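(* Let $N\ge 3$, $2\le p<N$, $p<r<p+\frac{p^2}{N}$, $a>0$, and let $\Omega\subset\mathbb{R}^N$ be an exterior domain. Put $S(a)=\{u\in W_0^{1,p}(\Omega):\int_\Omega|u|^p\,dx=a\}$, $\mathcal{J}(u)=\frac1p\int_\Omega|\nabla u|^p\,dx-\frac1r\int_\Omega|u|^r\,dx$ and $m(a)=\inf\{\mathcal{J}(u):u\in S(a)\}$. Then $m(a)$ is not attained, i.e. there is no $u\in S(a)$ with $\mathcal{J}(u)=m(a)$.
   Context: An exterior domain means a domain $\Omega\subset\mathbb{R}^N$ with smooth boundary $\partial\Omega\neq\emptyset$ such that $\mathbb{R}^N\setminus\Omega$ is bounded. Functions are real-valued. *)

(* Defs.v *)
From HB Require Import structures.
From mathcomp Require Import all_boot all_order all_algebra.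
From mathcomp Require Import all_classical all_reals all_analysis.

Set Implicit Arguments.
Unset Strict Implicit.
Unset Printing Implicit Defensive.
Import Order.TTheory GRing.Theory Num.Theory.
Import numFieldNormedType.Exports.

Local Open Scope classical_set_scope.
Local Open Scope ring_scope.

Section rV_measurable.
Context {d} {T : measurableType d} {n : nat}.

Definition rV_coord (i : 'I_n) (x : 'rV[T]_n) : T := x ord0 i.

Let rV_measurable0 : g_sigma_preimage rV_coord set0.
Proof. exact: sigma_algebra0. Qed.

Let rV_measurableC A : g_sigma_preimage rV_coord A -> g_sigma_preimage rV_coord (~` A).
Proof. exact: sigma_algebraC. Qed.

Let rV_measurable_bigcup (F : (set 'rV[T]_n)^nat) :
  (forall i, g_sigma_preimage rV_coord (F i)) ->
  g_sigma_preimage rV_coord (\bigcup_i (F i)).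
Proof. exact: sigma_algebra_bigcup. Qed.

(* The product sigma-algebra, as the library does for [n.-tuple T]; for
   T = R this is the Borel sigma-algebra of R^n. *)
HB.instance Definition _ := @isMeasurable.Build (measure_tuple_display d)
  'rV[T]_n (g_sigma_preimage rV_coord)
  rV_measurable0 rV_measurableC rV_measurable_bigcup.

End rV_measurable.

Lemma measurable_rV_coord d (T : measurableType d) n (i : 'I_n) :
  measurable_fun [set: 'rV[T]_n] (fun x => x ord0 i).
Proof.
move=> _ Y mY; rewrite setTI; apply: sub_sigma_algebra => /=.
rewrite -bigcup_seq/=; exists i => /=; first by rewrite mem_index_enum.
by exists Y => //; rewrite setTI.
Qed.

Lemma measurable_fun_rVP d d' (T1 : measurableType d) (T2 : measurableType d')
    n (f : T1 -> 'rV[T2]_n) :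
  (forall i, measurable_fun [set: T1] (fun x => f x ord0 i)) ->
  measurable_fun [set: T1] f.
Proof.
move=> mf _ A mA.
suff : g_sigma_preimage (fun i => rV_coord i \o f) `<=` measurable.
  by rewrite g_sigma_preimage_comp; apply; exists A.
apply: smallest_sub; first exact: sigma_algebra_measurable.
rewrite -bigcup_seq; apply: bigcup_sub => i _.
by move=> B [C mC <-]; exact: mf.
Qed.

(** Lebesgue measure on R^n, by induction on n: L^0 is the unit mass, and
    L^(n+1) is the product L^1 x L^n transported to ['rV[R]_n.+1]. *)

Section lebesgue_rV_step.
Context {R : realType} {n : nat}.

Definition cons_rV (z : measurableTypeR R * 'rV[R]_n) : 'rV[R]_n.+1 :=
  row_mx (const_mx z.1 : 'rV[R]_1) z.2.

Lemma cons_rV0 z : cons_rV z ord0 ord0 = z.1.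
Proof.
have := row_mxEl (const_mx z.1 : 'rV[R]_1) z.2 ord0 ord0.
by rewrite [RHS]mxE => <-; congr (row_mx _ _ _ _); exact/val_inj.
Qed.

Lemma cons_rVS z i : cons_rV z ord0 (lift ord0 i) = z.2 ord0 i.
Proof.
have := row_mxEr (const_mx z.1 : 'rV[R]_1) z.2 ord0 i.
by move=> <-; congr (row_mx _ _ _ _); exact/val_inj.
Qed.

Lemma measurable_cons_rV : measurable_fun setT cons_rV.
Proof.
apply: measurable_fun_rVP => i; case: (unliftP ord0 i) => [j|] ->.
- under eq_fun do rewrite cons_rVS.
  apply: (@measurableT_comp _ _ _ _ _ _ (fun x : 'rV[R]_n => x ord0 j)) => //.
  exact: measurable_rV_coord.
- under eq_fun do rewrite cons_rV0.
  exact: measurable_fst.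
Qed.

Variable mu : {sigma_finite_measure set 'rV[R]_n -> \bar R}.

Definition lebesgue_rV_step : set 'rV[R]_n.+1 -> \bar R :=
  pushforward (@lebesgue_measure R \x mu)%E cons_rV.

Let step0 : lebesgue_rV_step set0 = 0%E.
Proof. by rewrite /lebesgue_rV_step /pushforward preimage_set0 measure0. Qed.

Let step_ge0 A : (0 <= lebesgue_rV_step A)%E.
Proof. by rewrite /lebesgue_rV_step /pushforward; exact: measure_ge0. Qed.

Let step_sigma_additive : semi_sigma_additive lebesgue_rV_step.
Proof.
move=> F mF tF mUF; rewrite /lebesgue_rV_step /pushforward preimage_bigcup.
apply: measure_semi_sigma_additive.
- by move=> k; rewrite -[X in measurable X]setTI; exact: measurable_cons_rV.
- apply/trivIsetP => /= i j _ _ ij; rewrite -preimage_setI.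
  by move/trivIsetP : tF => /(_ _ _ _ _ ij) ->//; rewrite preimage_set0.
- by rewrite -preimage_bigcup -[X in measurable X]setTI; exact: measurable_cons_rV.
Qed.

HB.instance Definition _ := isMeasure.Build _ _ _ lebesgue_rV_step
  step0 step_ge0 step_sigma_additive.

Lemma lebesgue_rV_stepE (A : set R) (B : set 'rV[R]_n) :
  measurable A -> measurable B ->
  lebesgue_rV_step [set x | A (x ord0 ord0) /\
    B (\row_i x ord0 (lift ord0 i))] = (lebesgue_measure A * mu B)%E.
Proof.
move=> mA mB; rewrite /lebesgue_rV_step /pushforward.
rewrite [X in (_ \x _)%E X](_ : _ = A `*` B) ?product_measure1E//.
apply/seteqP; split => z /=; rewrite cons_rV0;
  by rewrite (_ : \row_i _ = z.2)//; apply/rowP => i; rewrite mxE cons_rVS.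
Qed.

Let step_sigma_finite : sigma_finite setT lebesgue_rV_step.
Proof.
have /sigma_finiteP[F [TF ndF Foo]] := sigma_finiteT (@lebesgue_measure R).
have /sigma_finiteP[G [TG ndG Goo]] := sigma_finiteT mu.
exists (fun k => [set x : 'rV[R]_n.+1 | F k (x ord0 ord0) /\
                    G k (\row_i x ord0 (lift ord0 i))]).
  rewrite predeqE => x; split => // _.
  have : [set: R] (x ord0 ord0) by [].
  rewrite TF => -[k _ Fk].
  have : [set: 'rV[R]_n] (\row_i x ord0 (lift ord0 i)) by [].
  rewrite TG => -[l _ Gl].
  exists (maxn k l) => //; split.
  - by move: (x _ _) Fk; exact/subsetPset/ndF/leq_maxl.
  - by move: (\row__ _) Gl; exact/subsetPset/ndG/leq_maxr.
move=> k; have [mF Fk] := Foo k; have [mG Gk] := Goo k; split.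
  apply: measurableI.
  - rewrite -[X in measurable X]setTI.
    exact: (@measurable_rV_coord _ _ n.+1 ord0).
  - rewrite -[X in measurable X]setTI.
    suff : measurable_fun [set: 'rV[R]_n.+1]
        (fun x => (\row_i x ord0 (lift ord0 i)) : 'rV[R]_n) by apply.
    apply: measurable_fun_rVP => i; under eq_fun do rewrite mxE.
    exact: measurable_rV_coord.
by rewrite lebesgue_rV_stepE// lte_mul_pinfty// ge0_fin_numE.
Qed.

HB.instance Definition _ := Measure_isSigmaFinite.Build _ _ _ lebesgue_rV_step
  step_sigma_finite.

End lebesgue_rV_step.

Fixpoint lebesgue_rV (R : realType) (n : nat) :
    {sigma_finite_measure set 'rV[R]_n -> \bar R} :=
  if n is m.+1 then lebesgue_rV_step (lebesgue_rV R m) else \d_(0 : 'rV[R]_0).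

Lemma measurable_box (R : realType) n (A : 'I_n -> set R) :
  (forall i, measurable (A i)) ->
  measurable [set x : 'rV[R]_n | forall i, A i (x ord0 i)].
Proof.
move=> mA; rewrite (_ : [set x | _] =
    \bigcap_(i in [set: 'I_n]) [set x : 'rV[R]_n | A i (x ord0 i)]); last first.
  by apply/seteqP; split => [x Ax i _|x Ax i]; exact: Ax.
apply: fin_bigcap_measurable => [|i _]; first exact: finite_finset.
by have := @measurable_rV_coord _ R n i measurableT _ (mA i); rewrite setTI.
Qed.

Lemma lebesgue_rV_box (R : realType) n (A : 'I_n -> set R) :
  (forall i, measurable (A i)) ->
  lebesgue_rV R n [set x | forall i, A i (x ord0 i)] =
  (\prod_(i < n) lebesgue_measure (A i))%E.
Proof.
elim: n A => [|n IHn] A mA.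
  by rewrite big_ord0 /= diracE mem_set// => -[].
rewrite big_ord_recl -IHn//=.
have mB := measurable_box (fun i => mA (lift ord0 i)).
rewrite -(lebesgue_rV_stepE _ (mA ord0) mB).
congr (lebesgue_rV_step _ _); apply/seteqP; split => x /=.
  by move=> Ax; split => // i; rewrite mxE.
move=> [A0 AS] i; case: (unliftP ord0 i) => [j|] ->//.
by have := AS j; rewrite mxE.
Qed.

Definition partial (R : realType) n (i : 'I_n) (f : 'rV[R]_n -> R) :
    'rV[R]_n -> R :=
  fun x => 'D_(delta_mx ord0 i) f x.

Definition smooth (R : realType) n (f : 'rV[R]_n -> R) := forall s : seq 'I_n,
  let g := foldr (@partial R n) f s in
  continuous g /\ forall x i, derivable g x (delta_mx ord0 i).

Definition boundary (T : topologicalType) (A : set T) := closure A `\` A^°.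

(* Near each boundary point, up to relabelling the coordinates and reversing
   one of them, Omega is the strict epigraph of a smooth function of the
   remaining n - 1 coordinates [col' i y]. *)
Definition smooth_boundary (R : realType) n (Omega : set 'rV[R]_n) :=
  forall x, boundary Omega x ->
  exists (i : 'I_n) (b : bool) (gamma : 'rV[R]_n.-1 -> R), smooth gamma /\
    \forall y \near x, Omega y <-> gamma (col' i y) < (-1) ^+ b * y ord0 i.

Definition exterior_domain (R : realType) n (Omega : set 'rV[R]_n) :=
  [/\ open Omega, connected Omega, bounded_set (~` Omega),
      boundary Omega !=set0 & smooth_boundary Omega].

(** Elements of the function spaces on Omega are represented by functions on
    R^n that are Borel on Omega; their values off Omega are irrelevant. *)

Section sobolev.
Context {R : realType} {n : nat}.
Variable Omega : set 'rV[R]_n.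
Implicit Types (u v phi : 'rV[R]_n -> R) (p : R).
Local Open Scope ereal_scope.

Local Notation mu := (lebesgue_rV R n).

Definition test_function phi :=
  let supp := closure [set x | phi x != 0%R] in
  [/\ smooth phi, compact supp & supp `<=` Omega].

Definition locally_integrable_rV u := measurable_fun Omega u /\
  forall K, K `<=` Omega -> compact K -> \int[mu]_(x in K) `|u x|%:E < +oo.

Definition is_weak_gradient u (g : 'rV[R]_n -> 'rV[R]_n) :=
  locally_integrable_rV u /\
  forall i, locally_integrable_rV (fun x => g x ord0 i) /\
    forall phi, test_function phi ->
      \int[mu]_(x in Omega) (u x * partial i phi x)%:E =
      - \int[mu]_(x in Omega) (g x ord0 i * phi x)%:E.

(* Unique up to a null set of Omega; the junk value is 0. *)
Definition weak_gradient u : 'rV[R]_n -> 'rV[R]_n :=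
  xget (fun=> 0%R) [set g | is_weak_gradient u g].

(* The library's norm [`|v|] on ['rV[R]_n] is the sup norm. *)
Definition euclidean_norm (v : 'rV[R]_n) : R :=
  Num.sqrt (\sum_i v ord0 i ^+ 2)%R.

Definition Lp p u := u \_ Omega \in Lfun mu p%:E.

Definition W1p p u := Lp p u /\
  exists2 g, is_weak_gradient u g & forall i, Lp p (fun x => g x ord0 i).

Definition W1p_norm p u : \bar R :=
  (\int[mu]_(x in Omega) (`|u x| `^ p)%:E +
   \int[mu]_(x in Omega) (euclidean_norm (weak_gradient u x) `^ p)%:E) `^ p^-1.

Definition W01p p u := W1p p u /\
  forall e : R, (0 < e)%R ->
  exists2 phi, test_function phi & W1p_norm p (u \- phi)%R < e%:E.

End sobolev.

Section problem.
Context {R : realType} {n : nat}.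
Variables (Omega : set 'rV[R]_n) (p r : R).
Local Open Scope ereal_scope.

Local Notation mu := (lebesgue_rV R n).

Definition sphere (a : R) : set ('rV[R]_n -> R) :=
  [set u | W01p Omega p u /\ \int[mu]_(x in Omega) (`|u x| `^ p)%:E = a%:E].

Definition energy (u : 'rV[R]_n -> R) : \bar R :=
  (p^-1)%:E *
    \int[mu]_(x in Omega) (euclidean_norm (weak_gradient Omega u x) `^ p)%:E -
  (r^-1)%:E * \int[mu]_(x in Omega) (`|u x| `^ r)%:E.

Definition min_energy (a : R) : \bar R :=
  ereal_inf [set energy u | u in sphere a].

End problem.

(* Main.v *)
Require Import Defs.
From mathcomp Require Import all_boot all_order all_algebra.
From mathcomp Require Import all_classical all_reals all_analysis.
From mathcomp Require Import measurable_realfun.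
From mathcomp Require Import ring lra.

(* Suppose u is a minimizer. By a weak type inequality (translate averages over
   cubes against the gradient) the L^r norm of u is finite, and u is approximated
   by test functions w >= 0 with mass, energy and distance to |u| under control.

   Filling a large cube Q up to height eps, i.e. passing from w to a smooth version
   v of max(w, eps), costs O(eps^p) in the Dirichlet integral but saves a fixed
   proportion of the integral of |grad w|^p over Q /\ {w < eps}. The competitor v
   does not vanish on the complement of Omega, but this set is bounded, so a
   translate of v is a test function on Omega; rescaled to mass a, it is admissible
   and minimality of u gives that this integral is O(eps^p).

   Hence grad(T(w / eps)), for a cutoff T rising on [1/2, 1], is bounded in L^p(Q)
   uniformly in eps, and it lives on {eps/2 < w < eps}, a set of vanishing measure:
   its L^1 norm tends to 0. Since T(w / eps) vanishes on a fixed box outside Omega,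
   integration by parts shows that the integral of T(w / eps) over Q tends to 0, so
   u = 0 a.e., contradicting a > 0. No regularity theory is needed. *)

Set Implicit Arguments.
Unset Strict Implicit.
Unset Printing Implicit Defensive.
Import Order.TTheory GRing.Theory Num.Theory.
Import numFieldNormedType.Exports.

Local Open Scope classical_set_scope.
Local Open Scope ring_scope.

(** * Lebesgue measure on R^n *)

(** The natural contradiction would be a strong maximum principle for the minimizer extended by
    zero. What replaces it is a comparison at order eps^p, the scale at which the gradient of w /
    eps is bounded in L^p. Adding mass of order eps^p is affordable: rescaling back changes the
    Dirichlet and r-th power terms by a relative error of the same order, and filling only increases
    the r-th powers.

    The saving comes from convexity: on {w < eps} the gradient of the filled function is a convex
    combination of grad w and eps grad eta, where the weight of the second is bounded below.

    An L^p bound on a small set yields a small L^1 norm through t <= q + q^(1-p) t^p: q is taken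
    large, which uses p > 1, and eps small afterwards. The band {eps/2 < w < eps} is small because,
    up to a small exceptional set, it lies in {0 < |u| < 2 eps}, and these sets shrink to the empty
    set. The condition r < p + p^2/N lets the weak bound of exponent p + p^2/N imply a finite L^r
    norm, so that the minimal energy is a real number. *)

Section box.
Context {R : realType} {n : nat}.
Implicit Types (a b : 'I_n -> R).

Definition box a b : set 'rV[R]_n := [set x | forall i, a i < x ord0 i < b i].

Lemma boxE a b :
  box a b = [set x | forall i, `]a i, b i[%classic (x ord0 i)].
Proof. by apply/seteqP; split=> x bx i; have := bx i; rewrite /= in_itv. Qed.

Lemma measurable_obox a b : measurable (box a b).
Proof. by rewrite boxE; exact: (@measurable_box _ _ (fun i => `]a i, b i[%classic)). Qed.

Lemma boxI a b a' b' : box a b `&` box a' b' =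
  box (fun i => Num.max (a i) (a' i)) (fun i => Num.min (b i) (b' i)).
Proof.
apply/seteqP; split => [x [h h'] i|x h].
  have /andP[? ?] := h i; have /andP[? ?] := h' i.
  by rewrite gt_max lt_min; apply/andP; split; apply/andP.
by split=> i; have := h i; rewrite gt_max lt_min => /andP[/andP[? ?] /andP[? ?]]; apply/andP.
Qed.

Lemma bigcup_box : \bigcup_k box (fun=> - k%:R) (fun=> k%:R) = setT.
Proof.
rewrite -subTset => x _.
have [k xk] : exists k : nat, forall i, `|x ord0 i| < k%:R.
  exists (\max_i (Num.bound (x ord0 i))) => i.
  apply: lt_le_trans (archi_boundP _) _ => //.
  rewrite ler_nat -[leqRHS]/(\max_i _)%N.
  apply: leq_trans (leq_bigmax i); rewrite /Num.bound.
  by rewrite normr_id.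
by exists k => // i; have := xk i; rewrite ltr_norml.
Qed.

(** A half space c < x_i is a countable union of boxes, so the open boxes generate. They also form a
    pi-system, on which uniqueness of measures and Dynkin induction can run. *)
Lemma rV_measurableE :
  @measurable _ 'rV[R]_n = <<s [set B | exists ab, B = box ab.1 ab.2] >>.
Proof.
set G := [set B | _].
apply/seteqP; split; last first.
  apply: smallest_sub; first exact: sigma_algebra_measurable.
  by move=> _ [ab ->]; exact: measurable_obox.
have sG : sigma_algebra setT (<<s G >>) by exact: smallest_sigma_algebra.
apply: smallest_sub => //.
rewrite -bigcup_seq; apply: bigcup_sub => i _.
move=> _ [B mB <-].
suff : measurable_fun [set: g_sigma_algebraType G] (rV_coord i : _ -> R).
  by move=> /(_ measurableT B mB).
apply: (measurability _ (RGenOInfty.measurableE R)) => //.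
move=> _ [_ [c ->] <-]; rewrite setTI.
rewrite (_ : _ @^-1` _ = \bigcup_k
   box (fun j => if j == i then c else - k%:R) (fun=> k%:R)).
  apply: bigcupT_measurable => k; apply: sub_sigma_algebra.
  by exists (fun j => if j == i then c else - k%:R, fun=> k%:R).
apply/seteqP; split=> x /=.
  rewrite /rV_coord in_itv/= andbT => cx.
  have : [set: 'rV[R]_n] x by [].
  rewrite -bigcup_box => -[k _ xk]; exists k => // j.
  by have /andP[xj xj'] := xk j; case: eqP => [->|_]; apply/andP; split=> //; have /andP[] := xk i.
by move=> [k _ /(_ i)]; rewrite eqxx /rV_coord in_itv/= andbT => /andP[].
Qed.

Lemma rV_measure_unique (m1 m2 : {measure set 'rV[R]_n -> \bar R}) :
  (forall a b, m1 (box a b) = m2 (box a b)) ->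
  (forall k : nat, (m1 (box (fun=> - k%:R)%R (fun=> k%:R)%R) < +oo)%E) ->
  forall A, measurable A -> m1 A = m2 A.
Proof.
move=> m12 m1oo A mA.
apply: (measure_unique _ (fun k => box (fun=> - k%:R) (fun=> k%:R)) rV_measurableE) => //.
- by move=> _ _ [ab ->] [cd ->]; rewrite boxI; eexists (_, _).
- by move=> k; exists ((fun=> - k%:R), (fun=> k%:R)).
- exact: bigcup_box.
- by move=> _ [[a b] ->]; exact: m12.
Qed.

Lemma lebesgue_box a b :
  lebesgue_rV R n (box a b) = (\prod_(i < n) lebesgue_measure (`]a i, b i[ : set R))%E.
Proof. by rewrite boxE (@lebesgue_rV_box _ _ (fun i => `]a i, b i[%classic)). Qed.

Lemma lebesgue_box_fin a b : (lebesgue_rV R n (box a b) < +oo)%E.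
Proof.
rewrite lebesgue_box ltey_eq; apply/orP; left.
elim/big_ind: _ => // [x y|i _]; first exact: fin_numM.
rewrite lebesgue_measure_itv/=; case: ifP => //.
Qed.

End box.

Section topology_rV.
Context {R : realType} {n : nat}.

Lemma ballrVP (x y : 'rV[R]_n) (e : R) :
  0 < e -> ball x e y <-> forall i, `|x ord0 i - y ord0 i| < e.
Proof.
move=> e0; split=> [[_ xy] i|h]; first exact: xy.
by split => // i j; rewrite (ord1 i); exact: h.
Qed.

Definition cbox (a b : 'I_n -> R) : set 'rV[R]_n :=
  [set x | forall i, a i <= x ord0 i <= b i].

Lemma compact_cbox a b : compact (cbox a b).
Proof.
rewrite (_ : cbox a b = [set x | forall i, `[a i, b i]%classic (x ord0 i)]).
  exact: (@rV_compact _ _ (fun i => `[a i, b i]%classic) (fun i => @segment_compact R _ _)).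
by apply/seteqP; split=> x bx i; have := bx i; rewrite /= in_itv.
Qed.

(** Boxes with rational centre and half side 1/(k+1), enumerated through [unpickle]; a code that
    decodes to nothing, or to a box whose closure leaves [U], contributes the empty set. Having the
    closed box inside [U] is what later turns bumps on it into test functions. *)
Lemma open_bigcup_box (U : set 'rV[R]_n) : open U ->
  exists2 D : nat -> set 'rV[R]_n, U = \bigcup_k D k &
    forall k, D k = set0 \/ exists a b, D k = box a b /\ cbox a b `<=` U.
Proof.
move=> oU.
pose lo (q : 'rV[rat]_n * nat) i : R := ratr (q.1 ord0 i) - q.2.+1%:R^-1.
pose hi (q : 'rV[rat]_n * nat) i : R := ratr (q.1 ord0 i) + q.2.+1%:R^-1.
pose D k := oapp (fun q => if `[< cbox (lo q) (hi q) `<=` U >]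
  then box (lo q) (hi q) else set0) set0 (unpickle k).
exists D; last first.
  move=> k; rewrite /D; case: unpickle => /= [q|]; last by left.
  by case: asboolP => qU; [right; exists (lo q), (hi q)|left].
apply/seteqP; split=> [x Ux|x [k _]]; last first.
  rewrite /D; case: unpickle => //= q; case: ifP => // /asboolP qU xq.
  by apply: qU => i; have /andP[/ltW -> /ltW ->] := xq i.
suff [q Bx BU] : exists2 q, box (lo q) (hi q) x & cbox (lo q) (hi q) `<=` U.
  exists (pickle q) => //; rewrite /D pickleK /=; case: ifPn => // /negP[].
  exact/asboolP.
have /nbhs_ballP[e /= e0 xeU] := open_nbhs_nbhs (conj oU Ux).
have [k ke] : exists k : nat, k.+1%:R^-1 < e / 2.
  exists (Num.bound (e / 2)^-1); rewrite invf_plt ?posrE ?divr_gt0//.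
  by apply: lt_trans (archi_boundP _) _; rewrite ?ltr_nat// invr_ge0 divr_ge0// ltW.
have [h hE] : exists h : R, h = k.+1%:R^-1 by exists k.+1%:R^-1.
have h0 : 0 < h by rewrite hE.
rewrite -hE in ke.
have /choice[q hq] (i : 'I_n) : exists q : rat, `|x ord0 i - ratr q| < h.
  have [|q] := @rat_in_itvoo R (x ord0 i - h) (x ord0 i + h); first by lra.
  by rewrite in_itv/= => /andP[? ?]; exists q; rewrite ltr_norml; lra.
exists (\row_i q i, k).
  by move=> i; have := hq i; rewrite /lo /hi mxE/= -hE ltr_norml => /andP[? ?]; lra.
move=> y By; apply: xeU; apply/ballrVP => // i.
have := By i; have := hq i; rewrite /lo /hi mxE/= -hE ltr_norml.
by move=> /andP[? ?] /andP[? ?]; rewrite ltr_norml; lra.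
Qed.

Lemma open_measurable_rV (U : set 'rV[R]_n) : open U -> measurable U.
Proof.
move=> /open_bigcup_box[D -> DP]; apply: bigcupT_measurable => k.
by have [->|[a [b [-> _]]]] := DP k => //; exact: measurable_obox.
Qed.

Lemma continuous_measurable_rV (f : 'rV[R]_n -> R) :
  continuous f -> measurable_fun setT f.
Proof.
move=> /continuousP cf; apply: (measurability _ (RGenOpens.measurableE R)).
by move=> _ [_ [a [b ->] <-]]; rewrite setTI; apply: open_measurable_rV; apply: cf; exact: interval_open.
Qed.

Lemma compact_measurable_rV (K : set 'rV[R]_n) : compact K -> measurable K.
Proof.
move=> /compact_closed cK; rewrite -[K]setCK; apply: measurableC.
by apply: open_measurable_rV; rewrite openC; apply: cK; exact: norm_hausdorff.
Qed.

Lemma bounded_boxP (A : set 'rV[R]_n) :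
  bounded_set A -> exists2 k : nat, (0 < k)%N & A `<=` box (fun=> - k%:R) (fun=> k%:R).
Proof.
move=> [M [Mr hM]].
pose k := (Num.bound `|M + 1|).+1; exists k => // x Ax i.
have Mk : M + 1 < k%:R.
  apply: le_lt_trans (ler_norm _) _; apply: lt_trans (archi_boundP _) _ => //.
  by rewrite ltr_nat.
have /= xM : `|x| <= M + 1 by apply: hM => //; lra.
have : `|x ord0 i| <= `|x|.
  by rewrite [leRHS]mx_normrE; exact: (le_bigmax _ (fun ij : 'I_1 * 'I_n => `|x ij.1 ij.2|) (ord0, i)).
rewrite -ltr_norml; lra.
Qed.

Lemma subset_box_bounded (A : set 'rV[R]_n) (k : R) :
  (forall x, A x -> forall i, `|x ord0 i| <= k) -> bounded_set A.
Proof.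
move=> Ak; exists (Num.max k 0); split; first exact: num_real.
move=> x kx y Ay /=; rewrite [leLHS]mx_normrE; apply/bigmax_leP; split => /=.
  by apply: le_trans (ltW kx); rewrite le_max lexx orbT.
move=> [i j] _ /=; rewrite (ord1 i); apply: le_trans (Ak _ Ay _) _.
by apply: le_trans (ltW kx); rewrite le_max lexx.
Qed.

End topology_rV.

Section shift.
Context {R : realType} {n : nat}.
Implicit Type v : 'rV[R]_n.

Lemma measurable_fun_shift v : measurable_fun setT (fun x : 'rV[R]_n => x + v).
Proof.
apply: measurable_fun_rVP => i; under eq_fun do rewrite mxE.
by apply: measurable_funD => //; exact: measurable_rV_coord.
Qed.

(** Translation preserves the side lengths of a box, and measures that agree on boxes are equal. *)
Lemma lebesgue_rV_shift v (B : set 'rV[R]_n) : measurable B ->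
  lebesgue_rV R n ((fun x => x + v) @^-1` B) = lebesgue_rV R n B.
Proof.
move=> mB.
have preE a b : (fun x => x + v) @^-1` box a b =
    box (fun i => a i - v ord0 i) (fun i => b i - v ord0 i).
  by apply/seteqP; split=> x h i; have := h i; rewrite /= mxE ltrBlDr ltrBrDr.
have pE a b : pushforward (lebesgue_rV R n) (fun x => x + v) (box a b) =
              lebesgue_rV R n (box a b).
  rewrite /pushforward preE !lebesgue_box; apply: eq_bigr => i _.
  rewrite !lebesgue_measure_itv/= !lte_fin ltrD2r.
  by case: ifP => // _; rewrite -!EFinB; congr EFin; ring.
have mf := measurable_fun_shift v.
unshelve refine (@rV_measure_unique R n
  (pushforward (lebesgue_rV R n) (fun x => x + v)) (lebesgue_rV R n) _ _ B mB) => //=.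
by move=> k; rewrite pE lebesgue_box_fin.
Qed.

Lemma integral_shift v (f : 'rV[R]_n -> \bar R) : measurable_fun setT f ->
  (forall x, 0 <= f x)%E ->
  (\int[lebesgue_rV R n]_x f (x + v)%R = \int[lebesgue_rV R n]_x f x)%E.
Proof.
move=> mf f0.
rewrite -(@ge0_integral_pushforward _ _ _ _ _ _ (measurable_fun_shift v) (lebesgue_rV R n) setT f)//.
have mf' := measurable_fun_shift v.
unshelve refine (eq_measure_integral (m1 := pushforward (lebesgue_rV R n) (fun x => x + v))
  (lebesgue_rV R n) _) => // B mB _.
exact: lebesgue_rV_shift.
Qed.

End shift.

(** * Smooth functions *)

Section directional.
Context {R : realType}.

(** A directional derivative sees only the line through x. Restricting to that line makes the
    one-variable chain rule available. *)
Lemma is_derive_lineP (V : normedModType R) (f : V -> R) (x v : V) df :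
  is_derive x v f df <-> is_derive (0 : R) 1 (fun t : R => f (t *: v + x)) df.
Proof.
have E : 'D_v f x = 'D_1 (fun t : R => f (t *: v + x)) 0.
  rewrite /derive; set g1 := fun h => h^-1 *: _; set g2 := fun h => h^-1 *: _.
  suff -> : g1 = g2 by [].
  by rewrite funeqE /g1 /g2 => h /=; rewrite addr0 scale0r add0r [_%:A]mulr1.
split=> [[/derivable1P df1 <-]|[df1 <-]]; first by split.
by split; [exact/derivable1P|].
Qed.

Context {V : normedModType R}.
Implicit Types (f : V -> R) (x v : V).

Lemma is_derive_at f x v df (t : R) :
  is_derive (t *: v + x) v f df <-> is_derive t 1 (fun s : R => f (s *: v + x)) df.
Proof.
apply: (iff_trans (is_derive_lineP _ _ _ _)).
apply: iff_trans; last exact: (iff_sym (is_derive_lineP _ _ _ _)).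
rewrite (_ : (fun s : R => f (s *: v + (t *: v + x))) =
             (fun s : R => f ((s *: 1 + t) *: v + x)))//.
by apply/funext => s; rewrite scalerDl -addrA [_%:A]mulr1.
Qed.

Lemma is_derive_comp_dir (h : R -> R) f x v dh df :
  is_derive (f x) 1 h dh -> is_derive x v f df ->
  is_derive x v (fun y => h (f y)) (dh * df).
Proof.
move=> hh /is_derive_lineP hf; apply/is_derive_lineP.
apply: (is_derive_eq (is_derive1_comp (f := h) (g := fun t : R => f (t *: v + x)) _ _)).
  by rewrite scale0r add0r; exact: hh.
by rewrite /= mulrC.
Qed.

Lemma is_deriveM_pt f g x v df dg :
  is_derive x v f df -> is_derive x v g dg ->
  is_derive x v (fun y => f y * g y) (df * g x + f x * dg).
Proof.
move=> hf hg; apply: (is_derive_eq (is_deriveM hf hg)).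
by rewrite addrC; congr (_ + _); exact: mulrC.
Qed.

Lemma is_deriveD_pt f g x v df dg :
  is_derive x v f df -> is_derive x v g dg ->
  is_derive x v (fun y => f y + g y) (df + dg).
Proof. by move=> hf hg; exact: is_deriveD. Qed.

Lemma is_derive_exprn k (t : R) : is_derive t 1 (fun s : R => s ^+ k) (k%:R * t ^+ k.-1).
Proof.
by split; [exact: exprn_derivable|rewrite exp_derive [_%:A]mulr1].
Qed.

End directional.

Lemma is_derive_affine (R : realType) (c d t : R) :
  is_derive t 1 (fun s : R => c * s + d) c.
Proof.
have h : is_derive t 1 (fun s : R => c * s) c.
  exact: (is_derive_eq (is_deriveZ c (is_derive_id t 1)) (mulr1 c)).
exact: (is_derive_eq (is_deriveD_pt h (is_derive_cst d t 1)) (addr0 c)).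
Qed.

Section flat.
Context {R : realType}.
Implicit Types (s : R) (k : nat).

(** The classical flat function exp(-1/s), divided by s^k. The index k closes the family under
    differentiation: the derivative of [flat k] is [flat k.+2] minus k times [flat k.+1]. In
    particular [flat 2] is the derivative of [flat 0]. *)
Definition flat k s : R := if 0 < s then expR (- s^-1) / s ^+ k else 0.

Lemma flat_le0 k s : s <= 0 -> flat k s = 0.
Proof. by move=> s0; rewrite /flat ltNge s0. Qed.

Lemma flat_gt0 k s : 0 < s -> 0 < flat k s.
Proof. by move=> s0; rewrite /flat s0 divr_gt0 ?expR_gt0 ?exprn_gt0. Qed.

Lemma flat_ge0 k s : 0 <= flat k s.
Proof. by case: (ltP 0 s) => [/(flat_gt0 k)/ltW//|/(flat_le0 k) ->]. Qed.

Lemma flatS k s : flat k s = s * flat k.+1 s.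
Proof.
rewrite /flat; case: ifPn => [s0|_]; last by rewrite mulr0.
by rewrite exprS; field; rewrite expf_neq0 ?gt_eqF.
Qed.

(** With x = 1/s this is x^(k+1) <= (k+1)! exp x, one term of the exponential series. It settles the
    derivative at 0, and for k = 0 it gives flat 0 s <= s for positive s. *)
Lemma flat_bound k s : flat k s <= k.+1`!%:R * `|s|.
Proof.
rewrite /flat; case: ifPn => [s0|_]; last by rewrite mulr_ge0.
rewrite gtr0_norm// expRN.
have := expR_ge1Dxn k (ltW (etrans (invr_gt0 s) s0)).
set E := expR _ => hE; have E0 : 0 < E by exact: expR_gt0.
have f0 : (0 : R) < k.+1`!%:R by rewrite ltr0n fact_gt0.
have sk : 0 < s ^+ k by rewrite exprn_gt0.
have {}hE : s^-1 ^+ k.+1 <= k.+1`!%:R * E.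
  by rewrite mulrC -ler_pdivrMr// (le_trans _ hE)// lerDr.
have : E^-1 * s^-1 ^+ k.+1 <= k.+1`!%:R.
  by rewrite ler_pdivrMl// mulrC.
rewrite exprS exprVn => hE'.
rewrite -ler_pdivrMr//; apply: le_trans hE'.
by rewrite mulrAC mulrA.
Qed.

Lemma is_derive_flat k s :
  is_derive s 1 (flat k) (flat k.+2 s - k%:R * flat k.+1 s).
Proof.
case: (ltgtP s 0) => s0.
- rewrite !flat_le0 ?ltW// mulr0 subrr.
  apply: near_eq_is_derive (is_derive_cst (0 : R) s 1) => //=.
  near=> t; rewrite flat_le0//.
  by near: t; apply: filterS (lt_nbhsl s0) => t /ltW.
- have D : is_derive s 1 (fun t : R => expR (- t^-1) * t^-1 ^+ k)
      (flat k.+2 s - k%:R * flat k.+1 s).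
    have sn0 : s != 0 by rewrite gt_eqF.
    have dV : is_derive s 1 (fun t : R => t^-1) (- s ^- 2).
      exact: (is_derive_eq (is_deriveV sn0 _) (scaler1 _)).
    have dE : is_derive s 1 (fun t : R => expR (- t^-1)) (expR (- s^-1) * s ^- 2).
      have dN : is_derive s 1 (fun t : R => - t^-1) (s ^- 2).
        by rewrite -[s ^- 2]opprK; exact: is_deriveN.
      exact: (@is_derive_comp_dir R _ expR (fun t : R => - t^-1) s 1 _ _
        (is_derive_expR _) dN).
    have dX := @is_derive_comp_dir R _ _ (fun t : R => t^-1) s 1 _ _
      (is_derive_exprn k s^-1) dV.
    apply: (is_derive_eq (is_deriveM_pt dE dX)).
    rewrite /flat s0 !exprVn; case: k {dX} => [|k] /=.
      by rewrite expr0 !exprS expr0; field.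
    rewrite !exprS expr0; move: (expf_neq0 k sn0) (k.+1%:R : R).
    by move: (s ^+ k) (expR _) => P E P0 c; field; rewrite P0.
  apply: near_eq_is_derive D.
  near=> t; rewrite /flat ifT ?exprVn//.
  by near: t; exact: lt_nbhsr.
- rewrite s0 !flat_le0// mulr0 subrr.
  have C : (fun h : R => h^-1 *: ((flat k \o shift 0) (h *: 1) - flat k 0)) @ 0^' --> (0 : R).
    apply: norm_cvg0.
    apply: (@squeeze_cvgr _ _ _ _ (fun=> 0) (fun h : R => k.+2`!%:R * `|h|)).
    + near=> h; have h0 : h != 0 by near: h; exact: nbhs_dnbhs_neq.
      (* Dividing by h raises the index: the difference quotient at 0 is [flat k.+1 h], which
         [flat_bound] squeezes to 0. *)
      rewrite normr_ge0 /= addr0 (flat_le0 k (lexx 0)) subr0 [h%:A]mulr1 flatS.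
      by rewrite scalerA mulVf// scale1r ger0_norm ?flat_ge0// flat_bound.
    + exact: cvg_cst.
    + have : (fun h : R => k.+2`!%:R * `|h|) @ (0:R) --> k.+2`!%:R * `|0 : R|.
        by apply: cvgM; [exact: cvg_cst|exact: norm_continuous].
      by rewrite normr0 mulr0; exact: cvg_within_filter.
  by split; [apply/cvg_ex; exists 0|exact/cvg_lim].
Unshelve. all: by end_near. Qed.

End flat.

Lemma continuous_flat (R : realType) k : continuous (@flat R k).
Proof.
move=> s; have [+ _] := is_derive_flat k s.
by move=> /derivable1_diffP/differentiable_continuous.
Qed.

Section smooth.
Context {R : realType} {n : nat}.
Implicit Types (f g : 'rV[R]_n -> R) (i : 'I_n) (k : nat).
Local Notation e_ i := (delta_mx ord0 i : 'rV[R]_n).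

(** C^k by recursion on k. Sums, products and compositions are handled by induction on k for all
    functions at once, whereas an induction along a fixed list of partial derivatives would not be
    stable under the product rule. *)
Fixpoint ck k f : Prop := continuous f /\
  if k is k'.+1 then
    forall i, (forall x, derivable f x (e_ i)) /\ ck k' (partial i f)
  else True.

Lemma smoothP f : smooth f <-> forall k, ck k f.
Proof.
split=> [sf k|].
  elim: k f sf => [|k IH] f sf; first by split => //; have [] := sf [::].
  have [cf df] := sf [::]; split => // i; split; first by move=> x; exact: df.
  by apply: IH => s; rewrite -foldr_rcons; exact: sf.
move=> + s; elim/last_ind: s f => [|s i IH] f cf.
  have [? _] := cf 0%N; have [_ df] := cf 1%N; split => // x i.
  by have [] := df i.
by rewrite /= foldr_rcons; apply: IH => k; have [_ /(_ i)[]] := cf k.+1.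
Qed.

Lemma ckS k f (g : 'I_n -> 'rV[R]_n -> R) : continuous f ->
  (forall i x, is_derive x (e_ i) f (g i x)) -> (forall i, ck k (g i)) ->
  ck k.+1 f.
Proof.
move=> cf fg cg; split => // i; split; first by move=> x; have [] := fg i x.
suff -> : partial i f = g i by [].
by apply/funext => x; rewrite /partial; have [] := fg i x.
Qed.

Lemma ck_continuous k f : ck k f -> continuous f.
Proof. by case: k => [|k] []. Qed.

Lemma ckW k f : ck k.+1 f -> ck k f.
Proof.
elim: k f => [|k IH] f [cf df]; first by split.
by split => // i; have [? ?] := df i; split => //; exact: IH.
Qed.

Lemma ck_is_derive k f i x : ck k.+1 f -> is_derive x (e_ i) f (partial i f x).
Proof. by move=> [_ /(_ i)[/(_ x) df _]]; exact: derivableP. Qed.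

Lemma ck_partial k f i : ck k.+1 f -> ck k (partial i f).
Proof. by move=> [_ /(_ i)[]]. Qed.

Lemma ck_cst k (c : R) : ck k (fun=> c).
Proof.
have cc (c' : R) : continuous (fun _ : 'rV[R]_n => c') by exact: cst_continuous.
elim: k c => [|k IH] c; first by split.
by apply: (@ckS _ _ (fun _ _ => 0)).
Qed.

Lemma ck_coord k i : ck k (fun x => x ord0 i).
Proof.
have cc : continuous (fun x : 'rV[R]_n => x ord0 i) by exact: coord_continuous.
case: k => [|k]; first by split.
apply: (@ckS _ _ (fun j _ => (j == i)%:R)) => // [j x|j]; last exact: ck_cst.
apply/is_derive_lineP.
rewrite (_ : (fun t : R => _) = (fun t : R => (j == i)%:R * t + x ord0 i)).
  exact: is_derive_affine.
by apply/funext => t; rewrite !mxE eqxx/= eq_sym mulrC.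
Qed.

Lemma ckD k f g : ck k f -> ck k g -> ck k (fun x => f x + g x).
Proof.
have cD f' g' k' : ck k' f' -> ck k' g' -> continuous (fun x => f' x + g' x).
  by move=> /ck_continuous cf /ck_continuous cg x; have := continuousD (cf x) (cg x); exact.
elim: k f g => [|k IH] f g cf cg.
  by split => //; exact: cD cf cg.
apply: (@ckS _ _ (fun i x => partial i f x + partial i g x)).
- exact: cD cf cg.
- by move=> i x; exact: (is_deriveD_pt (ck_is_derive i x cf) (ck_is_derive i x cg)).
- by move=> i; apply: IH; exact: ck_partial.
Qed.

Lemma ckM k f g : ck k f -> ck k g -> ck k (fun x => f x * g x).
Proof.
have cM f' g' k' : ck k' f' -> ck k' g' -> continuous (fun x => f' x * g' x).
  by move=> /ck_continuous cf /ck_continuous cg x; have := continuousM (cf x) (cg x); exact.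
elim: k f g => [|k IH] f g cf cg; first by split => //; exact: cM cf cg.
apply: (@ckS _ _ (fun i x => partial i f x * g x + f x * partial i g x)).
- exact: cM cf cg.
- by move=> i x; exact: (is_deriveM_pt (ck_is_derive i x cf) (ck_is_derive i x cg)).
- by move=> i; apply: ckD; apply: IH; (try exact: ck_partial); exact: ckW.
Qed.

Lemma ck_flat k j f : ck k f -> ck k (fun x => flat j (f x)).
Proof.
have cF j' f' k' : ck k' f' -> continuous (fun x => flat j' (f' x)).
  by move=> /ck_continuous cf x; have := continuous_comp (cf x) (@continuous_flat R j' (f' x)); exact.
elim: k j f => [|k IH] j f cf; first by split => //; exact: cF cf.
apply: (@ckS _ _ (fun i x =>
  (flat j.+2 (f x) + (- j%:R) * flat j.+1 (f x)) * partial i f x)).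
- exact: cF cf.
- move=> i x; rewrite mulNr.
  exact: (is_derive_comp_dir (is_derive_flat j (f x)) (ck_is_derive i x cf)).
- move=> i; apply: ckM; last exact: ck_partial.
  apply: ckD; first by apply: IH; exact: ckW.
  by apply: ckM; [exact: ck_cst|apply: IH; exact: ckW].
Qed.

Lemma smooth_cst (c : R) : smooth (fun _ : 'rV[R]_n => c).
Proof. by apply/smoothP => k; exact: ck_cst. Qed.

Lemma smooth_coord i : smooth (fun x : 'rV[R]_n => x ord0 i).
Proof. by apply/smoothP => k; exact: ck_coord. Qed.

Lemma smoothD f g : smooth f -> smooth g -> smooth (fun x => f x + g x).
Proof. by move=> /smoothP ? /smoothP ?; apply/smoothP => k; exact: ckD. Qed.

Lemma smoothM f g : smooth f -> smooth g -> smooth (fun x => f x * g x).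
Proof. by move=> /smoothP ? /smoothP ?; apply/smoothP => k; exact: ckM. Qed.

Lemma smooth_flat j f : smooth f -> smooth (fun x => flat j (f x)).
Proof. by move=> /smoothP ?; apply/smoothP => k; exact: ck_flat. Qed.

Lemma smoothZ (c : R) f : smooth f -> smooth (fun x => c * f x).
Proof. exact: (smoothM (smooth_cst c)). Qed.

Lemma smoothN f : smooth f -> smooth (fun x => - f x).
Proof.
move=> sf; rewrite (_ : (fun x => - f x) = (fun x => -1 * f x)).
  exact: (smoothZ (-1) sf).
by apply/funext => x; rewrite mulN1r.
Qed.

Lemma smoothB f g : smooth f -> smooth g -> smooth (fun x => f x - g x).
Proof. by move=> sf sg; exact: (smoothD sf (smoothN sg)). Qed.

Lemma smooth_prod (I : Type) (s : seq I) (P : pred I) (F : I -> 'rV[R]_n -> R) :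
  (forall j, smooth (F j)) -> smooth (fun x => \prod_(j <- s | P j) F j x).
Proof.
move=> sF; elim: s => [|j s IH].
  rewrite (_ : (fun x => _) = (fun=> 1)); first exact: smooth_cst.
  by apply/funext => x; rewrite big_nil.
rewrite (_ : (fun x => _) = (fun x => if P j
    then F j x * \prod_(j <- s | P j) F j x else \prod_(j <- s | P j) F j x)).
  by case: (P j); [exact: (smoothM (sF j) IH)|exact: IH].
by apply/funext => x; rewrite big_cons.
Qed.

Lemma smooth_continuous f : smooth f -> continuous f.
Proof. by move=> /(_ [::])[]. Qed.

Lemma smooth_is_derive f i x :
  smooth f -> is_derive x (e_ i) f (partial i f x).
Proof. by move=> /(_ [::])[_ /(_ x i)]; exact: derivableP. Qed.

Lemma smooth_partial f i : smooth f -> smooth (partial i f).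
Proof. by move=> /smoothP cf; apply/smoothP => k; exact: ck_partial. Qed.

Lemma partial_eq f i (g : 'rV[R]_n -> R) :
  (forall x, is_derive x (e_ i) f (g x)) -> partial i f = g.
Proof. by move=> fg; apply/funext => x; rewrite /partial; have [] := fg x. Qed.

Lemma partialM f g i : smooth f -> smooth g ->
  partial i (fun x => f x * g x) = fun x => partial i f x * g x + f x * partial i g x.
Proof.
move=> sf sg; apply: partial_eq => x.
exact: (is_deriveM_pt (smooth_is_derive i x sf) (smooth_is_derive i x sg)).
Qed.

Lemma partialD f g i : smooth f -> smooth g ->
  partial i (fun x => f x + g x) = fun x => partial i f x + partial i g x.
Proof.
move=> sf sg; apply: partial_eq => x.
exact: (is_deriveD_pt (smooth_is_derive i x sf) (smooth_is_derive i x sg)).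
Qed.

Lemma partialZ (c : R) f i : smooth f ->
  partial i (fun x => c * f x) = fun x => c * partial i f x.
Proof.
move=> sf; apply: partial_eq => x.
by exact: (is_deriveZ c (smooth_is_derive i x sf)).
Qed.

Lemma partialB f g i : smooth f -> smooth g ->
  partial i (fun x => f x - g x) = fun x => partial i f x - partial i g x.
Proof.
move=> sf sg; apply: partial_eq => x.
exact: (is_deriveB (smooth_is_derive i x sf) (smooth_is_derive i x sg)).
Qed.

Lemma partial_flat j f i : smooth f -> partial i (fun x => flat j (f x)) =
  fun x => (flat j.+2 (f x) - j%:R * flat j.+1 (f x)) * partial i f x.
Proof.
move=> sf; apply: partial_eq => x.
exact: (is_derive_comp_dir (is_derive_flat j (f x)) (smooth_is_derive i x sf)).
Qed.

Lemma partial_shift f i v :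
  partial i (fun x => f (x + v)) = fun x => partial i f (x + v).
Proof.
apply/funext => x; rewrite /partial /derive.
set g1 := fun h => h^-1 *: _; set g2 := fun h => h^-1 *: _.
suff -> : g1 = g2 by [].
by rewrite funeqE /g1 /g2 => h /=; rewrite addrA.
Qed.

Lemma smooth_shift f v : smooth f -> smooth (fun x => f (x + v)).
Proof.
have cs : continuous (fun x : 'rV[R]_n => x + v).
  by move=> x; apply: (@continuousD _ _ _ id (cst v)) => //; exact: cst_continuous.
have cfs g : continuous g -> continuous (fun x : 'rV[R]_n => g (x + v)).
  by move=> cg x; have := continuous_comp (cs x) (cg (x + v)); exact.
move=> /smoothP sf; apply/smoothP => k; elim: k f sf => [|k IH] f sf.
  by split => //; apply: cfs; have [] := sf 0%N.
have [cf df] := sf k.+1; split; first exact: cfs.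
move=> i; have [df1 _] := df i; split.
  move=> x; have := df1 (x + v); rewrite /derivable.
  set g1 := fun h => h^-1 *: _; set g2 := fun h => h^-1 *: _.
  suff -> : g1 = g2 by [].
  by rewrite funeqE /g1 /g2 => h /=; rewrite addrA.
rewrite partial_shift; apply: IH => k'; exact: (ck_partial i (sf k'.+1)).
Qed.

End smooth.

(** * Integration by parts *)

Lemma integrable_indic_fin d (T : measurableType d) (R : realType)
    (mu : {measure set T -> \bar R}) (B : set T) : measurable B ->
  (mu B < +oo)%E -> mu.-integrable setT (fun x => (\1_B x : R)%:E).
Proof.
move=> mB Boo; apply/integrableP; split; first exact/measurable_EFinP.
rewrite (eq_integral (fun x => (\1_B x)%:E)).
  by rewrite integral_indic// setIT.
by move=> t _; rewrite gee0_abs// lee_fin.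
Qed.

Section bounded_support.
Context {R : realType} {n : nat}.
Implicit Types (f g : 'rV[R]_n -> R) (i : 'I_n).
Local Notation mu := (lebesgue_rV R n).

Definition cube (k : nat) : set 'rV[R]_n := box (fun=> - k%:R) (fun=> k%:R).

(** Vanishing off a cube instead of compact support: no closure is involved, and the property passes
    to products, translates and partial derivatives. *)
Definition bsupp f := exists k, forall x, ~ cube k x -> f x = 0.

Lemma cubeP k x : cube k x <-> forall i, `|x ord0 i| < k%:R.
Proof. by split=> h i; have := h i; rewrite ltr_norml. Qed.

Lemma cubeS k l : (k <= l)%N -> cube k `<=` cube l.
Proof.
by move=> kl x /cubeP xk; apply/cubeP => i; rewrite (lt_le_trans (xk i))// ler_nat.
Qed.

Lemma bsuppW f k : (forall x, ~ cube k x -> f x = 0) ->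
  forall l, (k <= l)%N -> forall x, ~ cube l x -> f x = 0.
Proof. by move=> fk l kl x xl; apply: fk => /(cubeS kl). Qed.

Lemma mcube k : measurable (cube k).
Proof. exact: measurable_obox. Qed.

Lemma mu_cube k : (mu (cube k) < +oo)%E.
Proof. exact: lebesgue_box_fin. Qed.

Lemma compact_cube k : compact (closure (cube k)).
Proof.
apply: bounded_closed_compact; last exact: closed_closure.
apply: (@subset_box_bounded _ _ _ k%:R) => x xk i.
rewrite leNgt; apply/negP => kx.
have [|y [/cubeP yk /ballrVP]] := xk (ball x (`|x ord0 i| - k%:R)).
  by apply: nbhsx_ballx; rewrite subr_gt0.
rewrite subr_gt0 => /(_ kx)/(_ i).
have := yk i; have := ler_normD (x ord0 i - y ord0 i) (y ord0 i).
by rewrite subrK; lra.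
Qed.

Lemma bsupp_bounded f : continuous f -> bsupp f ->
  exists2 C, 0 <= C & forall x, `|f x| <= C.
Proof.
move=> cf [k fk].
have : compact (f @` closure (cube k)).
  apply: continuous_compact; last exact: compact_cube.
  exact: continuous_subspaceT.
move=> /compact_bounded[M [_ hM]].
exists (Num.max (M + 1) 0); first by rewrite le_max lexx orbT.
move=> x; case: (pselect (cube k x)) => [xk|/fk ->]; last first.
  by rewrite normr0 le_max lexx orbT.
rewrite le_max; apply/orP; left; apply: (hM (M + 1)); first by lra.
by exists x => //; exact: subset_closure.
Qed.

Lemma bsupp_integrable f : measurable_fun setT f -> bsupp f ->
  (exists C, forall x, `|f x| <= C) -> mu.-integrable setT (EFin \o f).
Proof.
move=> mf [k fk] [C fC].
apply: (@le_integrable _ _ _ _ _ measurableT _ (fun x => (C * \1_(cube k) x)%:E)).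
- exact/measurable_EFinP.
- move=> x _; rewrite /= lee_fin indicE.
  case: (pselect (cube k x)) => [xk|xk].
    by rewrite mem_set// mulr1 (le_trans (fC x))// ler_norm.
  by rewrite fk// normr0 normr_ge0.
- under eq_fun do rewrite EFinM.
  exact: (integrableZl measurableT C (integrable_indic_fin (mcube k) (mu_cube k))).
Qed.

Lemma cbsupp_integrable f : continuous f -> bsupp f ->
  mu.-integrable setT (EFin \o f).
Proof.
move=> cf sf; apply: bsupp_integrable => //; first exact: continuous_measurable_rV.
by have [C _ fC] := bsupp_bounded cf sf; exists C.
Qed.

Lemma bsuppM f g : bsupp f -> bsupp (fun x => f x * g x).
Proof. by move=> [k fk]; exists k => x /fk ->; rewrite mul0r. Qed.

Lemma bsuppMr f g : bsupp g -> bsupp (fun x => f x * g x).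
Proof. by move=> [k fk]; exists k => x /fk ->; rewrite mulr0. Qed.

Lemma bsupp_partial f i : bsupp f -> bsupp (partial i f).
Proof.
(* Off the cube [k.+1] the unit ball around x misses the cube [k], so f vanishes near x and not only
   at x. *)
move=> [k fk]; exists k.+1 => x xk; rewrite /partial.
have f0 : \near x, (fun=> 0) x = f x.
  have [j xj] : exists j, k.+1%:R <= `|x ord0 j|.
    apply: contrapT => /forallNP h; apply: xk; apply/cubeP => j.
    by have /negP := h j; rewrite -ltNge.
  apply/nbhs_ballP; exists 1 => //= y /ballrVP /(_ j) xy.
  apply/esym/fk => /cubeP /(_ j) yk.
  have := ler_normD (x ord0 j - y ord0 j) (y ord0 j); rewrite subrK.
  by move: xj; rewrite -natr1; lra.
by rewrite -(near_eq_derive _ f0) derive_cst.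
Qed.

End bounded_support.

Section difference_quotient.
Context {R : realType} {n : nat}.
Implicit Types (f g : 'rV[R]_n -> R) (i : 'I_n).
Local Notation mu := (lebesgue_rV R n).
Local Notation e_ i := (delta_mx ord0 i : 'rV[R]_n).

Definition dq i f (h : R) x := h^-1 * (f (x + h *: e_ i) - f x).

Lemma mean_value f i x h : smooth f -> 0 < h ->
  exists c, f (x + h *: e_ i) - f x = partial i f c * h.
Proof.
move=> sf h0.
have D (t : R) : is_derive t 1 (fun s : R => f (s *: e_ i + x)) (partial i f (t *: e_ i + x)).
  have D' := smooth_is_derive i (t *: e_ i + x) sf.
  exact: (iffLR (is_derive_at f x (e_ i) (partial i f (t *: e_ i + x)) t) D').
have [|c _] := MVT h0 (fun t _ => D t).
  apply: derivable_within_continuous => t _; by have [] := D t.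
rewrite scale0r add0r subr0 => E; exists (c *: e_ i + x).
by rewrite [x + _]addrC E.
Qed.

Lemma dq_cvg f i x (s : R) : smooth f -> 0 < s ->
  (fun k : nat => dq i f (s / k.+1%:R) x) @ \oo --> partial i f x.
Proof.
move=> sf s0.
have [+ <-] := smooth_is_derive i x sf.
move=> df; have hl : (fun h : R => h^-1 *: ((f \o shift x) (h *: e_ i) - f x)) @ 0^'
    --> 'D_(e_ i) f x by exact: df.
have sk : (fun k : nat => s / k.+1%:R) @ \oo --> (0 : R)^'.
  move=> P [e /= e0 hP]; suff : \forall k \near \oo, P (s / k.+1%:R) by [].
  near=> k.
  have h0 : 0 < s / k.+1%:R by rewrite divr_gt0.
  apply: hP; last by rewrite gt_eqF.
  rewrite /ball_/= sub0r normrN gtr0_norm// ltr_pdivrMr// mulrC -ltr_pdivrMr//.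
  rewrite -natr1; apply: lt_trans (_ : k%:R < _); last by rewrite ltrDl.
  by near: k; exact: nbhs_infty_gtr.
have := cvg_comp _ _ sk hl.
apply: cvg_trans; apply: near_eq_cvg; near=> k.
by rewrite /dq /= [x + _]addrC.
Unshelve. all: by end_near. Qed.

Lemma bsupp_shift f v : bsupp f -> bsupp (fun x => f (x + v)).
Proof.
move=> [k fk].
have : [set: 'rV[R]_n] v by [].
rewrite -bigcup_box => -[l _ vl].
exists (k + l)%N => x xkl; apply: fk => /cubeP xk; apply: xkl; apply/cubeP => i.
have /cubeP/(_ i) vi := vl.
have := xk i; rewrite mxE natrD => xi.
by have := ler_normB (x ord0 i + v ord0 i) (v ord0 i); rewrite addrK; lra.
Qed.

(** One dominating function for all steps h <= s: the mean value theorem bounds the quotient, and a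
    step of length at most s enlarges the support by at most s. *)
Lemma dq_dominated f i (s : R) : smooth f -> bsupp f -> 0 < s ->
  exists C k, forall h x, 0 < h -> h <= s -> `|dq i f h x| <= C * \1_(cube k) x.
Proof.
move=> sf bf s0.
have [C C0 fC] := bsupp_bounded (smooth_continuous (smooth_partial i sf)) (bsupp_partial i bf).
have [k fk] := bf; pose l := (k + Num.bound s)%N.
have sl : s < (Num.bound s)%:R by apply: archi_boundP; exact: ltW.
exists C, l => h x h0 hs; rewrite indicE.
case: (pselect (cube l x)) => xl.
  rewrite mem_set// mulr1 /dq; have [c ->] := mean_value i x sf h0.
  by rewrite mulrC mulfK ?gt_eqF.
rewrite memNset// mulr0 /dq (bsuppW fk _ xl) ?leq_addr// fk ?subr0 ?mulr0 ?normr0//.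
move=> /cubeP xk; apply: xl; apply/cubeP => j.
have := xk j; rewrite !mxE eqxx/= natrD => xj.
have := ler_normB (x ord0 j + h * (j == i)%:R) (h * (j == i)%:R); rewrite addrK.
have : `|h * (j == i)%:R| <= h.
  by case: (j == i); rewrite ?mulr1 ?mulr0 ?normr0 ?gtr0_norm// ltW.
by lra.
Qed.

Lemma smooth_measurable f : smooth f -> measurable_fun setT f.
Proof. by move=> /smooth_continuous cf; exact: continuous_measurable_rV. Qed.

Lemma measurable_dq f i h : smooth f -> measurable_fun setT (dq i f h).
Proof.
move=> sf; apply: measurable_funM => //; apply: measurable_funB.
  exact: smooth_measurable (smooth_shift (h *: e_ i) sf).
exact: smooth_measurable.
Qed.

Lemma dq_cvg_int f i (s : R) : smooth f -> bsupp f -> 0 < s ->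
  (\int[mu]_x `|dq i f (s / k.+1%:R) x - partial i f x|%:E @[k --> \oo] --> 0 /\
   \int[mu]_x (dq i f (s / k.+1%:R) x)%:E @[k --> \oo] -->
     \int[mu]_x (partial i f x)%:E)%E.
Proof.
move=> sf bf s0; have [C [k hk]] := dq_dominated i sf bf s0.
have [] := @dominated_convergence _ _ _ mu setT measurableT
  (fun k x => (dq i f (s / k.+1%:R) x)%:E) (fun x => (partial i f x)%:E)
  (fun x => (C * \1_(cube k) x)%:E).
- by move=> m; apply/measurable_EFinP; exact: measurable_dq.
- apply/measurable_EFinP.
  exact: smooth_measurable (smooth_partial i sf).
- by apply: aeW => x _; apply: cvg_EFin; [exact: nearW|exact: dq_cvg].
- under eq_fun do rewrite EFinM.
  exact: (integrableZl measurableT C (integrable_indic_fin (mcube k) (mu_cube k))).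
- apply: aeW => x m _; rewrite lee_fin; apply: hk; first by rewrite divr_gt0.
  by rewrite ler_pdivrMr// ler_peMr ?ler1n// ltW.
by move=> _ h1 h2; split; [exact: h1|exact: h2].
Qed.

Lemma integral_shift_real f v : measurable_fun setT f ->
  (\int[mu]_x (f (x + v))%:E = \int[mu]_x (f x)%:E)%E.
Proof.
move=> mf; rewrite integralE [RHS]integralE; congr (_ - _)%E.
- rewrite -[RHS](integral_shift v)//=; last first.
    by apply: measurable_funepos; exact/measurable_EFinP.
  by apply: eq_integral => x _; rewrite !funeposE.
- rewrite -[RHS](integral_shift v)//=; last first.
    by apply: measurable_funeneg; exact/measurable_EFinP.
  by apply: eq_integral => x _; rewrite !funenegE.
Qed.

(** Every difference quotient has integral 0 by translation invariance, and dominated convergence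
    passes this to the derivative. Applied to a product it is integration by parts, with no iterated
    integrals. *)
Lemma integral_partial f i : smooth f -> bsupp f ->
  (\int[mu]_x (partial i f x)%:E = 0)%E.
Proof.
move=> sf bf; have [_ h] := dq_cvg_int i sf bf ltr01.
have dq0 k : (\int[mu]_x (dq i f (1 / k.+1%:R) x)%:E = 0)%E.
  under eq_integral do rewrite /dq EFinM.
  have I1 := cbsupp_integrable (smooth_continuous sf) bf.
  have sf' := smooth_shift ((1 / k.+1%:R) *: e_ i) sf.
  have I2 := cbsupp_integrable (smooth_continuous sf') (bsupp_shift _ bf).
  rewrite integralZl//; last by under eq_fun do rewrite EFinB; exact: integrableB.
  under eq_integral do rewrite EFinB.
  rewrite integralB// integral_shift_real ?subee ?mule0//.
    exact: integrable_fin_num.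
  exact: smooth_measurable.
move: h; under eq_fun do rewrite dq0.
by move=> /cvg_lim <-//; rewrite lim_cst.
Qed.

Lemma integration_by_parts f g i : smooth f -> smooth g -> bsupp f ->
  (\int[mu]_x (f x * partial i g x)%:E = - \int[mu]_x (partial i f x * g x)%:E)%E.
Proof.
move=> sf sg bf.
have := integral_partial i (smoothM sf sg) (bsuppM _ bf).
rewrite partialM//.
under eq_integral do rewrite EFinD.
have I1 := cbsupp_integrable (smooth_continuous (smoothM (smooth_partial i sf) sg))
  (bsuppM g (bsupp_partial i bf)).
have I2 := cbsupp_integrable (smooth_continuous (smoothM sf (smooth_partial i sg)))
  (bsuppM (partial i g) bf).
rewrite integralD// => h.
have F1 := integrable_fin_num measurableT I1.
by rewrite -[RHS]adde0 -h addeA [(- _ + _)%E]addeC subee// add0e.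
Qed.

End difference_quotient.

(** * The fundamental lemma of the calculus of variations *)

Lemma flat0_le1 (R : realType) (s : R) : flat 0 s <= 1.
Proof.
case: (ltP 0 s) => s0; last by rewrite flat_le0.
by rewrite /flat s0 expr0 divr1 expRN invf_le1 ?expR_gt0// -expR0 ler_expR invr_ge0 ltW.
Qed.

Lemma cvg_flat0 (R : realType) (s : R) : 0 < s ->
  (fun m : nat => flat 0 (m.+1%:R * s)) @ \oo --> (1 : R).
Proof.
move=> s0.
have h : (fun m : nat => - (m.+1%:R^-1 * s^-1)) @ \oo --> (0 : R).
  rewrite -oppr0 -(mul0r s^-1); apply: cvgN; apply: cvgM; last exact: cvg_cst.
  exact: cvg_harmonic.
have := cvg_comp _ _ h (@continuous_expR R 0); rewrite expR0.
apply: cvg_trans; apply: near_eq_cvg; near=> m.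
by rewrite /flat mulr_gt0// expr0 divr1 invfM.
Unshelve. all: by end_near. Qed.

Section fundamental.
Context {R : realType} {n : nat}.
Implicit Types (f g : 'rV[R]_n -> R) (a b : 'I_n -> R).
Local Notation mu := (lebesgue_rV R n).

(** Since exp(-1/(ms)) tends to 1 for s > 0, these smooth products converge to the indicator of the
    open box, stay between 0 and 1, and vanish off the box. *)
Definition bump a b (m : nat) (x : 'rV[R]_n) : R :=
  \prod_i (flat 0 (m.+1%:R * (x ord0 i - a i)) * flat 0 (m.+1%:R * (b i - x ord0 i))).

Lemma smooth_bump a b m : smooth (bump a b m).
Proof.
apply: smooth_prod => i; apply: smoothM; apply: smooth_flat; apply: smoothZ.
- by apply: smoothB; [exact: smooth_coord|exact: smooth_cst].
- by apply: smoothB; [exact: smooth_cst|exact: smooth_coord].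
Qed.

Lemma bump_ge0 a b m x : 0 <= bump a b m x.
Proof. by apply: prodr_ge0 => i _; rewrite mulr_ge0 ?flat_ge0. Qed.

Lemma bump_le1 a b m x : bump a b m x <= 1.
Proof.
by apply: prodr_ile1 => i _; rewrite mulr_ge0 ?flat_ge0//= mulr_ile1 ?flat_ge0 ?flat0_le1.
Qed.

Lemma bump_out a b m x : ~ box a b x -> bump a b m x = 0.
Proof.
move=> /existsNP[i hi]; rewrite /bump (bigD1 i)//=.
case: (ltP (a i) (x ord0 i)) => ax.
  rewrite [flat _ (_ * (b i - _))]flat_le0 ?mulr0 ?mul0r//.
  rewrite pmulr_rle0// subr_le0 leNgt; apply/negP => xb; apply: hi.
  by rewrite ax.
by rewrite [flat _ (_ * (_ - a i))]flat_le0 ?mul0r// pmulr_rle0// subr_le0.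
Qed.

Lemma cvg_bump a b x : (fun m => bump a b m x) @ \oo --> (\1_(box a b) x : R).
Proof.
rewrite indicE; case: (pselect (box a b x)) => xab; last first.
  rewrite memNset//; under eq_fun do rewrite bump_out//; exact: cvg_cst.
rewrite mem_set// /bump.
rewrite [X in _ --> X](_ : _ = \prod_(i < n) (1 * 1)); last first.
  by rewrite big1// => i _; rewrite mulr1.
elim: (index_enum _) => [|i r IH].
  by under eq_fun do rewrite big_nil; rewrite big_nil; apply: cvg_cst.
under eq_fun do rewrite big_cons; rewrite big_cons; apply: cvgM => //.
have /andP[ax xb] := xab i.
by apply: cvgM; apply: cvg_flat0; rewrite subr_gt0.
Qed.

Lemma box_cube a b : exists k, box a b `<=` cube k.
Proof.
have H (v : 'rV[R]_n) : exists k, cube k v.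
  by have : [set: 'rV[R]_n] v by []; rewrite -bigcup_box => -[k _]; exists k.
have [k /cubeP ak] := H (\row_i a i); have [l /cubeP bl] := H (\row_i b i).
exists (k + l)%N => x xab; apply/cubeP => i.
have := ak i; have := bl i; have /andP[] := xab i; rewrite !mxE natrD.
have : (0 : R) <= k%:R by []; have : (0 : R) <= l%:R by [].
by rewrite !ltr_norml => ? ? ? ? /andP[? ?] /andP[? ?]; apply/andP; split; lra.
Qed.

Lemma bsupp_bump a b m : bsupp (bump a b m).
Proof.
by have [k abk] := box_cube a b; exists k => x xk; rewrite bump_out// => /abk.
Qed.

Lemma test_bump (Omega : set 'rV[R]_n) a b m :
  cbox a b `<=` Omega -> test_function Omega (bump a b m).
Proof.
move=> abO.
have sub : closure [set x | bump a b m x != 0] `<=` cbox a b.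
  have cab : closed (cbox a b).
    by apply: compact_closed; [exact: norm_hausdorff|exact: compact_cbox].
  rewrite closureE; apply: smallest_sub => // x /= /eqP bx i.
  have [xab|/bump_out//] := pselect (box a b x).
  by have /andP[/ltW -> /ltW ->] := xab i.
split; first exact: smooth_bump.
- by apply: (subclosed_compact _ _ sub); [exact: closed_closure|exact: compact_cbox].
- exact: subset_trans abO.
Qed.

Lemma locally_integrable_int (Omega : set 'rV[R]_n) f K :
  open Omega -> locally_integrable_rV Omega f -> compact K -> K `<=` Omega ->
  mu.-integrable K (EFin \o f).
Proof.
move=> oO [mf If] cK KO; apply/integrableP; split; last exact: If.
apply/measurable_EFinP; apply: measurable_funS mf => //.
exact: open_measurable_rV.
Qed.

Lemma integral_box_eq0 (Omega : set 'rV[R]_n) f a b : open Omega ->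
  locally_integrable_rV Omega f ->
  (forall phi, test_function Omega phi -> \int[mu]_(x in Omega) (f x * phi x)%:E = 0)%E ->
  cbox a b `<=` Omega -> (\int[mu]_(x in box a b) (f x)%:E = 0)%E.
Proof.
move=> oO lf f0 abO.
have mO := open_measurable_rV oO.
have IQ := locally_integrable_int oO lf (@compact_cbox _ _ a b) abO.
have mQ : measurable (cbox a b) by apply: compact_measurable_rV; exact: compact_cbox.
have bQ : box a b `<=` cbox a b by move=> x xab i; have /andP[/ltW -> /ltW ->] := xab i.
have mf : measurable_fun (cbox a b) f by apply: measurable_funS lf.1.
have [] := @dominated_convergence _ _ _ mu (cbox a b) mQ
  (fun m x => (f x * bump a b m x)%:E) (fun x => (f x * \1_(box a b) x)%:E)
  (fun x => `|(f x)%:E|)%E.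
- move=> m; apply/measurable_EFinP; apply: measurable_funM => //.
  by apply: measurable_funTS; exact: smooth_measurable (smooth_bump a b m).
- apply/measurable_EFinP; apply: measurable_funM => //.
  by apply: measurable_indic; exact: measurable_obox.
- apply: aeW => x _; apply: cvg_EFin; first exact: nearW.
  by apply: cvgM; [exact: cvg_cst|exact: cvg_bump].
- exact: integrable_abse.
- apply: aeW => x m _; rewrite lee_fin normrM ler_piMr//.
  by rewrite ger0_norm ?bump_ge0 ?bump_le1.
move=> _ _ h.
have E m : (\int[mu]_(x in cbox a b) (f x * bump a b m x)%:E = 0)%E.
  rewrite -(f0 _ (test_bump m abO)) [LHS]integral_mkcond [RHS]integral_mkcond.
  apply: eq_integral => x _; rewrite !patchE.
  case: ifPn => xq; case: ifPn => xO //.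
    by move: xO; rewrite notin_setE => /(_ (abO _ (set_mem xq))).
  rewrite bump_out ?mulr0// => /bQ.
  by move: xq; rewrite notin_setE.
move: h; under eq_fun do rewrite E; move=> /cvg_lim; rewrite lim_cst// => h.
rewrite [LHS](_ : _ = \int[mu]_(x in cbox a b) (f x * \1_(box a b) x)%:E)%E.
  by rewrite -h.
rewrite [LHS]integral_mkcond [RHS]integral_mkcond.
apply: eq_integral => x _; rewrite !patchE indicE.
case: ifPn => xq; first by rewrite ifT ?mulr1// inE; apply: bQ; exact: set_mem.
by rewrite mulr0 if_same.
Qed.

(** Bumps only reach integrals over boxes. Boxes are stable under intersection, so Dynkin induction
    extends the vanishing to all measurable subsets of the box, and this forces f = 0 almost
    everywhere there. *)
Lemma fundamental_box (Omega : set 'rV[R]_n) f a b : open Omega ->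
  locally_integrable_rV Omega f ->
  (forall phi, test_function Omega phi -> \int[mu]_(x in Omega) (f x * phi x)%:E = 0)%E ->
  cbox a b `<=` Omega -> ae_eq mu (box a b) (EFin \o f) (cst 0%E).
Proof.
move=> oO lf f0 abO.
have mO := open_measurable_rV oO.
have mB := measurable_obox a b.
have bQ : box a b `<=` cbox a b by move=> x xab i; have /andP[/ltW -> /ltW ->] := xab i.
have IQ : mu.-integrable (box a b) (EFin \o f).
  have := locally_integrable_int oO lf (@compact_cbox _ _ a b) abO.
  by apply: integrableS => //; apply: compact_measurable_rV; exact: compact_cbox.
have key : forall S, <<s [set B | exists ab, B = @box R n ab.1 ab.2] >> S ->
    (\int[mu]_(x in S `&` box a b) (f x)%:E = 0)%E.
  apply: dynkin_induction.
  - exact: rV_measurableE.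
  - by move=> _ _ [ab ->] [cd ->]; rewrite boxI; eexists (_, _).
  - by rewrite setTI; exact: integral_box_eq0 lf f0 abO.
  - move=> _ [cd ->]; rewrite boxI; apply: (integral_box_eq0 oO lf f0).
    apply: subset_trans abO => x h i; have := h i.
    by rewrite ge_max le_min => /andP[/andP[_ ->] /andP[_ ->]].
  - move=> S mS IS.
    have := integral_box_eq0 oO lf f0 abO.
    rewrite -{1}(setUIDK (box a b) S) integral_setU.
    + by rewrite setIC IS add0e setDE setIC.
    + exact: measurableI.
    + exact: measurableD.
    + by rewrite setUIDK; case/integrableP: IQ.
    + by rewrite disj_set2E; apply/eqP; rewrite setIDA; apply/seteqP; split=> x// [[[]]].
  - move=> F mF tF IF; rewrite setI_bigcupl integral_bigcup.
    + by apply: eseries0 => k _ _; exact: IF.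
    + exact: trivIset_setIr.
    + by move=> k; exact: measurableI.
    + apply: (integrableS _ _ _ IQ) => //; last by apply: bigcup_sub => k _ x [].
      by apply: bigcupT_measurable => k; exact: measurableI.
apply: integral_ae_eq => //.
move=> E EB mE; rewrite integral0 -(setIidl EB).
by apply: key; rewrite -rV_measurableE.
Qed.

Lemma fundamental_lemma (Omega : set 'rV[R]_n) f : open Omega ->
  locally_integrable_rV Omega f ->
  (forall phi, test_function Omega phi -> \int[mu]_(x in Omega) (f x * phi x)%:E = 0)%E ->
  {ae mu, forall x, Omega x -> f x = 0}.
Proof.
move=> oO lf f0; have [D OD DP] := open_bigcup_box oO.
have : {ae mu, forall x, forall k, D k x -> f x = 0}.
  apply/ae_foralln => k; have [->|[a [b [-> abO]]]] := DP k.
    by apply: aeW.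
  have := fundamental_box oO lf f0 abO.
  by apply: filterS => x /= h /h [].
by apply: filterS => x h; rewrite OD => -[k _ /h].
Qed.

End fundamental.

(** * Elementary inequalities for real powers and for the Euclidean norm *)

Section powR_lemmas.
Context {R : realType}.
Implicit Types a b c p t : R.

Lemma powR_mono p a b : 0 <= p -> 0 <= a -> a <= b -> a `^ p <= b `^ p.
Proof. by move=> p0 a0 ab; apply: ge0_ler_powR; rewrite ?nnegrE// (le_trans a0). Qed.

Lemma powRD_le p a b : 0 <= p -> 0 <= a -> 0 <= b ->
  (a + b) `^ p <= 2 `^ p * (a `^ p + b `^ p).
Proof.
move=> p0 a0 b0; have h c d : 0 <= c -> c <= d -> (c + d) `^ p <= 2 `^ p * (c `^ p + d `^ p).
  move=> c0 cd; have d0 := le_trans c0 cd.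
  apply: (@le_trans _ _ ((2 * d) `^ p)); first by apply: powR_mono; lra.
  by rewrite powRM// ler_wpM2l ?powR_ge0// lerDr powR_ge0.
case: (leP a b) => ab; first exact: h.
by rewrite addrC [X in _ * X]addrC h// ltW.
Qed.

(** Either b >= (1 - t) a, or |a - b| >= t a. Integrated, it does the work of the triangle
    inequality in L^p with a constant as close to 1 as desired. *)
Lemma powR_perturb p t a b : 0 <= p -> 0 < t < 1 -> 0 <= a -> 0 <= b ->
  (1 - t) `^ p * a `^ p <= b `^ p + t^-1 `^ p * `|a - b| `^ p.
Proof.
move=> p0 /andP[t0 t1] a0 b0.
case: (leP ((1 - t) * a) b) => h.
  rewrite -powRM//; last by lra.
  rewrite (le_trans (powR_mono p0 _ h)) ?lerDl ?mulr_ge0 ?powR_ge0//.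
  by lra.
apply: (@le_trans _ _ (a `^ p)).
  rewrite ler_piMl ?powR_ge0//.
  have t1' : 0 <= 1 - t <= 1 by lra.
  by case/andP: t1' => ? /(powR_mono p0); rewrite powR1; exact.
rewrite -powRM ?invr_ge0 ?(ltW t0)//.
apply: (@le_trans _ _ ((t^-1 * `|a - b|) `^ p)); last by rewrite lerDr powR_ge0.
by apply: powR_mono => //; rewrite ler_pdivlMl// (le_trans _ (ler_norm _))//; lra.
Qed.

Lemma powR_convex p t a b : 1 <= p -> 0 <= t <= 1 -> 0 <= a -> 0 <= b ->
  ((1 - t) * a + t * b) `^ p <= (1 - t) * a `^ p + t * b `^ p.
Proof.
move=> p1 /andP[t0 t1] a0 b0.
have s01 : 0 <= 1 - t <= 1 by lra.
have [/= s0 s1] := andP s01.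
have := @convex_powR R p p1 (Itv01 s0 s1) a b.
rewrite !inE /= !in_itv /= !andbT !convRE /= => /(_ a0 b0).
by rewrite [X in X `^ _ <= _ -> _]convRE /= /unstable.onem subKr.
Qed.

(** For t > c one has t = t^(1-p) t^p <= c^(1-p) t^p, because 1 - p <= 0. The free parameter c
    balances the size of a set against a p-th power integral over it. *)
Lemma powR_young p c t : 1 <= p -> 0 < c -> 0 <= t ->
  t <= c + c `^ (1 - p) * t `^ p.
Proof.
move=> p1 c0 t0; case: (leP t c) => tc.
  by rewrite (le_trans tc)// lerDl mulr_ge0 ?powR_ge0.
apply: (@le_trans _ _ (c `^ (1 - p) * t `^ p)); last by rewrite lerDr ltW.
have tp : t `^ p = t * t `^ (p - 1) by rewrite mulr_powRB1//; lra.
rewrite tp mulrCA ler_peMr//.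
rewrite -opprB powRN ler_pdivlMl ?powR_gt0// mulr1.
by apply: powR_mono; lra.
Qed.

Lemma bernoulli_le k t : 0 <= t <= 1 -> 1 - k%:R * (1 - t) <= t ^+ k.
Proof.
move=> /andP[t0 t1]; elim: k => [|k IH]; first by rewrite expr0; lra.
rewrite exprS -natr1.
have : t * (1 - k%:R * (1 - t)) <= t * t ^+ k by rewrite ler_wpM2l.
have : 0 <= k%:R * (1 - t) * (1 - t) by rewrite !mulr_ge0//; lra.
lra.
Qed.

(** [Num.bound q] is an integer above q, so t^q dominates an integer power of t and Bernoulli's
    inequality applies. *)
Lemma powR_bernoulli q t : 0 <= q -> 0 < t <= 1 ->
  1 - (Num.bound q)%:R * (1 - t) <= t `^ q.
Proof.
move=> q0 /andP[t0 t1].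
apply: (@le_trans _ _ (t ^+ Num.bound q)); first by apply: bernoulli_le; lra.
rewrite -powR_mulrn ?(ltW t0)//; apply: ger_powR; first by rewrite t0.
by apply: ltW; exact: archi_boundP.
Qed.

End powR_lemmas.

Section euclidean.
Context {R : realType} {n : nat}.
Implicit Types (x y : 'rV[R]_n).
Local Notation enorm := (@euclidean_norm R n).

Lemma enorm_ge0 x : 0 <= enorm x.
Proof. exact: sqrtr_ge0. Qed.

Lemma enorm_sqr x : enorm x ^+ 2 = \sum_i x ord0 i ^+ 2.
Proof. by rewrite sqr_sqrtr// sumr_ge0// => i _; rewrite sqr_ge0. Qed.

Lemma cauchy_schwarz x y : \sum_i x ord0 i * y ord0 i <= enorm x * enorm y.
Proof.
set S := \sum_i _.
suff h : S ^+ 2 <= (enorm x * enorm y) ^+ 2.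
  rewrite (le_trans (ler_norm S))// -(ger0_norm (mulr_ge0 (enorm_ge0 x) (enorm_ge0 y))).
  by rewrite -ler_sqr ?nnegrE// !real_normK ?num_real.
rewrite exprMn !enorm_sqr.
(* Lagrange's identity: this sum of squares is twice the difference of the two sides of the squared
   inequality. *)
have : 0 <= \sum_i \sum_j (x ord0 i * y ord0 j - x ord0 j * y ord0 i) ^+ 2.
  by apply: sumr_ge0 => i _; apply: sumr_ge0 => j _; exact: sqr_ge0.
have -> : \sum_i \sum_j (x ord0 i * y ord0 j - x ord0 j * y ord0 i) ^+ 2 =
    ((\sum_i x ord0 i ^+ 2) * (\sum_i y ord0 i ^+ 2) +
     (\sum_i x ord0 i ^+ 2) * (\sum_i y ord0 i ^+ 2)) - (S ^+ 2 + S ^+ 2).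
  have E1 : (\sum_i x ord0 i ^+ 2) * (\sum_i y ord0 i ^+ 2) =
      \sum_i \sum_j x ord0 i ^+ 2 * y ord0 j ^+ 2 by rewrite big_distrlr.
  have E2 : (\sum_i x ord0 i ^+ 2) * (\sum_i y ord0 i ^+ 2) =
      \sum_i \sum_j x ord0 j ^+ 2 * y ord0 i ^+ 2.
    by rewrite E1 exchange_big.
  have E3 : S ^+ 2 = \sum_i \sum_j (x ord0 i * y ord0 i) * (x ord0 j * y ord0 j).
    by rewrite expr2 big_distrlr.
  rewrite {1}E1 E2 E3.
  rewrite -!big_split -sumrB /=; apply: eq_bigr => i _.
  rewrite -!big_split -sumrB /=; apply: eq_bigr => j _; ring.
lra.
Qed.

Lemma enorm_triangle x y : enorm (x + y) <= enorm x + enorm y.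
Proof.
rewrite -ler_sqr ?nnegrE ?addr_ge0 ?enorm_ge0// sqrrD !enorm_sqr.
have := cauchy_schwarz x y.
have -> : \sum_i (x + y) ord0 i ^+ 2 = \sum_i x ord0 i ^+ 2 +
    2 * (\sum_i x ord0 i * y ord0 i) + \sum_i y ord0 i ^+ 2.
  rewrite mulr_sumr -!big_split/=; apply: eq_bigr => i _; rewrite mxE; ring.
rewrite mulr2n; lra.
Qed.

Lemma enormZ (c : R) x : enorm (c *: x) = `|c| * enorm x.
Proof.
rewrite /euclidean_norm -sqrtr_sqr -sqrtrM ?sqr_ge0// mulr_sumr.
by congr Num.sqrt; apply: eq_bigr => i _; rewrite mxE exprMn.
Qed.

Lemma enormN x : enorm (- x) = enorm x.
Proof. by rewrite -scaleN1r enormZ normrN1 mul1r. Qed.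

Lemma enorm0 : enorm 0 = 0.
Proof. by rewrite -(scale0r 0) enormZ normr0 mul0r. Qed.

Lemma enorm_dist x y : `|enorm x - enorm y| <= enorm (x - y).
Proof.
have := enorm_triangle (x - y) y; rewrite subrK.
have := enorm_triangle (y - x) x; rewrite subrK -[enorm (y - x)]enormN opprB.
by rewrite ler_norml; lra.
Qed.

Lemma ler_coord_enorm x i : `|x ord0 i| <= enorm x.
Proof.
rewrite -sqrtr_sqr ler_wsqrtr// (bigD1 i)//= lerDl sumr_ge0// => j _.
by rewrite sqr_ge0.
Qed.

Lemma measurable_enorm d (T : measurableType d) (D : set T) (g : T -> 'rV[R]_n) :
  (forall i, measurable_fun D (fun z => g z ord0 i)) ->
  measurable_fun D (fun z => enorm (g z)).
Proof.
move=> mg.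
have ms : measurable_fun setT (@Num.sqrt R).
  by apply: continuous_measurable_fun; exact: (@sqrt_continuous R).
apply: (measurableT_comp ms).
by apply: measurable_sum => i; apply: measurable_funX.
Qed.

End euclidean.

(** * Weak gradients *)

Section test_functions.
Context {R : realType} {n : nat}.
Variable Omega : set 'rV[R]_n.
Implicit Types (u phi psi : 'rV[R]_n -> R) (i : 'I_n).

Definition grad phi (x : 'rV[R]_n) : 'rV[R]_n := \row_i partial i phi x.

Lemma test_bsupp phi : test_function Omega phi -> bsupp phi.
Proof.
move=> [_ /compact_bounded/bounded_boxP[k _ hk] _]; exists k => x xk.
apply: contrapT => /eqP phix; apply: xk; apply: hk.
by apply: subset_closure.
Qed.

Lemma test_out phi x : test_function Omega phi -> ~ Omega x -> phi x = 0.
Proof.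
move=> [_ _ sO] xO; apply: contrapT => /eqP phix; apply: xO; apply: sO.
by apply: subset_closure.
Qed.

Lemma test_near_out phi x : test_function Omega phi -> ~ Omega x ->
  \near x, phi x = 0.
Proof.
move=> [_ _ sO] xO; apply: contrapT => h; apply: xO; apply: sO => B Bx.
apply: contrapT => hB; apply: h; apply: filterS Bx => y By.
by apply: contrapT => /eqP phiy; apply: hB; exists y.
Qed.

Lemma test_partial_out phi i x : test_function Omega phi -> ~ Omega x ->
  partial i phi x = 0.
Proof.
move=> tphi xO; rewrite /partial (near_eq_derive _ (g := fun=> 0)).
  by rewrite derive_cst.
exact: test_near_out.
Qed.

Lemma test_grad_out phi x : test_function Omega phi -> ~ Omega x -> grad phi x = 0.
Proof.
by move=> tphi xO; apply/rowP => i; rewrite !mxE (test_partial_out _ tphi).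
Qed.

Lemma testP phi : smooth phi -> bsupp phi ->
  closure [set x | phi x != 0] `<=` Omega -> test_function Omega phi.
Proof.
move=> sphi [k hk] sO; split => //.
apply: bounded_closed_compact; last exact: closed_closure.
apply: (@subset_box_bounded _ _ _ k%:R) => x xs i.
have : closure (cube k) x.
  apply: closure_subset xs => y /= /eqP y0.
  by apply: contrapT => /hk.
move=> xk; rewrite leNgt; apply/negP => kx.
have [|y [/cubeP yk /ballrVP]] := xk (ball x (`|x ord0 i| - k%:R)).
  by apply: nbhsx_ballx; rewrite subr_gt0.
rewrite subr_gt0 => /(_ kx)/(_ i).
have := yk i; have := ler_normD (x ord0 i - y ord0 i) (y ord0 i).
by rewrite subrK; lra.
Qed.

End test_functions.

Section weak_gradients.
Context {R : realType} {n : nat}.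
Variable Omega : set 'rV[R]_n.
Implicit Types (u phi psi : 'rV[R]_n -> R) (i : 'I_n).
Local Notation mu := (lebesgue_rV R n).

Lemma test_partial phi i : test_function Omega phi ->
  test_function Omega (partial i phi).
Proof.
move=> tphi; have [sphi cK KO] := tphi.
have t' : test_function (closure [set x | phi x != 0]) phi by split.
have sub : closure [set x | partial i phi x != 0] `<=` closure [set x | phi x != 0].
  rewrite [X in X `<=` _]closureE; apply: smallest_sub; first exact: closed_closure.
  move=> x /= /eqP dx; apply: contrapT => /(test_partial_out i t').
  exact: dx.
split; first exact: smooth_partial.
- by apply: (subclosed_compact _ _ sub); [exact: closed_closure|].
- exact: subset_trans KO.
Qed.

Hypothesis oO : open Omega.
Let mO : measurable Omega := open_measurable_rV oO.

Lemma integral_Omega (f : 'rV[R]_n -> \bar R) :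
  (forall x, ~ Omega x -> f x = 0%E) ->
  (\int[mu]_(x in Omega) f x = \int[mu]_x f x)%E.
Proof.
move=> f0; rewrite [LHS]integral_mkcond; apply: eq_integral => x _.
rewrite patchE; case: ifPn => // xO; rewrite f0//.
by move: xO; rewrite notin_setE.
Qed.

Lemma locally_integrable_bounded u : measurable_fun setT u ->
  (exists C, forall x, `|u x| <= C) -> locally_integrable_rV Omega u.
Proof.
move=> mu_ [C uC]; split; first exact: measurable_funTS.
move=> K KO cK; have mK := compact_measurable_rV cK.
have [k _ Kk] := bounded_boxP (compact_bounded cK).
apply: (@le_lt_trans _ _ (\int[mu]_(x in K) C%:E)%E).
  apply: ge0_le_integral => //.
  - by apply/measurable_EFinP; apply: measurableT_comp => //; exact: measurable_funTS.
  - by move=> x _; rewrite lee_fin (le_trans _ (uC x)).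
rewrite integral_cst//; apply: (@le_lt_trans _ _ (`|C|%:E * mu K)%E).
  by rewrite lee_wpmul2r// lee_fin ler_norm.
apply: lte_mul_pinfty => //; apply: le_lt_trans (mu_cube k).
by apply: le_measure => //; rewrite inE//; exact: mcube.
Qed.

Lemma locally_integrable_test phi : test_function Omega phi ->
  locally_integrable_rV Omega phi.
Proof.
move=> tphi; have [sphi _ _] := tphi.
apply: locally_integrable_bounded; first exact: smooth_measurable.
by have [C _ ?] := bsupp_bounded (smooth_continuous sphi) (test_bsupp tphi); exists C.
Qed.

Lemma locally_integrable_partial phi i : test_function Omega phi ->
  locally_integrable_rV Omega (partial i phi).
Proof.
move=> tphi; have [sphi _ _] := tphi; have spphi := smooth_partial i sphi.
apply: locally_integrable_bounded; first exact: smooth_measurable.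
have [C _ ?] := bsupp_bounded (smooth_continuous spphi) (bsupp_partial i (test_bsupp tphi)).
by exists C.
Qed.

Lemma locally_integrableB u v : locally_integrable_rV Omega u ->
  locally_integrable_rV Omega v -> locally_integrable_rV Omega (fun x => u x - v x).
Proof.
move=> [mu_ Iu] [mv Iv]; split; first exact: measurable_funB.
move=> K KO cK; have mK := compact_measurable_rV cK.
have muK : measurable_fun K u := measurable_funS mO KO mu_.
have mvK : measurable_fun K v := measurable_funS mO KO mv.
apply: (@le_lt_trans _ _ (\int[mu]_(x in K) (`|u x|%:E + `|v x|%:E))%E).
  apply: ge0_le_integral => //.
  - by apply/measurable_EFinP; apply: measurableT_comp => //; exact: measurable_funB.
  - by apply: emeasurable_funD; apply/measurable_EFinP; exact: measurableT_comp.
  - by move=> x _; rewrite -EFinD lee_fin ler_normB.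
rewrite ge0_integralD//; [|by apply/measurable_EFinP; exact: measurableT_comp..].
by rewrite lte_add_pinfty// ?Iu// Iv.
Qed.

Lemma integrable_test_mul u psi : locally_integrable_rV Omega u ->
  continuous psi -> bsupp psi -> compact (closure [set x | psi x != 0]) ->
  closure [set x | psi x != 0] `<=` Omega ->
  mu.-integrable Omega (fun x => (u x * psi x)%:E).
Proof.
move=> lu cpsi bpsi cK KO.
set K := closure _ in cK KO.
have mK := compact_measurable_rV cK.
have IK := locally_integrable_int oO lu cK KO.
have [C C0 psiC] := bsupp_bounded cpsi bpsi.
have mup : measurable_fun Omega (fun x => u x * psi x).
  apply: measurable_funM; first by case: lu.
  by apply: measurable_funTS; exact: continuous_measurable_rV.
apply/integrableP; split; first exact/measurable_EFinP.
apply: (@le_lt_trans _ _ (\int[mu]_(x in K) (C%:E * `|(u x)%:E|))%E); last first.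
  have muK := measurable_int _ IK.
  rewrite ge0_integralZl//.
  - by apply: lte_mul_pinfty => //; case/integrableP: IK.
  - exact: measurableT_comp.
rewrite [leLHS](_ : _ = \int[mu]_(x in K) `|(u x * psi x)%:E|)%E.
  apply: ge0_le_integral => //.
  - apply: measurableT_comp => //; apply/measurable_EFinP.
    exact: measurable_funS mO KO mup.
  - apply: emeasurable_funM => //; apply: measurableT_comp => //.
    exact: measurable_int IK.
  - by move=> x _; rewrite lee_fin normrM mulrC ler_wpM2r.
rewrite [LHS]integral_mkcond [RHS]integral_mkcond; apply: eq_integral => x _.
rewrite !patchE; case: ifPn => xO; case: ifPn => xK //.
  suff -> : psi x = 0 by rewrite mulr0 abse0.
  apply: contrapT => /eqP h; move: xK; rewrite notin_setE; apply.
  exact: subset_closure.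
by move: xO; rewrite notin_setE => /(_ (KO _ (set_mem xK))).
Qed.

Lemma integrable_test u psi : locally_integrable_rV Omega u ->
  test_function Omega psi -> mu.-integrable Omega (fun x => (u x * psi x)%:E).
Proof.
move=> lu tpsi; have [spsi cK KO] := tpsi.
by apply: integrable_test_mul => //; [exact: smooth_continuous|exact: test_bsupp tpsi].
Qed.

Lemma weak_gradient_unique u g g' :
  is_weak_gradient Omega u g -> is_weak_gradient Omega u g' ->
  {ae mu, forall x, Omega x -> g x = g' x}.
Proof.
move=> [lu hg] [_ hg'].
have H i : {ae mu, forall x, Omega x -> g x ord0 i - g' x ord0 i = 0}.
  have [li hi] := hg i; have [li' hi'] := hg' i.
  apply: (fundamental_lemma oO (locally_integrableB li li')) => phi tphi.
  under eq_integral do rewrite mulrBl EFinB.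
  have I1 := integrable_test li tphi; have I2 := integrable_test li' tphi.
  rewrite integralB//.
  have := hi phi tphi; rewrite (hi' phi tphi) => /oppe_inj ->.
  by rewrite subee//; exact: integrable_fin_num.
have : {ae mu, forall x, forall i, Omega x -> g x ord0 i - g' x ord0 i = 0}.
  exact: filter_forall.
apply: filterS => x h Ox; apply/rowP => i.
by apply/eqP; rewrite -subr_eq0; apply/eqP; exact: h.
Qed.

Lemma is_weak_gradient_test phi : test_function Omega phi ->
  is_weak_gradient Omega phi (grad phi).
Proof.
move=> tphi; split; first exact: locally_integrable_test.
move=> i; split.
  have -> : (fun x => grad phi x ord0 i) = partial i phi.
    by apply/funext => x; rewrite mxE.
  exact: locally_integrable_partial.
move=> psi tpsi.
have [sphi _ _] := tphi; have [spsi _ _] := tpsi.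
rewrite !integral_Omega.
- rewrite (integration_by_parts _ sphi spsi (test_bsupp tphi)); congr (- _)%E.
  by apply: eq_integral => x _; rewrite mxE.
- by move=> x xO; rewrite mxE (test_out tpsi)// mulr0.
- by move=> x xO; rewrite (test_out tphi)// mul0r.
Qed.

Lemma is_weak_gradientB u g v h :
  is_weak_gradient Omega u g -> is_weak_gradient Omega v h ->
  is_weak_gradient Omega (u \- v) (fun x => g x - h x).
Proof.
move=> [lu hg] [lv hh]; split; first exact: locally_integrableB.
move=> i; have [lgi hgi] := hg i; have [lhi hhi] := hh i.
have E : (fun x => (g x - h x) ord0 i) = (fun x => g x ord0 i - h x ord0 i).
  by apply/funext => x; rewrite !mxE.
split; first by rewrite E; exact: locally_integrableB.
move=> psi tpsi.
have tdpsi := test_partial i tpsi.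
have I1 := integrable_test lu tdpsi; have I2 := integrable_test lv tdpsi.
have I3 := integrable_test lgi tpsi; have I4 := integrable_test lhi tpsi.
under eq_integral do rewrite mulrBl EFinB.
under [in RHS]eq_integral do rewrite !mxE mulrBl EFinB.
rewrite !integralB// hgi// hhi// oppeB; first by rewrite oppeK.
by apply: fin_num_adde_defr; exact: integrable_fin_num.
Qed.

Lemma weak_gradientP u g : is_weak_gradient Omega u g ->
  is_weak_gradient Omega u (weak_gradient Omega u).
Proof. exact: xgetI. Qed.

Lemma weak_gradient_ae u g : is_weak_gradient Omega u g ->
  {ae mu, forall x, Omega x -> weak_gradient Omega u x = g x}.
Proof. by move=> ug; exact: (weak_gradient_unique (weak_gradientP ug) ug). Qed.

Lemma is_weak_gradient_measurable u g : is_weak_gradient Omega u g ->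
  measurable_fun Omega (fun x => euclidean_norm (g x)).
Proof. by move=> [_ h]; apply: measurable_enorm => i; have [[]] := h i. Qed.

(** [weak_gradient] is picked by choice and cannot be computed; almost everywhere uniqueness still
    lets any explicit gradient evaluate the Dirichlet integral. *)
Lemma integral_weak_gradient (p : R) u g : is_weak_gradient Omega u g ->
  (\int[mu]_(x in Omega) (euclidean_norm (weak_gradient Omega u x) `^ p)%:E =
   \int[mu]_(x in Omega) (euclidean_norm (g x) `^ p)%:E)%E.
Proof.
move=> ug; apply: ae_eq_integral => //.
- apply/measurable_EFinP; apply: (measurableT_comp (measurable_powR _)).
  exact: is_weak_gradient_measurable (weak_gradientP ug).
- apply/measurable_EFinP; apply: (measurableT_comp (measurable_powR _)).
  exact: is_weak_gradient_measurable ug.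
- by apply: filterS (weak_gradient_ae ug) => x h Ox; rewrite h.
Qed.

End weak_gradients.

(** * Mass and Dirichlet integral on the whole space: finiteness, translation, scaling *)

Section lp_energy.
Context {R : realType} {n : nat}.
Implicit Types (u v w phi : 'rV[R]_n -> R) (p q : R).
Local Notation mu := (lebesgue_rV R n).
Local Notation enorm := (@euclidean_norm R n).

(** Taken over the whole space and not over the domain, because filled functions do not vanish off
    the domain and have to be translated. For test functions and positive exponents both versions
    agree. *)
Definition mass p w : \bar R := (\int[mu]_x (`|w x| `^ p)%:E)%E.
Definition dirichlet p w : \bar R := (\int[mu]_x (enorm (grad w x) `^ p)%:E)%E.

Lemma measurable_abs_powR d (T : measurableType d) (D : set T) (f : T -> R) p :
  measurable_fun D f -> measurable_fun D (fun x => (`|f x| `^ p)%:E).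
Proof.
move=> mf; apply/measurable_EFinP; apply: (measurableT_comp (measurable_powR _)).
exact: measurableT_comp.
Qed.

Lemma measurable_grad_powR p w : smooth w ->
  measurable_fun setT (fun x => (enorm (grad w x) `^ p)%:E).
Proof.
move=> sw; apply/measurable_EFinP; apply: (measurableT_comp (measurable_powR _)).
apply: measurable_enorm => i; under eq_fun do rewrite mxE.
by apply: smooth_measurable; exact: smooth_partial.
Qed.

Lemma mass_ge0 p w : (0 <= mass p w)%E.
Proof. by apply: integral_ge0 => x _; rewrite lee_fin powR_ge0. Qed.

Lemma dirichlet_ge0 p w : (0 <= dirichlet p w)%E.
Proof. by apply: integral_ge0 => x _; rewrite lee_fin powR_ge0. Qed.

Lemma enorm_le_sum (x : 'rV[R]_n) : enorm x <= \sum_i `|x ord0 i|.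
Proof.
rewrite -ler_sqr ?nnegrE ?enorm_ge0 ?sumr_ge0// enorm_sqr.
rewrite expr2 big_distrlr/=; apply: ler_sum => i _.
rewrite (bigD1 i)//= -normrM -expr2 ger0_norm ?sqr_ge0// lerDl.
by apply: sumr_ge0 => j _; rewrite mulr_ge0.
Qed.

Lemma grad_bounded w : smooth w -> bsupp w ->
  exists2 C, 0 <= C & forall x, enorm (grad w x) <= C.
Proof.
move=> sw bw.
have /choice[C hC] (i : 'I_n) : exists C, forall x, `|partial i w x| <= C.
  have [C _ h] := bsupp_bounded (smooth_continuous (smooth_partial i sw)) (bsupp_partial i bw).
  by exists C.
exists (\sum_i `|C i|); first exact: sumr_ge0.
move=> x; apply: le_trans (enorm_le_sum _) _; apply: ler_sum => i _.
by rewrite mxE (le_trans (hC i x))// ler_norm.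
Qed.

Lemma integrable_mass p w : 0 < p -> continuous w -> bsupp w ->
  mu.-integrable setT (fun x => (`|w x| `^ p)%:E).
Proof.
move=> p0 cw bw; apply: (@bsupp_integrable _ _ (fun x => `|w x| `^ p)).
- apply: (measurableT_comp (measurable_powR _)).
  by apply: measurableT_comp => //; exact: continuous_measurable_rV.
- by have [k hk] := bw; exists k => x /hk ->; rewrite normr0 powR0// gt_eqF.
- have [C _ wC] := bsupp_bounded cw bw; exists (C `^ p) => x.
  by rewrite ger0_norm ?powR_ge0// powR_mono// ltW.
Qed.

Lemma integrable_dirichlet p w : 0 < p -> smooth w -> bsupp w ->
  mu.-integrable setT (fun x => (enorm (grad w x) `^ p)%:E).
Proof.
move=> p0 sw bw; apply: (@bsupp_integrable _ _ (fun x => enorm (grad w x) `^ p)).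
- by apply/measurable_EFinP; exact: measurable_grad_powR.
- have /choice[k hk] (i : 'I_n) : exists k, forall x, ~ cube k x -> partial i w x = 0.
    exact: bsupp_partial.
  exists (\max_i k i) => x xk; rewrite (_ : grad w x = 0) ?enorm0 ?powR0 ?gt_eqF//.
  apply/rowP => i; rewrite !mxE (bsuppW (hk i) _ xk)//.
  exact: (leq_bigmax i).
- have [C _ wC] := grad_bounded sw bw; exists (C `^ p) => x.
  by rewrite ger0_norm ?powR_ge0// powR_mono ?enorm_ge0// ltW.
Qed.

Lemma mass_fin p w : 0 < p -> continuous w -> bsupp w -> mass p w \is a fin_num.
Proof. by move=> *; apply: integrable_fin_num => //; exact: integrable_mass. Qed.

Lemma dirichlet_fin p w : 0 < p -> smooth w -> bsupp w -> dirichlet p w \is a fin_num.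
Proof. by move=> *; apply: integrable_fin_num => //; exact: integrable_dirichlet. Qed.

Lemma grad_shift w (v : 'rV[R]_n) : grad (fun x => w (x + v)) = fun x => grad w (x + v).
Proof. by apply/funext => x; apply/rowP => i; rewrite !mxE partial_shift. Qed.

Lemma mass_shift p w (v : 'rV[R]_n) : measurable_fun setT w ->
  mass p (fun x => w (x + v)) = mass p w.
Proof.
move=> mw; rewrite /mass -[RHS](integral_shift v)//.
exact: measurable_abs_powR.
Qed.

Lemma dirichlet_shift p w (v : 'rV[R]_n) : smooth w ->
  dirichlet p (fun x => w (x + v)) = dirichlet p w.
Proof.
move=> sw; rewrite /dirichlet grad_shift -[RHS](integral_shift v)//.
  exact: measurable_grad_powR.
by move=> x; rewrite lee_fin powR_ge0.
Qed.

Lemma gradZ (c : R) w : smooth w -> grad (fun x => c * w x) = fun x => c *: grad w x.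
Proof. by move=> sw; apply/funext => x; apply/rowP => i; rewrite !mxE partialZ. Qed.

Lemma massZ p (c : R) w : 0 <= c -> measurable_fun setT w ->
  mass p (fun x => c * w x) = ((c `^ p)%:E * mass p w)%E.
Proof.
move=> c0 mw; rewrite /mass -ge0_integralZl//.
- by apply: eq_integral => x _; rewrite normrM (ger0_norm c0) powRM// EFinM.
- exact: measurable_abs_powR.
- by rewrite lee_fin powR_ge0.
Qed.

Lemma dirichletZ p (c : R) w : 0 <= c -> smooth w ->
  dirichlet p (fun x => c * w x) = ((c `^ p)%:E * dirichlet p w)%E.
Proof.
move=> c0 sw; rewrite /dirichlet gradZ// -ge0_integralZl//.
- by apply: eq_integral => x _; rewrite enormZ (ger0_norm c0) powRM ?enorm_ge0// EFinM.
- exact: measurable_grad_powR.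
- by move=> x _; rewrite lee_fin powR_ge0.
- by rewrite lee_fin powR_ge0.
Qed.

Lemma le_mass p w w' : 0 <= p -> measurable_fun setT w -> measurable_fun setT w' ->
  (forall x, `|w x| <= `|w' x|) -> (mass p w <= mass p w')%E.
Proof.
move=> p0 mw mw' ww'; apply: ge0_le_integral => //.
- exact: measurable_abs_powR.
- exact: measurable_abs_powR.
- by move=> x _; rewrite lee_fin powR_mono.
Qed.

Lemma le_dirichlet p w w' : 0 <= p -> smooth w -> smooth w' ->
  (forall x, enorm (grad w x) <= enorm (grad w' x)) ->
  (dirichlet p w <= dirichlet p w')%E.
Proof.
move=> p0 mw mw' ww'; apply: ge0_le_integral.
- exact: measurableT.
- by move=> x _; rewrite lee_fin powR_ge0.
- exact: measurable_grad_powR.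
- exact: measurable_grad_powR.
- by move=> x _; rewrite lee_fin powR_mono ?enorm_ge0.
Qed.

End lp_energy.

(** * Test functions as elements of the Sobolev space, and approximation by them *)

Section sobolev_interface.
Context {R : realType} {n : nat}.
Variable Omega : set 'rV[R]_n.
Implicit Types (u v w phi : 'rV[R]_n -> R) (p q r : R).
Local Notation mu := (lebesgue_rV R n).
Local Notation enorm := (@euclidean_norm R n).
Hypothesis oO : open Omega.
Let mO : measurable Omega := open_measurable_rV oO.

Lemma integral_mass_test p w : 0 < p -> test_function Omega w ->
  (\int[mu]_(x in Omega) (`|w x| `^ p)%:E = mass p w)%E.
Proof.
move=> p0 tw; apply: integral_Omega => x xO.
by rewrite (test_out tw)// normr0 powR0// gt_eqF.
Qed.

Lemma integral_dirichlet_test p w : 0 < p -> test_function Omega w ->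
  (\int[mu]_(x in Omega) (enorm (weak_gradient Omega w x) `^ p)%:E = dirichlet p w)%E.
Proof.
move=> p0 tw; rewrite (integral_weak_gradient oO p (is_weak_gradient_test tw)).
by apply: integral_Omega => x xO; rewrite (test_grad_out tw)// enorm0 powR0// gt_eqF.
Qed.

Lemma energy_test p r w : 0 < p -> 0 < r -> test_function Omega w ->
  energy Omega p r w = ((p^-1)%:E * dirichlet p w - (r^-1)%:E * mass r w)%E.
Proof.
by move=> p0 r0 tw; rewrite /energy integral_dirichlet_test// integral_mass_test.
Qed.

Lemma Lp_test p f : 0 < p -> measurable_fun setT f -> bsupp f ->
  (exists C, forall x, `|f x| <= C) -> (forall x, ~ Omega x -> f x = 0) ->
  Lp Omega p f.
Proof.
move=> p0 mf bf [C fC] fO.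
have E : f \_ Omega = f.
  apply/funext => x; rewrite patchE; case: ifPn => // xO; apply/esym/fO.
  by move: xO; rewrite notin_setE.
rewrite /Lp E inE; apply/andP; split; first by rewrite inE.
rewrite inE /finite_norm unlock /=; apply: poweR_lty.
have : mu.-integrable setT (fun x => (`|f x| `^ p)%:E).
  apply: (@bsupp_integrable _ _ (fun x => `|f x| `^ p)).
  - by apply: (measurableT_comp (measurable_powR _)); exact: measurableT_comp.
  - by have [k hk] := bf; exists k => x /hk ->; rewrite normr0 powR0// gt_eqF.
  - exists (C `^ p) => x; rewrite ger0_norm ?powR_ge0// powR_mono//.
    exact: ltW.
by move=> /integrable_fin_num h; rewrite ltey_eq h.
Qed.

Lemma W1p_norm_self p w : 0 < p -> test_function Omega w ->
  W1p_norm Omega p (w \- w) = 0%E.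
Proof.
move=> p0 tw; rewrite /W1p_norm.
have gw := is_weak_gradient_test tw.
rewrite (integral_weak_gradient oO p (is_weak_gradientB oO gw gw)).
rewrite integral0_eq ?integral0_eq.
- by rewrite adde0 poweR0r// invr_neq0// gt_eqF.
- by move=> x _; rewrite subrr enorm0 powR0// gt_eqF.
- by move=> x _; rewrite /= subrr normr0 powR0// gt_eqF.
Qed.

Lemma W01p_test p w : 0 < p -> test_function Omega w -> W01p Omega p w.
Proof.
move=> p0 tw; have [sw _ _] := tw; have bw := test_bsupp tw.
split; last by move=> e e0; exists w => //; rewrite W1p_norm_self.
split.
  apply: Lp_test => //; first exact: smooth_measurable.
    by have [C _ wC] := bsupp_bounded (smooth_continuous sw) bw; exists C.
  by move=> x; exact: test_out tw.
exists (grad w); first exact: is_weak_gradient_test.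
move=> i; have -> : (fun x => grad w x ord0 i) = partial i w.
  by apply/funext => x; rewrite mxE.
have tpw := test_partial i tw; have [spw _ _] := tpw; have bpw := test_bsupp tpw.
apply: Lp_test => //; first exact: smooth_measurable.
  by have [C _ wC] := bsupp_bounded (smooth_continuous spw) bpw; exists C.
by move=> x; exact: test_out tpw.
Qed.

Lemma poweR_ltP (q e : R) (x : \bar R) : 0 < q -> 0 < e -> (0 <= x)%E ->
  (x `^ q < (e `^ q)%:E)%E -> (x < e%:E)%E.
Proof.
move=> q0 e0; case: x => [x| |//]; last first.
  by move=> _; rewrite poweRyr ?gt_eqF.
rewrite !lee_fin poweR_EFin !lte_fin => x0; rewrite !ltNge; apply: contra => ex.
by apply: powR_mono => //; exact: ltW.
Qed.

Lemma W01p_weak_gradient p u : W01p Omega p u ->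
  is_weak_gradient Omega u (weak_gradient Omega u).
Proof. by move=> [[_ [g ug _]] _]; exact: weak_gradientP ug. Qed.

Lemma W01p_measurable p u : W01p Omega p u -> measurable_fun Omega u.
Proof. by move=> [[_ [g [[]]]]]. Qed.

Lemma W01p_approx p u e : 0 < p -> W01p Omega p u -> 0 < e ->
  exists phi, [/\ test_function Omega phi,
    (\int[mu]_(x in Omega) (`|u x - phi x| `^ p)%:E < e%:E)%E &
    (\int[mu]_(x in Omega) (enorm (weak_gradient Omega u x - grad phi x) `^ p)%:E
      < e%:E)%E].
Proof.
move=> p0 Wu e0; have ug := W01p_weak_gradient Wu.
(* [W1p_norm] is a p-th root of a sum, so the tolerance e^(1/p) makes the sum, hence both integrals,
   smaller than e. *)
have [|phi tphi] := Wu.2 (e `^ p^-1); first exact: powR_gt0.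
rewrite /W1p_norm (integral_weak_gradient oO p
  (is_weak_gradientB oO ug (is_weak_gradient_test tphi))).
have I10 : (0 <= \int[mu]_(x in Omega) (`|u x - phi x| `^ p)%:E)%E.
  by apply: integral_ge0 => x _; rewrite lee_fin powR_ge0.
have I20 : (0 <= \int[mu]_(x in Omega)
    (enorm (weak_gradient Omega u x - grad phi x) `^ p)%:E)%E.
  by apply: integral_ge0 => x _; rewrite lee_fin powR_ge0.
move=> /poweR_ltP h.
have p1 : 0 < p^-1 by rewrite invr_gt0.
have {}h := h p1 e0 (adde_ge0 I10 I20).
exists phi; split; first exact: tphi.
- exact: le_lt_trans (leeDl _ I20) h.
- exact: le_lt_trans (leeDr _ I10) h.
Qed.

End sobolev_interface.

(** * The weak type inequality *)

Section chebyshev.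
Context d (T : measurableType d) (R : realType) (mu : {measure set T -> \bar R}).

Lemma chebyshev (D : set T) (f : T -> R) (p t : R) : measurable D ->
  measurable_fun D f -> 0 < p -> 0 < t ->
  ((t `^ p)%:E * mu (D `&` [set x | (t < `|f x|)%R]) <=
    \int[mu]_(x in D) (`|f x| `^ p)%:E)%E.
Proof.
move=> mD mf p0 t0.
set E := D `&` _.
have mE : measurable E.
  have mnf : measurable_fun D (fun x => `|f x|) by exact: measurableT_comp.
  by have := mnf mD _ (measurable_itv `]t, +oo[); rewrite set_itvoy.
rewrite -(integral_cst mu mE); apply: (@le_trans _ _ (\int[mu]_(x in E) (`|f x| `^ p)%:E)%E).
  apply: ge0_le_integral => //.
  - by move=> x _; rewrite lee_fin powR_ge0.
  - apply: (@measurable_funS _ _ _ _ D) => //; first by move=> x [].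
    exact: measurable_abs_powR.
  - by move=> x [_ /= tx]; rewrite lee_fin powR_mono// ltW.
apply: ge0_subset_integral => //.
- exact: measurable_abs_powR.
- by move=> x [].
Qed.

End chebyshev.

Section weak_type.
Context {R : realType} {n : nat}.
Implicit Types (phi w : 'rV[R]_n -> R) (i : 'I_n) (p t h : R).
Local Notation mu := (lebesgue_rV R n).
Local Notation e_ i := (delta_mx ord0 i : 'rV[R]_n).

Lemma measurable_jump phi (v : 'rV[R]_n) t : smooth phi ->
  measurable [set x | (t < `|phi (x + v) - phi x|)%R].
Proof.
move=> sphi.
have mf : measurable_fun setT (fun x : 'rV[R]_n => `|phi (x + v) - phi x|).
  apply: measurableT_comp => //; apply: measurable_funB; last exact: smooth_measurable.
  exact: smooth_measurable (smooth_shift v sphi).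
by have := mf measurableT _ (measurable_itv `]t, +oo[); rewrite setTI set_itvoy.
Qed.

(* The weak Young inequality, applied to the [k] increments of [phi] between
   [x] and [x + s e_i], replaces Hoelder's inequality. *)
Lemma jump_le_increments phi i p s t k : smooth phi -> bsupp phi -> 1 <= p ->
  0 < s -> 0 < t ->
  (((t / (2 * k.+1%:R)) `^ p)%:E * mu [set x | (t < `|phi (x + s *: e_ i) - phi x|)%R] <=
   mass p (fun x => phi (x + (s / k.+1%:R) *: e_ i) - phi x)%R)%E.
Proof.
move=> sphi bphi p1 s0 t0.
(* The K constants c of Young's inequality add up to t / 2; the p-th powers of the increments must
   account for the other half of the jump. *)
set K : R := k.+1%:R; set h := s / K; set c := t / (2 * K).
have K0 : 0 < K by rewrite ltr0n.
have c0 : 0 < c by rewrite divr_gt0// mulr_gt0.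
pose D (x : 'rV[R]_n) := phi (x + h *: e_ i) - phi x.
have mD : measurable_fun setT D.
  apply: measurable_funB; last exact: smooth_measurable.
  exact: smooth_measurable (smooth_shift _ sphi).
set E := [set x | _].
have mE : measurable E by exact: measurable_jump.
have pw x : E x -> K * c `^ p <= \sum_(j < k.+1) `|D (x + (j%:R * h) *: e_ i)| `^ p.
  rewrite /E /= => tx.
  have tel : phi (x + s *: e_ i) - phi x = \sum_(j < k.+1) D (x + (j%:R * h) *: e_ i).
    pose a j := phi (x + (j%:R * h) *: e_ i).
    have := @telescope_sumr _ 0 k.+1 a (leq0n _).
    rewrite /a mul0r scale0r addr0 big_mkord [k.+1%:R * h]mulrC divfK ?gt_eqF// => <-.
    apply: eq_bigr => j _; rewrite /D /a -addrA -scalerDl.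
    by congr (phi (_ + _ *: _) - _); rewrite -natr1 mulrDl mul1r.
  have : t < \sum_(j < k.+1) `|D (x + (j%:R * h) *: e_ i)|.
    by apply: lt_le_trans tx _; rewrite tel; exact: ler_norm_sum.
  have : \sum_(j < k.+1) `|D (x + (j%:R * h) *: e_ i)| <=
      \sum_(j < k.+1) (c + c `^ (1 - p) * `|D (x + (j%:R * h) *: e_ i)| `^ p).
    by apply: ler_sum => j _; exact: powR_young.
  rewrite big_split/= sumr_const card_ord -mulr_sumr.
  set S := \sum_(j < _) _ `^ p.
  rewrite -[c *+ _]mulr_natl -/K => h1 h2.
  have Kc : K * c = t / 2 by rewrite /c; field; rewrite gt_eqF.
  have h3 : K * c <= c `^ (1 - p) * S by lra.
  have cp : c `^ p = c `^ (p - 1) * c by rewrite mulrC mulr_powRB1//; lra.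
  rewrite -[1 - p]opprB powRN in h3.
  by rewrite cp [leLHS]mulrCA; move: h3; rewrite ler_pdivlMl ?powR_gt0.
have KcE : ((K * c `^ p)%:E * mu E <= K%:E * mass p D)%E.
  rewrite -integral_cst//.
  apply: (@le_trans _ _ (\int[mu]_x (\sum_(j < k.+1)
      (`|D (x + (j%:R * h) *: e_ i)| `^ p)%:E))%E).
    rewrite [leLHS]integral_mkcond; apply: ge0_le_integral => //.
    - move=> x _; rewrite patchE; case: ifPn => // _.
      by rewrite lee_fin mulr_ge0 ?powR_ge0// ltW.
    - by apply/(measurable_restrictT _ _).1 => //; exact: measurable_cst.
    - apply: emeasurable_sum => j; apply: measurable_abs_powR.
      by apply: (measurableT_comp mD); exact: measurable_fun_shift.
    - move=> x _; rewrite patchE sumEFin; case: ifPn => [/set_mem/pw|_].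
        by rewrite lee_fin.
      by rewrite lee_fin sumr_ge0// => j _; exact: powR_ge0.
  rewrite ge0_integral_sum//.
  - rewrite (eq_bigr (fun=> mass p D)).
      rewrite (eq_bigr (fun=> 1%:E * mass p D)%E); last by move=> *; rewrite mul1e.
      by rewrite -ge0_sume_distrl// sumEFin sumr_const card_ord.
    by move=> j _; exact: mass_shift.
  - move=> j; apply: measurable_abs_powR.
    by apply: (measurableT_comp mD); exact: measurable_fun_shift.
by rewrite -(@lee_pmul2l _ K%:E)// muleA -EFinM.
Qed.

Lemma mass_split p w w' : 0 <= p -> measurable_fun setT w -> measurable_fun setT w' ->
  (mass p w <= (2 `^ p)%:E * (mass p w' + mass p (fun x => w x - w' x)%R))%E.
Proof.
move=> p0 mw mw'; have mB : measurable_fun setT (fun x => w x - w' x).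
  exact: measurable_funB.
rewrite /mass -ge0_integralD//; [|exact: measurable_abs_powR..].
rewrite -ge0_integralZl//.
- apply: ge0_le_integral => //.
  + exact: measurable_abs_powR.
  + by apply: measurable_funeM; apply: emeasurable_funD; exact: measurable_abs_powR.
  + move=> x _; rewrite -EFinD -EFinM lee_fin; apply: le_trans (powRD_le p0 _ _) => //.
    by apply: powR_mono => //; rewrite -{1}(subrK (w' x) (w x)) addrC ler_normD.
- by apply: emeasurable_funD; exact: measurable_abs_powR.
- by move=> x _; rewrite adde_ge0// lee_fin powR_ge0.
Qed.

Lemma jump_weak phi i p s t : smooth phi -> bsupp phi -> 1 <= p ->
  0 < s -> 0 < t ->
  (mu [set x | (t < `|phi (x + s *: e_ i) - phi x|)%R] <=
   ((4 * s / t) `^ p)%:E * mass p (partial i phi))%E.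
Proof.
move=> sphi bphi p1 s0 t0; have p0 : 0 <= p by lra.
have [C [l hC]] := dq_dominated i sphi bphi s0.
have [C' C'0 hC'] := bsupp_bounded (smooth_continuous (smooth_partial i sphi))
  (bsupp_partial i bphi).
pose B := `|C| + C' + 1; have B0 : 0 < B by rewrite /B; have := normr_ge0 C; lra.
have mp : measurable_fun setT (partial i phi) by apply: smooth_measurable; exact: smooth_partial.
pose a k := (\int[mu]_x `|dq i phi (s / k.+1%:R) x - partial i phi x|%:E)%E.
have key k : (mu [set x | (t < `|phi (x + s *: e_ i) - phi x|)%R] <=
   ((4 * s / t) `^ p)%:E * (mass p (partial i phi) + (B `^ (p - 1))%:E * a k))%E.
  have := jump_le_increments i k sphi bphi p1 s0 t0.
  set K : R := k.+1%:R; set h := s / K; set c := t / (2 * K).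
  have K0 : 0 < K by rewrite ltr0n.
  have c0 : 0 < c by rewrite divr_gt0// mulr_gt0.
  have h0 : 0 < h by rewrite divr_gt0.
  have hs : h <= s by rewrite ler_pdivrMr// ler_peMr ?ler1n// ltW.
  have mq : measurable_fun setT (dq i phi h) by exact: measurable_dq.
  rewrite (_ : (fun x => _) = (fun x => h * dq i phi h x)); last first.
    by apply/funext => x; rewrite /dq mulrA divff ?mul1r// gt_eqF.
  rewrite massZ ?(ltW h0)// => H.
  have {}H : (mu [set x | (t < `|phi (x + s *: e_ i) - phi x|)%R] <=
      ((2 * s / t) `^ p)%:E * mass p (dq i phi h))%E.
    have -> : 2 * s / t = c^-1 * h by rewrite /c /h; field; rewrite !gt_eqF.
    rewrite powRM ?invr_ge0 ?(ltW c0) ?(ltW h0)// EFinM -muleA.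
    rewrite -[leLHS]mul1e.
    have -> : (1 = (c^-1 `^ p)%:E * (c `^ p)%:E :> \bar R)%E.
      by rewrite -EFinM -powRM ?invr_ge0 ?(ltW c0)// mulVf ?powR1// gt_eqF.
    by rewrite -muleA lee_wpmul2l// lee_fin powR_ge0.
  apply: le_trans H _.
  have -> : 4 * s / t = (2 * s / t) * 2 by ring.
  have st0 : 0 <= 2 * s / t by rewrite divr_ge0 ?mulr_ge0 ?(ltW s0) ?(ltW t0).
  rewrite [(_ * 2) `^ p]powRM// EFinM -muleA.
  apply: lee_wpmul2l; first by rewrite lee_fin powR_ge0.
  apply: le_trans (mass_split p0 mq mp) _.
  apply: lee_wpmul2l; first by rewrite lee_fin powR_ge0.
  apply: leeD2l; rewrite /a -/K -/h -ge0_integralZl//.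
  - apply: ge0_le_integral => //.
    + by apply: measurable_abs_powR; exact: measurable_funB.
    + apply/measurable_EFinP; apply: measurable_funM => //.
      by apply: measurableT_comp => //; exact: measurable_funB.
    + move=> x _; rewrite lee_fin -mulr_powRB1 ?normr_ge0//; last by lra.
      rewrite mulrC ler_wpM2r//; apply: powR_mono; rewrite ?subr_ge0//.
      have := hC h x h0 hs; have := hC' x.
      have : C * \1_(cube l) x <= `|C|.
        rewrite (le_trans (ler_norm _))// normrM ler_piMr// indicE.
        by case: (_ \in _); rewrite ?normr1 ?normr0.
      by have := ler_normB (dq i phi h x) (partial i phi x); rewrite /B; lra.
  - by apply/measurable_EFinP; apply: measurableT_comp => //; exact: measurable_funB.
  - by rewrite lee_fin powR_ge0.
have fm : mass p (partial i phi) \is a fin_num.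
  apply: mass_fin; [lra|exact: smooth_continuous (smooth_partial i sphi)|exact: bsupp_partial].
have [ha _] := dq_cvg_int i sphi bphi s0.
have hlim : (((4 * s / t) `^ p)%:E * (mass p (partial i phi) + (B `^ (p - 1))%:E * a k))%E
   @[k --> \oo] --> (((4 * s / t) `^ p)%:E * (mass p (partial i phi) + (B `^ (p - 1))%:E * 0))%E.
  apply: cvgeZl => //; apply: cvgeD; [by rewrite mule0 fin_num_adde_defl|exact: cvg_cst|].
  by apply: cvgeZl.
rewrite mule0 adde0 in hlim.
rewrite -(cvg_lim _ hlim)//; apply: lime_ge; last exact: nearW.
by apply/cvg_ex; eexists; exact: hlim.
Qed.

End weak_type.

Lemma measure_bigsetU_le d (T : measurableType d) (R : realType)
    (mu : {measure set T -> \bar R}) (I : Type) (s : seq I) (G : I -> set T) :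
  (forall i, measurable (G i)) ->
  (mu (\big[setU/set0]_(i <- s) G i) <= \sum_(i <- s) mu (G i))%E.
Proof.
move=> mG; elim: s => [|i s IH]; first by rewrite !big_nil measure0.
rewrite !big_cons; apply: le_trans (measureU2 _ _ _) _ => //.
  exact: bigsetU_measurable.
exact: leeD2l.
Qed.

Section weak_type_inequality.
Context {R : realType} {n : nat}.
Implicit Types (phi w : 'rV[R]_n -> R) (i : 'I_n) (p t h : R).
Local Notation mu := (lebesgue_rV R n).
Local Notation e_ i := (delta_mx ord0 i : 'rV[R]_n).

Lemma mass_partial_le p phi i : 0 <= p -> smooth phi ->
  (mass p (partial i phi) <= dirichlet p phi)%E.
Proof.
move=> p0 sphi; have mp : measurable_fun setT (partial i phi).
  by apply: smooth_measurable; exact: smooth_partial.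
rewrite /mass /dirichlet; apply: ge0_le_integral.
- exact: measurableT.
- by move=> x _; rewrite lee_fin powR_ge0.
- exact: measurable_abs_powR.
- exact: measurable_grad_powR.
- move=> x _; rewrite lee_fin powR_mono//.
  by have := ler_coord_enorm (grad phi x) i; rewrite mxE.
Qed.

(** The path from x to x + y follows the coordinate axes, [Y k] being y cut after its first k
    coordinates. A jump above t forces a jump above t / n on one of the n legs, and each leg is a
    translate of the situation of [jump_weak]. *)
Lemma jump_vec phi (y : 'rV[R]_n) p h t : smooth phi -> bsupp phi -> 1 <= p ->
  (0 < n)%N -> 0 < h -> 0 < t -> (forall i, 0 <= y ord0 i <= h) ->
  (mu [set x | (t < `|phi (x + y) - phi x|)%R] <=
   (n%:R * (4 * h * n%:R / t) `^ p)%:E * dirichlet p phi)%E.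
Proof.
move=> sphi bphi p1 n0 h0 t0 yh; have p0 : 0 <= p by lra.
have n0' : (0 : R) < n%:R by rewrite ltr0n.
pose Y (k : nat) : 'rV[R]_n := \row_i (if (i < k)%N then y ord0 i else 0).
have YS (k : 'I_n) : Y k.+1 = y ord0 k *: e_ k + Y k.
  apply/rowP => i; rewrite !mxE eqxx/= ltnS leq_eqVlt.
  have [->|ik] := eqVneq i k; first by rewrite eqxx ltnn mulr1 addr0.
  by rewrite (negbTE ik : (val i == val k) = false) mulr0 add0r.
pose F (k : 'I_n) := [set x | t / n%:R < `|phi (x + y ord0 k *: e_ k) - phi x|].
pose G (k : 'I_n) := (fun x => x + Y k) @^-1` F k.
have mF k : measurable (F k) by exact: measurable_jump.
have mG k : measurable (G k).
  by rewrite -[G k]setTI; exact: (@measurable_fun_shift R n (Y k) measurableT).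
have EG : [set x | t < `|phi (x + y) - phi x|] `<=` \big[setU/set0]_k G k.
  move=> x /= tx; rewrite -bigcup_seq/=; apply: contrapT => hG.
  have tel : phi (x + y) - phi x = \sum_(k < n) (phi (x + Y k.+1) - phi (x + Y k)).
    have := @telescope_sumr _ 0 n (fun k => phi (x + Y k)) (leq0n _).
    rewrite big_mkord => ->.
    congr (phi _ - phi _).
      by congr (_ + _); apply/rowP => i; rewrite !mxE ltn_ord.
    by rewrite (_ : Y 0%N = 0) ?addr0//; apply/rowP => i; rewrite !mxE.
  have : `|phi (x + y) - phi x| <= \sum_(k < n) (t / n%:R).
    rewrite tel; apply: le_trans (ler_norm_sum _ _ _) _; apply: ler_sum => k _.
    rewrite leNgt; apply/negP => tk; apply: hG; exists k; first exact: mem_index_enum.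
    rewrite /G /F /= -addrA [Y k + _]addrC -YS; exact: tk.
  rewrite sumr_const card_ord -(mulr_natr (t / n%:R)) divfK ?gt_eqF//.
  by rewrite leNgt tx.
have muF k : (mu (G k) <= ((4 * h * n%:R / t) `^ p)%:E * dirichlet p phi)%E.
  rewrite /G lebesgue_rV_shift//.
  have /andP[y0 yh'] := yh k.
  have [yk0|yk0] := eqVneq (y ord0 k) 0.
    rewrite (_ : F k = set0) ?measure0 ?mule_ge0 ?dirichlet_ge0 ?lee_fin ?powR_ge0//.
    rewrite /F yk0 scale0r; apply/seteqP; split => // x /=.
    by rewrite addr0 subrr normr0 ltNge divr_ge0 ?ltW.
  have y0' : 0 < y ord0 k by rewrite lt_def yk0.
  apply: le_trans (jump_weak k sphi bphi p1 y0' (divr_gt0 t0 n0')) _.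
  apply: lee_pmul.
  - by rewrite lee_fin powR_ge0.
  - exact: mass_ge0.
  - rewrite lee_fin powR_mono//.
      by rewrite divr_ge0 ?divr_ge0 ?mulr_ge0 ?(ltW t0) ?ltW.
    rewrite invf_div mulrA ler_pM2r ?invr_gt0// ler_pM2r// ler_pM2l//.
  - exact: mass_partial_le.
apply: (@le_trans _ _ (mu (\big[setU/set0]_k G k))).
  apply: le_measure => //; rewrite inE; first exact: measurable_jump.
  by apply: bigsetU_measurable => k _.
apply: (@le_trans _ _ (\sum_(k < n) mu (G k))%E).
  exact: measure_bigsetU_le.
apply: (@le_trans _ _ (\sum_(k < n) (((4 * h * n%:R / t) `^ p)%:E * dirichlet p phi))%E).
  by apply: lee_sum => k _; exact: muF.
rewrite EFinM -muleA.
rewrite (eq_bigr (fun=> 1%:E * (((4 * h * n%:R / t) `^ p)%:E * dirichlet p phi))%E).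
  by rewrite -ge0_sume_distrl// sumEFin sumr_const card_ord.
by move=> *; rewrite mul1e.
Qed.

Lemma lebesgue_cube0 h : 0 < h ->
  mu (box (fun=> 0) (fun=> h)) = (h ^+ n)%:E.
Proof.
move=> h0; rewrite lebesgue_box (eq_bigr (fun=> h%:E)).
  by rewrite prodEFin prodr_const card_ord.
by move=> i _; rewrite lebesgue_measure_itv/= lte_fin h0 sube0.
Qed.

(* Averages over a cube of side [h] are at most [t], while [phi] differs from
   them by at most [h |grad phi|] in norm. *)
Lemma weak_type phi p h t : smooth phi -> bsupp phi -> 1 <= p ->
  (0 < n)%N -> 0 < h -> 0 < t -> (mass p phi <= (t `^ p * (h ^+ n / 2))%:E)%E ->
  (mu [set x | (2 * t < `|phi x|)%R] <=
   (2 * (n%:R * (4 * h * n%:R / t) `^ p))%:E * dirichlet p phi)%E.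
Proof.
move=> sphi bphi p1 n0 h0 t0 Mphi; have p0 : 0 < p by lra.
have mphi := smooth_measurable sphi.
have mn : measurable_fun setT (fun x => `|phi x|) by exact: measurableT_comp.
pose L := [set x | t < `|phi x|].
have mL : measurable L.
  by have := mn measurableT _ (measurable_itv `]t, +oo[); rewrite setTI set_itvoy.
set E := [set x | _].
have mE : measurable E.
  by have := mn measurableT _ (measurable_itv `]2 * t, +oo[); rewrite setTI set_itvoy.
(* By Chebyshev's inequality L fills at most half of any cube of side h. *)
have muL : (mu L <= (h ^+ n / 2)%:E)%E.
  have := chebyshev mu measurableT mphi p0 t0; rewrite setTI => H.
  by have := le_trans H Mphi; rewrite EFinM lee_pmul2l// lte_fin powR_gt0.
(* Finiteness is what allows half of the measure of E to be absorbed into the left side at the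
   end. *)
have Efin : mu E \is a fin_num.
  have [k hk] := bphi; rewrite ge0_fin_numE ?measure_ge0//.
  apply: le_lt_trans (mu_cube k); apply: le_measure; rewrite ?inE//; first exact: mcube.
  move=> x Ex; apply: contrapT => /hk x0; move: Ex.
  by rewrite /E /= x0 normr0 ltNge mulr_ge0// ltW.
set B : \bar R := ((n%:R * (4 * h * n%:R / t) `^ p)%:E * dirichlet p phi)%E.
have B0 : (0 <= B)%E.
  by rewrite mule_ge0 ?dirichlet_ge0// lee_fin mulr_ge0 ?powR_ge0.
pose Y : set 'rV[R]_n := box (fun=> 0) (fun=> h).
have mY : measurable Y by exact: measurable_obox.
pose Z (x y : 'rV[R]_n) : R := \1_E x * \1_L (x + y).
(* A point of E is above 2t; either its translate by y stays in L, or the value drops by more than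
   t, which [jump_vec] controls. *)
have EY y : Y y -> (mu E <= \int[mu]_x (Z x y)%:E + B)%E.
  move=> Yy; pose Ly := (fun x => x + y) @^-1` L.
  have mLy : measurable Ly.
    by rewrite -[X in measurable X]setTI; exact: (@measurable_fun_shift R n y measurableT).
  have -> : (\int[mu]_x (Z x y)%:E = mu (E `&` Ly))%E.
    rewrite -(setIT (E `&` Ly)) -integral_indic//; last exact: measurableI.
    by apply: eq_integral => x _; rewrite /Z indicI.
  apply: (@le_trans _ _ (mu ((E `&` Ly) `|`
      [set x | t < `|phi (x + y) - phi x|]))).
    apply: le_measure; rewrite ?inE//.
      by apply: measurableU; [exact: measurableI|exact: measurable_jump].
    move=> x Ex; case: (ltP t `|phi (x + y)|) => tx; [by left|right].
    move: Ex; rewrite /E /= => Ex.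
    have := ler_normB (phi (x + y)) (phi (x + y) - phi x).
    by rewrite subKr; lra.
  apply: le_trans (measureU2 _ _ _) _.
  - exact: measurableI.
  - exact: measurable_jump.
  - apply: leeD2l; apply: jump_vec => // i.
    by have /andP[/ltW -> /ltW ->] := Yy i.
have madd : measurable_fun setT (fun z : 'rV[R]_n * 'rV[R]_n => z.1 + z.2).
  apply: measurable_fun_rVP => i; under eq_fun do rewrite mxE.
  apply: measurable_funD; apply: (measurableT_comp (measurable_rV_coord _)).
    exact: measurable_fst.
  exact: measurable_snd.
have mi A (mA : measurable A) : measurable_fun setT (\1_A : 'rV[R]_n -> R).
  exact: measurable_indic.
have mZ : measurable_fun setT (fun z : 'rV[R]_n * 'rV[R]_n => (Z z.1 z.2)%:E).
  apply/measurable_EFinP; apply: measurable_funM.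
    exact: (measurableT_comp (mi E mE) measurable_fst).
  exact: (measurableT_comp (mi L mL) madd).
have Z0 x y : (0 <= (Z x y)%:E)%E by rewrite lee_fin mulr_ge0.
have mZy : measurable_fun setT (fun y => \int[mu]_x (Z x y)%:E)%E.
  exact: (measurable_fun_fubini_tonelli_G (m1 := mu) (fun z => (Z z.1 z.2)%:E) mZ (fun z => Z0 z.1 z.2)).
have H1 : (mu E * (h ^+ n)%:E <= \int[mu]_(y in Y) \int[mu]_x (Z x y)%:E + B * (h ^+ n)%:E)%E.
  rewrite -(lebesgue_cube0 h0) -!integral_cst// -ge0_integralD//.
  - apply: ge0_le_integral => //.
    by apply: emeasurable_funD => //; exact: measurable_funTS.
  - by move=> y _; exact: integral_ge0.
  - exact: measurable_funTS.
(* By Tonelli, for each x in E the y with x + y in L have the measure of L, at most half that of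
   [Y]. *)
have H2 : (\int[mu]_(y in Y) \int[mu]_x (Z x y)%:E <= mu E * (h ^+ n / 2)%:E)%E.
  apply: (@le_trans _ _ (\int[mu]_y \int[mu]_x (Z x y)%:E)%E).
    by apply: ge0_subset_integral => // y _; exact: integral_ge0.
  rewrite -(fubini_tonelli (m1 := mu) (m2 := mu) (fun z => (Z z.1 z.2)%:E) mZ (fun z => Z0 z.1 z.2)).
  have EZ x : (\int[mu]_y (Z x y)%:E = (\1_E x)%:E * mu L)%E.
    rewrite /Z; under eq_integral do rewrite EFinM.
    rewrite ge0_integralZl//.
    + congr (_ * _)%E; rewrite -[in RHS](lebesgue_rV_shift x mL).
      set Lx := _ @^-1` L; rewrite -(setIT Lx) -integral_indic//.
        by apply: eq_integral => y _; rewrite addrC.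
      by rewrite -[X in measurable X]setTI; exact: (@measurable_fun_shift R n x measurableT).
    + apply/measurable_EFinP; apply: (measurableT_comp (mi L mL)).
      rewrite (_ : +%R x = (fun y => y + x)); first exact: measurable_fun_shift.
      by apply/funext => y; rewrite addrC.
  under eq_integral do rewrite /= EZ muleC.
  rewrite ge0_integralZl//.
    by rewrite integral_indic// setIT muleC lee_wpmul2l.
  exact/measurable_EFinP/measurable_indic.
have Bfin : B \is a fin_num.
  by rewrite fin_numM//; apply: dirichlet_fin.
rewrite EFinM -muleA -/B.
have := le_trans H1 (leeD2r (B * (h ^+ n)%:E)%E H2).
move: Efin Bfin; case: (mu E) => // e _; case: B {B0 EY H1 H2} => // b _.
rewrite -!EFinM -EFinD !lee_fin => H.
have hn : 0 < h ^+ n by rewrite exprn_gt0.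
rewrite -(ler_pM2r hn); lra.
Qed.

End weak_type_inequality.

(** * Integrated power inequalities, and finiteness of the L^r norm *)

Section integral_inequalities.
Context d (T : measurableType d) (R : realType) (mu : {measure set T -> \bar R}).
Variables (D : set T) (mD : measurable D).
Implicit Types (f g h : T -> R) (p t : R).

Lemma measurable_EFin_powR f p : measurable_fun D f ->
  measurable_fun D (fun x => (f x `^ p)%:E).
Proof. by move=> mf; apply/measurable_EFinP; exact: (measurableT_comp (measurable_powR _)). Qed.

Lemma integral_powRD_le f g h p : 0 <= p ->
  measurable_fun D f -> measurable_fun D g -> measurable_fun D h ->
  (forall x, 0 <= f x) -> (forall x, 0 <= g x) -> (forall x, 0 <= h x) ->
  (forall x, D x -> f x <= g x + h x) ->
  (\int[mu]_(x in D) (f x `^ p)%:E <= (2 `^ p)%:E *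
   (\int[mu]_(x in D) (g x `^ p)%:E + \int[mu]_(x in D) (h x `^ p)%:E))%E.
Proof.
move=> p0 mf mg mh f0 g0 h0 fgh.
have m1 := measurable_EFin_powR p mg; have m2 := measurable_EFin_powR p mh.
have P0 (k : T -> R) x : D x -> (0 <= (k x `^ p)%:E)%E by rewrite lee_fin powR_ge0.
rewrite -ge0_integralD//; [|exact: P0|exact: P0].
rewrite -ge0_integralZl//.
- apply: ge0_le_integral => //.
  + exact: P0.
  + exact: measurable_EFin_powR.
  + by apply: measurable_funeM; exact: emeasurable_funD.
  + move=> x Dx; rewrite -EFinD -EFinM lee_fin; apply: le_trans (powRD_le p0 _ _) => //.
    by apply: powR_mono => //; exact: fgh.
- exact: emeasurable_funD.
- by move=> x _; rewrite adde_ge0// lee_fin powR_ge0.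
Qed.

Lemma integral_powR_perturb f g h p t : 0 <= p -> 0 < t < 1 ->
  measurable_fun D f -> measurable_fun D g -> measurable_fun D h ->
  (forall x, 0 <= f x) -> (forall x, 0 <= g x) -> (forall x, 0 <= h x) ->
  (forall x, D x -> `|f x - g x| <= h x) ->
  (((1 - t) `^ p)%:E * \int[mu]_(x in D) (f x `^ p)%:E <=
   \int[mu]_(x in D) (g x `^ p)%:E + (t^-1 `^ p)%:E * \int[mu]_(x in D) (h x `^ p)%:E)%E.
Proof.
move=> p0 t01 mf mg mh f0 g0 h0 fgh.
have m1 := measurable_EFin_powR p mg; have m2 := measurable_EFin_powR p mh.
have m3 := measurable_EFin_powR p mf.
have P0 (k : T -> R) x : D x -> (0 <= (k x `^ p)%:E)%E by rewrite lee_fin powR_ge0.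
rewrite -!ge0_integralZl//; try (by move=> x _; rewrite lee_fin powR_ge0);
  try (by rewrite lee_fin powR_ge0).
rewrite -ge0_integralD//.
- apply: ge0_le_integral => //.
  + by move=> x _; rewrite -EFinM lee_fin mulr_ge0 ?powR_ge0.
  + exact: measurable_funeM.
  + by apply: emeasurable_funD => //; exact: measurable_funeM.
  + move=> x Dx; rewrite -!EFinM -EFinD lee_fin.
    apply: le_trans (powR_perturb p0 t01 (f0 x) (g0 x)) _.
    by rewrite lerD2l ler_wpM2l ?powR_ge0// powR_mono// fgh.
- exact: P0.
- by move=> x _; rewrite -EFinM lee_fin mulr_ge0 ?powR_ge0.
- exact: measurable_funeM.
Qed.

Lemma fin_integral_powR f p : (\int[mu]_(x in D) (f x `^ p)%:E < +oo)%E ->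
  exists2 b : R, 0 <= b & (\int[mu]_(x in D) (f x `^ p)%:E = b%:E)%E.
Proof.
have f0 : (0 <= \int[mu]_(x in D) (f x `^ p)%:E)%E.
  by apply: integral_ge0 => x _; rewrite lee_fin powR_ge0.
move: (\int[mu]_(x in D) _)%E f0 => I I0 Ioo.
by exists (fine I); [exact: fine_ge0|rewrite fineK// ge0_fin_numE].
Qed.

End integral_inequalities.

Lemma powR_exprn (R : realType) (x s : R) j : 0 <= x -> (x `^ s) ^+ j = (x ^+ j) `^ s.
Proof. by move=> x0; rewrite -powR_mulrn ?powR_ge0// powRAC powR_mulrn. Qed.

Section embedding.
Context {R : realType} {n : nat}.
Variable Omega : set 'rV[R]_n.
Implicit Types (u phi : 'rV[R]_n -> R) (p q r t : R).
Local Notation mu := (lebesgue_rV R n).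
Local Notation enorm := (@euclidean_norm R n).
Hypothesis oO : open Omega.
Let mO : measurable Omega := open_measurable_rV oO.

Lemma measurable_enorm_grad phi : smooth phi ->
  measurable_fun setT (fun x => enorm (grad phi x)).
Proof.
move=> sw; apply: measurable_enorm => i; under eq_fun do rewrite mxE.
by apply: smooth_measurable; exact: smooth_partial.
Qed.

Lemma integral_dirichlet_Omega p phi : 0 < p -> test_function Omega phi ->
  (\int[mu]_(x in Omega) (enorm (grad phi x) `^ p)%:E = dirichlet p phi)%E.
Proof.
move=> p0 tphi; apply: integral_Omega => // x xO.
by rewrite (test_grad_out tphi)// enorm0 powR0// gt_eqF.
Qed.

Lemma W01p_dirichlet_lty p u : 0 < p -> W01p Omega p u ->
  (\int[mu]_(x in Omega) (enorm (weak_gradient Omega u x) `^ p)%:E < +oo)%E.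
Proof.
move=> p0 Wu; have ug := W01p_weak_gradient Wu.
have [phi [tphi _ h]] := W01p_approx oO p0 Wu ltr01.
have [sphi _ _] := tphi.
have mg : measurable_fun Omega (fun x => enorm (grad phi x)).
  by apply: measurable_funTS; exact: measurable_enorm_grad.
apply: le_lt_trans (integral_powRD_le mu mO (ltW p0)
   (is_weak_gradient_measurable ug) mg
   (is_weak_gradient_measurable (is_weak_gradientB oO ug (is_weak_gradient_test tphi)))
   _ _ _ _) _ => // [x|x|x|x _|]; try exact: enorm_ge0.
  by rewrite addrC -{1}(subrK (grad phi x) (weak_gradient Omega u x)) enorm_triangle.
rewrite integral_dirichlet_Omega//; apply: lte_mul_pinfty => //.
apply: lte_add_pinfty; last by apply: lt_trans h _; exact: ltry.
by rewrite ltey_eq dirichlet_fin//; exact: test_bsupp tphi.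
Qed.

(** Bounds common to all test functions within distance 1 of u. They let the approximating function
    depend on the level t in [W01p_weak_type] while the constant does not. *)
Lemma W01p_bounds p u : 0 < p -> W01p Omega p u ->
  (\int[mu]_(x in Omega) (`|u x| `^ p)%:E < +oo)%E ->
  exists M0 G0 : R, [/\ 0 < M0, 0 <= G0 & forall phi, test_function Omega phi ->
    (\int[mu]_(x in Omega) (`|u x - phi x| `^ p)%:E < 1%:E)%E ->
    (\int[mu]_(x in Omega) (enorm (weak_gradient Omega u x - grad phi x) `^ p)%:E
      < 1%:E)%E -> (mass p phi <= M0%:E)%E /\ (dirichlet p phi <= G0%:E)%E].
Proof.
move=> p0 Wu Aoo; have ug := W01p_weak_gradient Wu.
have Goo := W01p_dirichlet_lty p0 Wu.
have [A A0 AE] := fin_integral_powR Aoo.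
have [G G0 GE] := fin_integral_powR Goo.
exists (2 `^ p * (A + 1)), (2 `^ p * (G + 1)); split.
- by rewrite mulr_gt0// ?powR_gt0// ltr_wpDl.
- by rewrite mulr_ge0 ?powR_ge0// addr_ge0.
move=> phi tphi h1 h2; have [sphi _ _] := tphi.
have mu_ := W01p_measurable Wu.
have mphi : measurable_fun Omega phi by apply: measurable_funTS; exact: smooth_measurable.
split.
- rewrite -(integral_mass_test p0 tphi).
  apply: (@le_trans _ _ ((2 `^ p)%:E *
      (\int[mu]_(x in Omega) (`|u x| `^ p)%:E + \int[mu]_(x in Omega) (`|u x - phi x| `^ p)%:E))%E).
    apply: integral_powRD_le => //; try exact: ltW; try exact: measurableT_comp.
      by apply: measurableT_comp => //; exact: measurable_funB.
    by move=> x _; rewrite -{1}(subKr (u x) (phi x)) ler_normB.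
  rewrite AE EFinM; apply: lee_wpmul2l; first by rewrite lee_fin powR_ge0.
  by rewrite EFinD; exact: (leeD2l _ (ltW h1)).
- rewrite -(integral_dirichlet_Omega p0 tphi).
  apply: (@le_trans _ _ ((2 `^ p)%:E *
      (\int[mu]_(x in Omega) (enorm (weak_gradient Omega u x) `^ p)%:E + \int[mu]_(x in Omega)
      (enorm (weak_gradient Omega u x - grad phi x) `^ p)%:E))%E).
    apply: integral_powRD_le => //; try (by move=> x; exact: enorm_ge0); try exact: ltW.
    + by apply: measurable_funTS; exact: measurable_enorm_grad.
    + exact: is_weak_gradient_measurable ug.
    + exact: (is_weak_gradient_measurable
        (is_weak_gradientB oO ug (is_weak_gradient_test tphi))).
    + move=> x _; rewrite -{1}(subKr (weak_gradient Omega u x) (grad phi x)).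
      by apply: le_trans (enorm_triangle _ _) _; rewrite enormN.
  rewrite GE EFinM; apply: lee_wpmul2l; first by rewrite lee_fin powR_ge0.
  by rewrite EFinD; exact: (leeD2l _ (ltW h2)).
Qed.

(** The level 3t is split into t for u - phi, made negligible by approximation, and 2t for phi,
    where [weak_type] applies. The exponent comes from the cube size h of order t^(-p/n), for which
    (h / t)^p is of order t^(-(p + p^2/n)). *)
Lemma W01p_weak_type p u : 1 <= p -> (0 < n)%N -> W01p Omega p u ->
  (\int[mu]_(x in Omega) (`|u x| `^ p)%:E < +oo)%E ->
  exists2 C : R, 0 <= C & forall t, 0 < t ->
    (mu (Omega `&` [set x | (3 * t < `|u x|)%R]) <=
      (C * t `^ (- (p + p ^+ 2 / n%:R)))%:E)%E.
Proof.
move=> p1 n0 Wu Aoo; have p0 : 0 < p by lra.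
have [M0 [G0 [M00 G00 hMG]]] := W01p_bounds p0 Wu Aoo.
have n0' : (0 : R) < n%:R by rewrite ltr0n.
pose K : R := (2 * M0) `^ (n%:R^-1).
have K0 : 0 < K by rewrite powR_gt0// mulr_gt0.
exists (2 * (n%:R * ((4 * n%:R) `^ p * K `^ p)) * G0).
  by rewrite mulr_ge0// mulr_ge0// mulr_ge0// mulr_ge0 ?powR_ge0.
move=> t t0; apply/lee_addgt0Pr => e e0.
(* With this tolerance Chebyshev's inequality at height t leaves at most e. *)
pose e' := Num.min 1 (e * t `^ p).
have e'0 : 0 < e' by rewrite lt_min ltr01 mulr_gt0 ?powR_gt0.
have [phi [tphi h1 h2]] := W01p_approx oO p0 Wu e'0.
have [sphi _ _] := tphi; have bphi := test_bsupp tphi.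
have e'1 : (e'%:E <= 1%:E)%E by rewrite lee_fin ge_min lexx.
have [mphi dphi] := hMG phi tphi (lt_le_trans h1 e'1) (lt_le_trans h2 e'1).
(* The solution of t^p h^n / 2 = M0, the smallest cube for which the mass condition of [weak_type]
   is guaranteed. *)
pose h := K * t `^ (- (p / n%:R)).
have h0 : 0 < h := mulr_gt0 K0 (powR_gt0 _ t0).
have hn : t `^ p * (h ^+ n / 2) = M0.
  rewrite /h exprMn -!powR_mulrn ?powR_ge0 ?(ltW K0)// -!powRrM.
  rewrite mulVf ?gt_eqF// powRr1 ?mulr_ge0 ?(ltW M00)//.
  rewrite mulNr divfK ?gt_eqF// powRN.
  by field; rewrite gt_eqF ?powR_gt0.
have wt := weak_type sphi bphi p1 n0 h0 t0.
rewrite hn in wt; have {}wt := wt mphi.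
have hp : (4 * h * n%:R / t) `^ p = (4 * n%:R) `^ p * K `^ p * t `^ (- (p + p ^+ 2 / n%:R)).
  have -> : 4 * h * n%:R / t = (4 * n%:R) * K * (t `^ (- (p / n%:R)) * t `^ (-1)).
    by rewrite powR_inv1 ?(ltW t0)// /h; ring.
  rewrite -powRD; last by rewrite (gt_eqF t0) implybT.
  rewrite !powRM ?mulr_ge0 ?powR_ge0 ?(ltW K0)// -powRrM; congr (_ * t `^ _).
  by rewrite expr2; ring.
have mu_ := W01p_measurable Wu.
have mphi_ : measurable_fun Omega phi by apply: measurable_funTS; exact: smooth_measurable.
have mlev (f : 'rV[R]_n -> R) (s : R) : measurable_fun Omega f ->
    measurable (Omega `&` [set x | s < `|f x|]).
  move=> mf; have mnf : measurable_fun Omega (fun x => `|f x|) by exact: measurableT_comp.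
  by have := mnf mO _ (measurable_itv `]s, +oo[); rewrite set_itvoy.
have ml1 := mlev _ t (measurable_funB mu_ mphi_).
have ml2 := mlev _ (2 * t) mphi_.
apply: (@le_trans _ _ (mu ((Omega `&` [set x | t < `|u x - phi x|]) `|`
    (Omega `&` [set x | 2 * t < `|phi x|])))).
  apply: le_measure; rewrite ?inE; [exact: mlev|exact: measurableU|].
  move=> x [Ox /= ux]; case: (ltP t `|u x - phi x|) => h3; [by left|right].
  split => //=; have := ler_normD (u x - phi x) (phi x); rewrite subrK; lra.
apply: le_trans (measureU2 _ ml1 ml2) _.
rewrite addeC; apply: leeD.
- apply: (@le_trans _ _ (mu [set x | 2 * t < `|phi x|])).
    apply: le_measure; rewrite ?inE//.
    have mnf : measurable_fun setT (fun x => `|phi x|).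
      by apply: measurableT_comp => //; exact: smooth_measurable.
    by have := mnf measurableT _ (measurable_itv `]2 * t, +oo[); rewrite setTI set_itvoy.
  apply: le_trans wt _; rewrite hp.
  apply: (@le_trans _ _ ((2 * (n%:R * ((4 * n%:R) `^ p * K `^ p *
      t `^ (- (p + p ^+ 2 / n%:R)))))%:E * G0%:E)%E).
    by rewrite lee_wpmul2l// lee_fin !mulr_ge0 ?powR_ge0.
  by rewrite -EFinM lee_fin le_eqVlt; apply/orP; left; apply/eqP; ring.
- have tp0 : 0 < t `^ p by rewrite powR_gt0.
  rewrite -(@lee_pmul2l _ (t `^ p)%:E)//.
  apply: le_trans (chebyshev mu mO (measurable_funB mu_ mphi_) p0 t0) _.
  apply: le_trans (ltW h1) _; rewrite -EFinM lee_fin mulrC.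
  by rewrite ge_min lexx orbT.
Qed.

(** Where |u| <= 3 the r-th power is dominated by the p-th. Above, the levels 3 * 2^j contribute a
    geometric series of ratio 2^(r - q), which converges because r < q. *)
Lemma W01p_embedding p r u : 1 <= p -> (0 < n)%N -> p < r -> r < p + p ^+ 2 / n%:R ->
  W01p Omega p u ->
  (\int[mu]_(x in Omega) (`|u x| `^ p)%:E < +oo)%E ->
  (\int[mu]_(x in Omega) (`|u x| `^ r)%:E < +oo)%E.
Proof.
move=> p1 n0 pr rq Wu Aoo; have [C C0 hC] := W01p_weak_type p1 n0 Wu Aoo.
set q := p + p ^+ 2 / n%:R in rq hC.
have mu_ := W01p_measurable Wu.
have r0 : 0 < r by lra.
have mlev (s : R) : measurable (Omega `&` [set x | s < `|u x|]).
  have mnf : measurable_fun Omega (fun x => `|u x|) by exact: measurableT_comp.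
  by have := mnf mO _ (measurable_itv `]s, +oo[); rewrite set_itvoy.
pose f (j : nat) (x : 'rV[R]_n) : \bar R :=
  (((3 * 2 ^+ j.+1) `^ r)%:E * (\1_(Omega `&` [set x | 3 * 2 ^+ j < `|u x|]) x)%:E)%E.
have f0 j x : (0 <= f j x)%E by rewrite mule_ge0// lee_fin// powR_ge0.
have mf j : measurable_fun Omega (f j).
  apply: measurable_funeM; apply/measurable_EFinP.
  by apply: measurable_funTS; exact: measurable_indic.
have pw x : Omega x -> ((`|u x| `^ r)%:E <=
    (3 `^ (r - p))%:E * (`|u x| `^ p)%:E + \sum_(j <oo) f j x)%E.
  move=> Ox; have S0 : (0 <= \sum_(j <oo) f j x)%E by apply: nneseries_ge0.
  case: (leP `|u x| 3) => ux.
    rewrite -[leLHS]adde0 leeD// -EFinM lee_fin.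
    have [->|u0] := eqVneq `|u x| 0; first by rewrite !powR0 ?mulr0 ?gt_eqF//; lra.
    have -> : r = (r - p) + p by rewrite subrK.
    rewrite powRD; last by rewrite u0 implybT.
    rewrite addrK ler_wpM2r ?powR_ge0// powR_mono//; lra.
  have [j0 hj0] : exists j, `|u x| <= 3 * 2 ^+ j.
    exists (Num.bound `|u x|).
    apply: (@le_trans _ _ (Num.bound `|u x|)%:R); first by apply: ltW; exact: archi_boundP.
    apply: (@le_trans _ _ (2 ^+ Num.bound `|u x|)).
      by rewrite -natrX ler_nat ltnW// ltn_expl.
    by rewrite ler_peMl// ?exprn_ge0//; lra.
  have ex : exists j, `|u x| <= 3 * 2 ^+ j by exists j0.
  (* The least dyadic level above |u x| is not the level 0, since |u x| > 3; its predecessor j is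
     the layer containing x. *)
  case: (ex_minnP ex) => [[|j]]; first by rewrite expr0 mulr1 leNgt ux.
  move=> uj hmin.
  have uj' : 3 * 2 ^+ j < `|u x|.
    by rewrite ltNge; apply/negP => /hmin; rewrite ltnn.
  apply: (@le_trans _ _ (f j x)).
    rewrite /f indicE mem_set// mule1 lee_fin powR_mono//; exact: ltW.
  apply: (@le_trans _ _ (\sum_(j <oo) f j x)%E); last first.
    by rewrite leeDr// mule_ge0// lee_fin powR_ge0.
  apply: le_trans (nneseries_lim_ge j.+1 (fun i _ _ => f0 i x)).
  by rewrite big_nat_recr//= leeDr// sume_ge0.
have mS : measurable_fun Omega (fun x => \sum_(j <oo) f j x)%E.
  by apply: ge0_emeasurable_sum.
apply: (@le_lt_trans _ _ (\int[mu]_(x in Omega) ((3 `^ (r - p))%:E * (`|u x| `^ p)%:E +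
    \sum_(j <oo) f j x))%E).
  apply: ge0_le_integral => //.
  - exact: measurable_abs_powR.
  - by apply: emeasurable_funD => //; apply: measurable_funeM; exact: measurable_abs_powR.
rewrite ge0_integralD//; first last.
- by move=> x _; exact: nneseries_ge0.
- by apply: measurable_funeM; exact: measurable_abs_powR.
apply: lte_add_pinfty.
  rewrite ge0_integralZl//.
  - by apply: lte_mul_pinfty => //; rewrite lee_fin powR_ge0.
  - exact: measurable_abs_powR.
rewrite integral_nneseries//.
pose rho : R := 2 `^ (r - q).
have rho0 : 0 < rho by rewrite powR_gt0.
have rho1 : rho < 1.
  rewrite /rho /powR pnatr_eq0/= expR_lt1 pmulr_llt0 ?subr_lt0//.
  by apply: ln_gt0; lra.
apply: (@le_lt_trans _ _ ((C * 6 `^ r) / (1 - rho))%:E); last exact: ltry.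
apply: lime_le; first by apply: is_cvg_nneseries => j _ _; exact: integral_ge0.
apply: nearW => N.
apply: (@le_trans _ _ (\sum_(0 <= j < N) (C * 6 `^ r * rho ^+ j)%:E)%E).
  apply: lee_sum => j _.
  rewrite /f ge0_integralZl//.
  + rewrite integral_indic// setIAC setIid.
    have t0 : (0 : R) < 2 ^+ j by rewrite exprn_gt0.
    apply: (@le_trans _ _ (((3 * 2 ^+ j.+1) `^ r)%:E * (C * (2 ^+ j) `^ (- q))%:E)%E).
      by apply: lee_wpmul2l; [rewrite lee_fin powR_ge0|exact: hC].
    rewrite -EFinM lee_fin le_eqVlt; apply/orP; left; apply/eqP.
    rewrite exprS mulrA (_ : 3 * 2 = 6 :> R); last by ring.
    rewrite powRM ?(ltW t0)//.
    rewrite (_ : rho ^+ j = (2 ^+ j) `^ r * (2 ^+ j) `^ (- q)); first by ring.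
    rewrite -powRD; last by rewrite (gt_eqF t0) implybT.
    by rewrite -powR_exprn.
  + by apply/measurable_EFinP; apply: measurable_funTS; exact: measurable_indic.
rewrite sumEFin lee_fin -mulr_sumr ler_wpM2l ?mulr_ge0 ?powR_ge0//.
have := subrX1 rho N; rewrite big_mkord => E.
have r1 : 0 < 1 - rho by lra.
rewrite -[leRHS]mul1r ler_pdivlMr// mulrC.
have : 0 <= rho ^+ N by rewrite exprn_ge0// ltW.
by move: E; lra.
Qed.

End embedding.

(** * Nonnegative approximation *)

Section integral_continuity.
Context d (T : measurableType d) (R : realType) (mu : {measure set T -> \bar R}).
Variables (D : set T) (mD : measurable D).

(** The closeness c depends only on p, A and e, never on the functions, and f and g may be
    exchanged; this gives upper and lower control of the approximants. *)
Lemma integral_powR_close (p A e : R) : 0 < p -> 0 <= A -> 0 < e ->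
  exists2 c : R, 0 < c & forall f g h : T -> R,
    measurable_fun D f -> measurable_fun D g -> measurable_fun D h ->
    (forall x, 0 <= f x) -> (forall x, 0 <= g x) -> (forall x, 0 <= h x) ->
    (forall x, D x -> `|f x - g x| <= h x) ->
    (\int[mu]_(x in D) (h x `^ p)%:E <= c%:E ->
     \int[mu]_(x in D) (f x `^ p)%:E <= A%:E ->
     \int[mu]_(x in D) (g x `^ p)%:E <= (A + e)%:E)%E.
Proof.
move=> p0 A0 e0; pose b : R := (Num.bound p)%:R.
have b0 : 0 <= b by rewrite ler0n.
have bAe : 0 <= b * (A + e) by rewrite mulr_ge0// addr_ge0// ltW.
(* Solves (1 - b t)(A + e) = A + t + t e, so that Bernoulli's bound on (1 - t)^p still beats A +
   t. *)
pose t := e / (b * (A + e) + 1 + e).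
have den0 : 0 < b * (A + e) + 1 + e by lra.
have t0 : 0 < t by rewrite divr_gt0.
have tE : t * (b * (A + e) + 1 + e) = e by rewrite divfK// gt_eqF.
have t1 : t < 1 by rewrite ltr_pdivrMr//; lra.
have t01 : 0 < t < 1 by rewrite t0.
exists (t * t `^ p); first by rewrite mulr_gt0// powR_gt0.
move=> f g h mf mg mh f0 g0 h0 fgh hc fA.
rewrite leNgt; apply/negP => hg.
have fgh' x : D x -> `|g x - f x| <= h x by move=> Dx; rewrite distrC fgh.
have := integral_powR_perturb mu mD (ltW p0) t01 mg mf mh g0 f0 h0 fgh'.
apply/negP; rewrite -ltNge.
have tp0 : 0 < t `^ p by rewrite powR_gt0.
apply: (@le_lt_trans _ _ (A + t)%:E).
  rewrite EFinD leeD//; apply: (@le_trans _ _ ((t^-1 `^ p)%:E * (t * t `^ p)%:E)%E).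
    by rewrite lee_wpmul2l// lee_fin powR_ge0.
  rewrite -EFinM lee_fin mulrCA -powRM ?invr_ge0 ?(ltW t0)//.
  by rewrite mulVf ?gt_eqF// powR1 mulr1.
have q0 : 0 < (1 - t) `^ p by rewrite powR_gt0//; lra.
apply: (@lt_trans _ _ (((1 - t) `^ p)%:E * (A + e)%:E)%E); last by rewrite lte_pmul2l.
rewrite -EFinM lte_fin.
have t1' : 0 < 1 - t <= 1 by lra.
have := powR_bernoulli (ltW p0) t1'; rewrite -/b => hb.
have Ae0 : 0 < A + e by lra.
have : (1 - b * (1 - (1 - t))) * (A + e) <= (1 - t) `^ p * (A + e) by rewrite ler_pM2r.
have te0 : 0 < t * e by rewrite mulr_gt0.
by move: tE te0; nra.
Qed.

(** Approximation is only in L^p, but the r-th powers are needed too. For functions truncated at K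
    an L^p bound controls the L^r distance, and monotone convergence says that truncation loses
    little. *)
Lemma integral_powR_truncation (r b e : R) (f : T -> R) : 0 < r -> 0 < e ->
  measurable_fun D f -> (forall x, 0 <= f x) ->
  (\int[mu]_(x in D) (f x `^ r)%:E = b%:E)%E ->
  exists k : nat, ((b - e)%:E < \int[mu]_(x in D) (Num.min (f x) k.+1%:R `^ r)%:E)%E.
Proof.
move=> r0 e0 mf f0 fb.
pose F (k : nat) x := (Num.min (f x) k.+1%:R `^ r)%:E.
have mF k : measurable_fun D (F k).
  by apply: measurable_EFin_powR; apply: measurable_minr => //; exact: measurable_cst.
have F0 k x : D x -> (0 <= F k x)%E by move=> _; rewrite lee_fin powR_ge0.
have ndF x : D x -> {homo (fun k => F k x) : k l / (k <= l)%N >-> (k <= l)%E}.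
  move=> Dx k l kl; rewrite lee_fin powR_mono ?(ltW r0)//.
    by rewrite le_min f0 ler0n.
  by rewrite le_min ge_min lexx/= ge_min ler_nat ltnS kl orbT.
have hl := @cvg_monotone_convergence _ _ _ mu _ mD _ mF F0 ndF.
have El : (\int[mu]_(x in D) limn (F^~ x) = b%:E)%E.
  rewrite -fb; apply: eq_integral => x _; apply: cvg_lim => //.
  apply: cvg_near_cst; exists (Num.bound (f x)) => // k /= kx.
  rewrite /F min_l//; apply: ltW; apply: lt_le_trans (archi_boundP (f0 x)) _.
  by rewrite ler_nat ltnW// ltnS.
rewrite El in hl; apply: contrapT => hk.
have : (b%:E <= (b - e)%:E)%E.
  rewrite -(cvg_lim _ hl)//; apply: lime_le; first by apply/cvg_ex; exists b%:E.
  apply: nearW => k; rewrite leNgt; apply/negP => h; apply: hk; by exists k.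
by rewrite lee_fin; lra.
Qed.

End integral_continuity.

Section smooth_absolute_value.
Context {R : realType} {n : nat}.
Implicit Types (phi : 'rV[R]_n -> R) (c s : R).
Local Notation enorm := (@euclidean_norm R n).

(** For phi x nonzero this is |s| exp(-1/(c|s|)) at s = phi x. It is smooth, within 1/c of |phi|,
    and vanishes wherever phi does, so supports do not grow. *)
Definition smooth_abs c phi (x : 'rV[R]_n) : R :=
  phi x * (flat 0 (c * phi x) - flat 0 (- c * phi x)).

Lemma smooth_smooth_abs c phi : smooth phi -> smooth (smooth_abs c phi).
Proof.
move=> sphi; have sf d := smooth_flat 0 (smoothZ d sphi).
exact: (smoothM sphi (smoothB (sf c) (sf (- c)))).
Qed.

Lemma smooth_abs_ge0 c phi x : 0 < c -> 0 <= smooth_abs c phi x.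
Proof.
move=> c0; rewrite /smooth_abs mulNr; case: (leP 0 (phi x)) => h.
  have ch := mulr_ge0 (ltW c0) h.
  by rewrite (@flat_le0 _ _ (- _)) ?oppr_le0// subr0 mulr_ge0// flat_ge0.
rewrite flat_le0 ?pmulr_rle0 ?(ltW h)// sub0r mulrN -mulNr.
by rewrite mulr_ge0 ?flat_ge0//; lra.
Qed.

Lemma flat0_abs c s : 0 < c -> 0 <= s -> 0 <= s - s * flat 0 (c * s) <= c^-1.
Proof.
move=> c0; rewrite le_eqVlt => /predU1P[<-|s0].
  by rewrite mul0r subr0 lexx invr_ge0 ltW.
rewrite subr_ge0 ler_piMr ?(ltW s0) ?flat0_le1//=.
have cs0 : 0 < c * s by rewrite mulr_gt0.
have := expR_ge1Dx (- (c * s)^-1); rewrite /flat cs0 expr0 divr1 => h.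
have : s * (1 - (c * s)^-1) <= s * expR (- (c * s)^-1) by rewrite ler_pM2l.
have -> : s * (1 - (c * s)^-1) = s - c^-1 by field; rewrite !gt_eqF.
by lra.
Qed.

Lemma smooth_abs_dist c phi x : 0 < c -> `| `|phi x| - smooth_abs c phi x| <= c^-1.
Proof.
move=> c0; suff : 0 <= `|phi x| - smooth_abs c phi x <= c^-1.
  by move=> /andP[h1 h2]; rewrite ger0_norm.
rewrite /smooth_abs mulNr; case: (leP 0 (phi x)) => h.
  have ch := mulr_ge0 (ltW c0) h.
  by rewrite (@flat_le0 _ _ (- _)) ?oppr_le0// subr0 ger0_norm// flat0_abs.
rewrite (flat_le0 _ (_ : c * phi x <= 0)) ?pmulr_rle0 ?(ltW h)// sub0r mulrN.
rewrite ltr0_norm// -mulNr -mulrN; apply: flat0_abs => //; lra.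
Qed.

(** The derivative of s * flat 0 s. For s > 0 it equals (1 + x) exp(-x) with x = 1/s, so the
    smoothed modulus never steepens a gradient. *)
Lemma flat01_le1 s : 0 <= flat 0 s + flat 1 s <= 1.
Proof.
rewrite addr_ge0 ?flat_ge0//=; case: (leP s 0) => s0.
  by rewrite !flat_le0// addr0.
rewrite /flat s0 expr0 expr1 divr1 -{1}[expR _]mulr1 -mulrDr.
rewrite expRN mulrC ler_pdivrMr ?expR_gt0// mul1r; exact: expR_ge1Dx.
Qed.

Lemma grad_smooth_abs c phi x : smooth phi -> grad (smooth_abs c phi) x =
  ((flat 0 (c * phi x) + flat 1 (c * phi x)) -
   (flat 0 (- c * phi x) + flat 1 (- c * phi x))) *: grad phi x.
Proof.
move=> sphi; apply/rowP => i; rewrite !mxE /smooth_abs.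
have s1 := smoothZ c sphi; have s2 := smoothZ (- c) sphi.
have s3 := smooth_flat 0 s1; have s4 := smooth_flat 0 s2.
rewrite (partialM _ sphi (smoothB s3 s4)) (partialB _ s3 s4).
rewrite (partial_flat _ _ s1) (partial_flat _ _ s2) (partialZ _ _ sphi) (partialZ _ _ sphi).
rewrite !mul0r !subr0 (flatS 1 (c * phi x)) (flatS 1 (- c * phi x)).
ring.
Qed.

Lemma enorm_grad_smooth_abs c phi x : smooth phi -> 0 < c ->
  enorm (grad (smooth_abs c phi) x) <= enorm (grad phi x).
Proof.
move=> sphi c0; rewrite grad_smooth_abs// enormZ ler_piMl ?enorm_ge0//.
have := flat01_le1 (c * phi x); have := flat01_le1 (- c * phi x).
by rewrite ler_norml; lra.
Qed.

Lemma test_smooth_abs (Omega : set 'rV[R]_n) c phi :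
  test_function Omega phi -> test_function Omega (smooth_abs c phi).
Proof.
move=> tphi; have [sphi _ hs] := tphi; apply: testP.
- exact: smooth_smooth_abs.
- by apply: bsuppM; exact: test_bsupp tphi.
- apply: subset_trans hs; apply: closureS => x /=.
  by apply: contra_neq => h; rewrite /smooth_abs h mul0r.
Qed.

End smooth_absolute_value.

Section nonnegative_approximation.
Context {R : realType} {n : nat}.
Variable Omega : set 'rV[R]_n.
Implicit Types (u phi w : 'rV[R]_n -> R).
Local Notation mu := (lebesgue_rV R n).
Local Notation enorm := (@euclidean_norm R n).
Hypothesis oO : open Omega.
Let mO : measurable Omega := open_measurable_rV oO.

Lemma smooth_abs_close (p e : R) phi : 0 < p -> 0 < e -> smooth phi -> bsupp phi ->
  exists2 c, 0 < c &
    (\int[mu]_(x in Omega) (`| `|phi x| - smooth_abs c phi x| `^ p)%:E <= e%:E)%E.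
Proof.
move=> p0 e0 sphi [k hk].
have [m m0 mE] : exists2 m : R, 0 <= m & mu (cube k) = m%:E.
  exists (fine (mu (cube k))); first exact: fine_ge0.
  by rewrite fineK// ge0_fin_numE// mu_cube.
pose q := e / (m + 1).
have q0 : 0 < q by rewrite divr_gt0//; lra.
pose c := (q `^ p^-1)^-1.
have c0 : 0 < c by rewrite invr_gt0 powR_gt0.
have cp : c^-1 `^ p = q.
  by rewrite /c invrK -powRrM mulVf ?gt_eqF// powRr1// ltW.
have qm : q * m <= e by rewrite /q mulrAC ler_pdivrMr; [rewrite ler_pM2l//; lra|lra].
clearbody q; exists c => //.
have sw := smooth_smooth_abs c sphi.
clearbody c.
have mh : measurable_fun Omega (fun x => `|phi x| - smooth_abs c phi x).
  apply: measurable_funTS; apply: measurable_funB; last exact: smooth_measurable.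
  by apply: measurableT_comp => //; exact: smooth_measurable.
have mI : measurable_fun Omega (fun x => (\1_(cube k) x : R)%:E).
  by apply/measurable_EFinP; apply: measurable_funTS; apply: measurable_indic; exact: mcube.
apply: (@le_trans _ _ (\int[mu]_(x in Omega) (q%:E * (\1_(cube k) x : R)%:E))%E).
  apply: ge0_le_integral => //.
  - exact: measurable_abs_powR.
  - exact: measurable_funeM.
  - move=> x Ox; rewrite -EFinM lee_fin indicE.
    have [xk|xk] := boolP (x \in cube k).
      rewrite mulr1 -cp; apply: powR_mono => //; first exact: ltW.
      exact: smooth_abs_dist.
    have hx : phi x = 0 by apply: hk => xk'; move/negP: xk; apply; rewrite inE.
    by rewrite /smooth_abs hx mul0r subr0 !normr0 mulr0 powR0// gt_eqF.
rewrite ge0_integralZl//; last by rewrite lee_fin ltW.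
rewrite integral_indic//; last exact: mcube.
apply: (@le_trans _ _ (q%:E * m%:E)%E); last by rewrite -EFinM lee_fin.
rewrite lee_wpmul2l ?lee_fin ?(ltW q0)//.
by rewrite -mE; apply: le_measure; rewrite ?inE;
  [apply: measurableI => //; exact: mcube|exact: mcube|exact: subIsetl].
Qed.

Lemma W01p_approx_dist (p : R) u e : 0 < p -> W01p Omega p u -> 0 < e ->
  exists phi c, [/\ test_function Omega phi, 0 < c,
    (\int[mu]_(x in Omega) (`| `|u x| - smooth_abs c phi x| `^ p)%:E <= e%:E)%E &
    (\int[mu]_(x in Omega) (enorm (weak_gradient Omega u x - grad phi x) `^ p)%:E
      <= e%:E)%E].
Proof.
move=> p0 Wu e0; pose e1 := Num.min e (e / (2 `^ p * 2)).
have q0 : 0 < (2 : R) `^ p * 2 by rewrite mulr_gt0// powR_gt0.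
have e10 : 0 < e1 by rewrite lt_min e0 divr_gt0.
have e1e : 2 `^ p * (e1 + e1) <= e.
  have : e1 <= e / (2 `^ p * 2) by rewrite ge_min lexx orbT.
  by rewrite ler_pdivlMr//; lra.
have e1e' : e1 <= e by rewrite ge_min lexx.
clearbody e1.
have [phi [tphi h1 h2]] := W01p_approx oO p0 Wu e10.
have [sphi _ _] := tphi.
have [c c0 hc] := smooth_abs_close p0 e10 sphi (test_bsupp tphi).
exists phi, c; split => //; last by apply: le_trans (ltW h2) _; rewrite lee_fin.
have sw := smooth_smooth_abs c sphi.
have mu_ := W01p_measurable Wu.
have mphi : measurable_fun Omega phi by apply: measurable_funTS; exact: smooth_measurable.
have mw : measurable_fun Omega (smooth_abs c phi) by apply: measurable_funTS; exact: smooth_measurable.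
have mnu : measurable_fun Omega (fun x => `|u x|) by exact: measurableT_comp.
have mnp : measurable_fun Omega (fun x => `|phi x|) by exact: measurableT_comp.
apply: (@le_trans _ _ ((2 `^ p)%:E * (\int[mu]_(x in Omega) (`|u x - phi x| `^ p)%:E +
    \int[mu]_(x in Omega) (`| `|phi x| - smooth_abs c phi x| `^ p)%:E))%E).
  apply: integral_powRD_le => //; first exact: ltW.
  - by apply: measurableT_comp => //; exact: measurable_funB.
  - by apply: measurableT_comp => //; exact: measurable_funB.
  - by apply: measurableT_comp => //; exact: measurable_funB.
  - move=> x _; have := ler_distD `|phi x| `|u x| (smooth_abs c phi x).
    have := ler_dist_dist (u x) (phi x); lra.
apply: (@le_trans _ _ ((2 `^ p)%:E * (e1%:E + e1%:E))%E).
  apply: lee_wpmul2l; first by rewrite lee_fin powR_ge0.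
  exact: (leeD (ltW h1) hc).
by rewrite -EFinD -EFinM lee_fin.
Qed.

Lemma minr_dist (K s t : R) : `|Num.min s K - Num.min t K| <= `|s - t|.
Proof.
have := ler_norm (s - t); have := ler_norm (t - s); rewrite distrC ler_norml.
by case: (lerP s K) => h1; case: (lerP t K) => h2; lra.
Qed.

Lemma minr_powR_le (p r K s : R) : 0 < p -> p <= r -> 0 < K -> 0 <= s ->
  Num.min s K `^ r <= K `^ (r - p) * s `^ p.
Proof.
move=> p0 pr K0; rewrite le_eqVlt => /predU1P[<-|s0].
  by rewrite min_l ?(ltW K0)// !powR0 ?mulr0 ?gt_eqF//; exact: lt_le_trans pr.
have m0 : 0 < Num.min s K by rewrite lt_min s0.
have -> : Num.min s K `^ r = Num.min s K `^ (r - p) * Num.min s K `^ p.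
  by rewrite -powRD ?subrK// (gt_eqF m0) implybT.
apply: ler_pM; rewrite ?powR_ge0//; apply: powR_mono; rewrite ?subr_ge0 ?(ltW p0) ?(ltW m0)//.
  by rewrite ge_min lexx orbT.
by rewrite ge_min lexx.
Qed.

(** w is the smoothed modulus of a test function close to u. No chain rule for |u| is needed: its
    gradient is compared with that of the test function, which is close to the weak gradient of u
    itself. For the r-th powers a lower bound is enough, and truncation provides it. *)
Lemma W01p_approx_ge0 (p r : R) u (a b G e : R) : 0 < p -> p <= r -> 0 < e ->
  W01p Omega p u ->
  (\int[mu]_(x in Omega) (`|u x| `^ p)%:E = a%:E)%E ->
  (\int[mu]_(x in Omega) (`|u x| `^ r)%:E = b%:E)%E ->
  (\int[mu]_(x in Omega) (enorm (weak_gradient Omega u x) `^ p)%:E = G%:E)%E ->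
  exists w, [/\ test_function Omega w, forall x, 0 <= w x,
    ((a - e)%:E <= mass p w <= (a + e)%:E)%E /\ ((b - e)%:E <= mass r w)%E,
    (dirichlet p w <= (G + e)%:E)%E &
    (\int[mu]_(x in Omega) (`| `|u x| - w x| `^ p)%:E <= e%:E)%E].
Proof.
move=> p0 pr e0 Wu ua ub uG; have r0 := lt_le_trans p0 pr.
have a0 : 0 <= a by rewrite -lee_fin -ua; apply: integral_ge0 => x _; rewrite lee_fin powR_ge0.
have G0 : 0 <= G by rewrite -lee_fin -uG; apply: integral_ge0 => x _; rewrite lee_fin powR_ge0.
have e20 : 0 < e / 2 by lra.
have [c1 c10 hc1] := integral_powR_close mu mO p0 a0 e0.
(* The absolute value only supplies a nonnegative parameter: the lower bound is argued by
   contradiction, in a case where a - e is nonnegative anyway. The same holds for b - e. *)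
have [c2 c20 hc2] := integral_powR_close mu mO p0 (normr_ge0 (a - e)) e20.
have [c3 c30 hc3] := integral_powR_close mu mO p0 G0 e0.
have [c4 c40 hc4] := integral_powR_close mu mO r0 (normr_ge0 (b - e)) e20.
have mu_ := W01p_measurable Wu.
have mnu : measurable_fun Omega (fun x => `|u x|) by exact: measurableT_comp.
have [k hk] := integral_powR_truncation mO r0 e20 mnu (fun x => normr_ge0 _) ub.
pose K : R := k.+1%:R.
have K0 : 0 < K by rewrite ltr0n.
have Kp0 : 0 < K `^ (r - p) by rewrite powR_gt0.
(* In the last term, the r-th power of the truncated distance is at most K^(r - p) times the p-th
   power of the distance. *)
pose d := Num.min (Num.min e c1) (Num.min (Num.min c2 c3) (c4 / K `^ (r - p))).
have d0 : 0 < d by rewrite !lt_min e0 c10 c20 c30 divr_gt0.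
have [de dc1 dc2 dc3 dc4] : [/\ d <= e, d <= c1, d <= c2, d <= c3 & d <= c4 / K `^ (r - p)].
  by split; rewrite /d !ge_min lexx ?orbT.
clearbody d.
have [phi [c [tphi c0 hu hg]]] := W01p_approx_dist p0 Wu d0.
have [sphi _ _] := tphi; have tw := test_smooth_abs c tphi.
have [sw _ _] := tw.
have w0 x := smooth_abs_ge0 phi x c0.
have Gw x := enorm_grad_smooth_abs x sphi c0.
have mM (q : R) : 0 < q -> (mass q (smooth_abs c phi) =
    \int[mu]_(x in Omega) (smooth_abs c phi x `^ q)%:E)%E.
  move=> q0; rewrite -(integral_mass_test q0 tw); apply: eq_integral => x _.
  by rewrite ger0_norm.
move: (smooth_abs c phi) tw sw w0 Gw mM hu => w tw sw w0 Gw mM hu.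
have mw : measurable_fun Omega w by apply: measurable_funTS; exact: smooth_measurable.
have mh : measurable_fun Omega (fun x => `| `|u x| - w x|).
  by apply: measurableT_comp => //; exact: measurable_funB.
exists w; split; [exact: tw|exact: w0| | |by apply: le_trans hu _; rewrite lee_fin].
- split.
    apply/andP; split; rewrite (mM p p0).
      rewrite leNgt; apply/negP => h.
      have ae : 0 <= a - e.
        rewrite -lee_fin; apply: le_trans (ltW h).
        by apply: integral_ge0 => x _; rewrite lee_fin powR_ge0.
      have : (\int[mu]_(x in Omega) (`|u x| `^ p)%:E <= (`|a - e| + e / 2)%:E)%E.
        apply: (hc2 w _ (fun x => `| `|u x| - w x|)) => //.
        - by move=> x _; rewrite distrC.
        - by apply: le_trans hu _; rewrite lee_fin.
        - by apply: ltW; rewrite ger0_norm.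
      by rewrite ua lee_fin ger0_norm//; lra.
    apply: (hc1 (fun x => `|u x|) _ (fun x => `| `|u x| - w x|)) => //.
    - by apply: le_trans hu _; rewrite lee_fin.
    - by rewrite ua.
  rewrite (mM r r0) leNgt; apply/negP => h.
  have be : 0 <= b - e.
    rewrite -lee_fin; apply: le_trans (ltW h).
    by apply: integral_ge0 => x _; rewrite lee_fin powR_ge0.
  have minK (s : R) : 0 <= s -> 0 <= Num.min s K by move=> s0; rewrite le_min s0 ltW.
  have mmin (f : 'rV[R]_n -> R) : measurable_fun Omega f ->
      measurable_fun Omega (fun x => Num.min (f x) K).
    by move=> mf; apply: measurable_minr => //; exact: measurable_cst.
  have : (\int[mu]_(x in Omega) (Num.min `|u x| K `^ r)%:E <= (`|b - e| + e / 2)%:E)%E.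
    apply: (hc4 (fun x => Num.min (w x) K) _ (fun x => Num.min `| `|u x| - w x| K)) => //.
    - exact: mmin.
    - exact: mmin.
    - exact: mmin.
    - by move=> x; exact: minK.
    - by move=> x; exact: minK.
    - by move=> x; exact: minK.
    - move=> x _; rewrite distrC le_min minr_dist/=.
      have := minK _ (normr_ge0 (u x)); have := minK _ (w0 x).
      have : Num.min (w x) K <= K by rewrite ge_min lexx orbT.
      have : Num.min `|u x| K <= K by rewrite ge_min lexx orbT.
      by rewrite ler_norml; lra.
    - apply: (@le_trans _ _ ((K `^ (r - p))%:E * \int[mu]_(x in Omega) (`| `|u x| - w x| `^ p)%:E)%E).
        rewrite -ge0_integralZl//; first last.
        + by rewrite lee_fin powR_ge0.
        + exact: measurable_EFin_powR.
        apply: ge0_le_integral => //.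
        + by move=> x _; rewrite lee_fin powR_ge0.
        + by apply: measurable_EFin_powR; exact: mmin.
        + by apply: measurable_funeM; exact: measurable_EFin_powR.
        + move=> x _; rewrite -EFinM lee_fin.
          by apply: minr_powR_le.
      apply: (@le_trans _ _ ((K `^ (r - p))%:E * d%:E)%E).
        by rewrite lee_wpmul2l// lee_fin powR_ge0.
      by rewrite -EFinM lee_fin mulrC -ler_pdivlMr.
    - rewrite ger0_norm//; apply: le_trans (ltW h).
      apply: ge0_le_integral => //.
      + by move=> x _; rewrite lee_fin powR_ge0.
      + by apply: measurable_EFin_powR; exact: mmin.
      + exact: measurable_EFin_powR.
      + move=> x _; rewrite lee_fin; apply: powR_mono; first exact: ltW.
          by rewrite minK.
        by rewrite ge_min lexx.
  move=> /(lt_le_trans hk); rewrite lte_fin ger0_norm//; lra.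
- apply: (@le_trans _ _ (dirichlet p phi)); first by apply: le_dirichlet => //; exact: ltW.
  have ug := W01p_weak_gradient Wu.
  rewrite -(integral_dirichlet_Omega p0 tphi).
  apply: (hc3 (fun x => enorm (weak_gradient Omega u x)) _
     (fun x => enorm (weak_gradient Omega u x - grad phi x))) => //; try by move=> x; exact: enorm_ge0.
  + exact: is_weak_gradient_measurable ug.
  + by apply: measurable_funTS; exact: measurable_enorm_grad.
  + exact: (is_weak_gradient_measurable
        (is_weak_gradientB oO ug (is_weak_gradient_test tphi))).
  + by move=> x _; exact: enorm_dist.
  + by apply: le_trans hg _; rewrite lee_fin.
  + by rewrite uG.
Qed.

End nonnegative_approximation.

(** * Comparison with filled functions *)

Lemma ge0_le_integral_combination d (T : measurableType d) (R : realType)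
    (mu : {measure set T -> \bar R}) (f1 f2 f3 f4 : T -> R) (c k : R) :
  0 <= c -> 0 <= k ->
  measurable_fun setT (EFin \o f1) -> measurable_fun setT (EFin \o f2) ->
  measurable_fun setT (EFin \o f3) -> measurable_fun setT (EFin \o f4) ->
  (forall x, 0 <= f1 x) -> (forall x, 0 <= f2 x) ->
  (forall x, 0 <= f3 x) -> (forall x, 0 <= f4 x) ->
  (forall x, f1 x + c * f2 x <= f3 x + k * f4 x) ->
  (\int[mu]_x (f1 x)%:E + c%:E * \int[mu]_x (f2 x)%:E <=
   \int[mu]_x (f3 x)%:E + k%:E * \int[mu]_x (f4 x)%:E)%E.
Proof.
move=> c0 k0 m1 m2 m3 m4 f10 f20 f30 f40 h.
have E0 (f : T -> R) : (forall x, 0 <= f x) -> forall x, setT x -> (0 <= (f x)%:E)%E.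
  by move=> f0 x _; rewrite lee_fin.
have mc2 := measurable_funeM c%:E m2; have mk4 := measurable_funeM k%:E m4.
have c20 x : setT x -> (0 <= c%:E * (f2 x)%:E)%E by move=> _; rewrite mule_ge0 ?lee_fin.
have k40 x : setT x -> (0 <= k%:E * (f4 x)%:E)%E by move=> _; rewrite mule_ge0 ?lee_fin.
rewrite -(ge0_integralZl mu measurableT m2 (E0 _ f20)) ?lee_fin//.
rewrite -(ge0_integralZl mu measurableT m4 (E0 _ f40)) ?lee_fin//.
rewrite -(ge0_integralD mu measurableT (E0 _ f10) m1 c20 mc2).
rewrite -(ge0_integralD mu measurableT (E0 _ f30) m3 k40 mk4).
apply: (ge0_le_integral mu measurableT).
- by move=> x Tx; apply: adde_ge0; [exact: E0|exact: c20].
- exact: emeasurable_funD.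
- exact: emeasurable_funD.
- by move=> x _; rewrite -!EFinM -!EFinD lee_fin.
Qed.

Lemma convex_gain (R : realType) (L X Y t k : R) : 0 <= X -> 0 <= Y -> t <= 1 -> k <= t ->
  L <= (1 - t) * X + t * Y -> L + k * X <= X + Y.
Proof.
move=> X0 Y0 t1 kt hL; have h1 : k * X <= t * X by rewrite ler_wpM2r.
have h2 : t * Y <= Y by rewrite ler_piMl.
lra.
Qed.

Section filling.
Context {R : realType} {n : nat}.
Implicit Types (w eta : 'rV[R]_n -> R) (e p s : R).
Local Notation mu := (lebesgue_rV R n).
Local Notation enorm := (@euclidean_norm R n).

(** With x = 1/s this is x^2 <= exp x, the square of x <= exp(x/2). Because [flat 2] is the slope of
    [flat 0], the factor t in [grad_fill] is a convex weight. *)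
Lemma flat2_le1 s : flat 2 s <= 1.
Proof.
rewrite /flat; case: ltP => // s0.
have x0 : 0 < s^-1 by rewrite invr_gt0.
rewrite -exprVn; move: (s^-1) x0 => x x0.
rewrite expRN mulrC ler_pdivrMr ?expR_gt0// mul1r.
have h : x <= expR (x / 2).
  have -> : x / 2 = 1 + (x / 2 - 1) by ring.
  have h1 := expR_ge1Dx (x / 2 - 1); have h2 := @expR_ge1Dx R 1.
  rewrite expRD; apply: (@le_trans _ _ (2 * (x / 2))); first by lra.
  case: (leP 0 (x / 2)) => x2; last by lra.
  by apply: ler_pM => //; lra.
rewrite (_ : expR x = expR (x / 2) ^+ 2); last by rewrite -expRM_natl; congr expR; field.
by rewrite lerXn2r// nnegrE ?(ltW x0)// expR_ge0.
Qed.

Lemma flat2_ge s (b : R) : 1 <= s <= b -> expR (- 1) / b ^+ 2 <= flat 2 s.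
Proof.
move=> /andP[s1 sb]; have s0 : 0 < s by lra.
have b0 : 0 < b by lra.
rewrite /flat s0; apply: ler_pM; rewrite ?expR_ge0 ?invr_ge0 ?exprn_ge0 ?(ltW b0)//.
  by rewrite ler_expR lerN2 invf_le1.
by rewrite lef_pV2 ?posrE ?exprn_gt0// lerXn2r// nnegrE ltW.
Qed.

(* A smooth substitute for [max w (e * eta)], up to a constant factor on [eta]. *)
Definition fill e eta w (x : 'rV[R]_n) : R := w x + e * flat 0 (eta x - e^-1 * w x).

Lemma smooth_fill e eta w : smooth eta -> smooth w -> smooth (fill e eta w).
Proof.
move=> seta sw; apply: (smoothD sw (smoothZ _ (smooth_flat _ _))).
exact: (smoothB seta (smoothZ _ sw)).
Qed.

Lemma bsupp_fill e eta w : bsupp eta -> bsupp w -> bsupp (fill e eta w).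
Proof.
move=> [k hk] [l hl]; exists (maxn k l) => x xkl.
rewrite /fill (bsuppW hk (leq_maxl k l) xkl) (bsuppW hl (leq_maxr k l) xkl).
by rewrite mulr0 subr0 flat_le0// mulr0 addr0.
Qed.

Lemma fill_ge e eta w x : 0 < e -> w x <= fill e eta w x.
Proof. by move=> e0; rewrite lerDl mulr_ge0 ?flat_ge0// ltW. Qed.

Lemma fill_le e eta w x : 0 < e -> 0 <= w x -> 0 <= eta x ->
  fill e eta w x <= Num.max (w x) (e * eta x).
Proof.
move=> e0 w0 eta0; rewrite /fill.
case: (leP (eta x - e^-1 * w x) 0) => h.
  by rewrite flat_le0// mulr0 addr0 le_max lexx.
have := flat_bound 0 (eta x - e^-1 * w x); rewrite (_ : 1`!%:R = 1 :> R)// mul1r gtr0_norm// => h1.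
have : e * flat 0 (eta x - e^-1 * w x) <= e * (eta x - e^-1 * w x) by rewrite ler_pM2l.
rewrite mulrBr mulrA divff ?gt_eqF// mul1r => h2.
by rewrite le_max; apply/orP; right; lra.
Qed.

Lemma grad_fill e eta w x : 0 < e -> smooth eta -> smooth w ->
  let t := flat 2 (eta x - e^-1 * w x) in
  grad (fill e eta w) x = (1 - t) *: grad w x + (t * e) *: grad eta x.
Proof.
move=> e0 seta sw t; apply/rowP => i; rewrite !mxE /fill.
have s1 := smoothZ e^-1 sw; have s2 := smoothB seta s1.
have s3 := smooth_flat 0 s2.
rewrite (partialD _ sw (smoothZ e s3)) (partialZ _ _ s3) (partial_flat _ _ s2).
rewrite (partialB _ seta s1) (partialZ _ _ sw) mul0r subr0 -/t.
by field; rewrite gt_eqF.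
Qed.

Lemma fill_mass_le p e eta w : 0 < p -> 0 < e -> smooth eta -> smooth w ->
  (forall x, 0 <= eta x) -> (forall x, 0 <= w x) ->
  (mass p (fill e eta w) <= mass p w + (e `^ p)%:E * mass p eta)%E.
Proof.
move=> p0 e0 seta sw eta0 w0.
have mw := smooth_measurable sw; have meta := smooth_measurable seta.
have mv := smooth_measurable (smooth_fill e seta sw).
rewrite /mass -ge0_integralZl//; first last.
- by rewrite lee_fin powR_ge0.
- exact: measurable_abs_powR.
rewrite -ge0_integralD//; first last.
- by apply: measurable_funeM; exact: measurable_abs_powR.
- by move=> x _; rewrite mule_ge0// lee_fin powR_ge0.
- exact: measurable_abs_powR.
apply: ge0_le_integral.
- exact: measurableT.
- by move=> x _; rewrite lee_fin powR_ge0.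
- exact: measurable_abs_powR.
- apply: emeasurable_funD; first exact: measurable_abs_powR.
  by apply: measurable_funeM; exact: measurable_abs_powR.
- move=> x _; rewrite -EFinM -EFinD lee_fin.
  have v0 := le_trans (w0 x) (fill_ge eta w x e0).
  rewrite !ger0_norm// -powRM// ?(ltW e0)//.
  apply: le_trans (powR_mono (ltW p0) v0 (fill_le e0 (w0 x) (eta0 x))) _.
  by case: (leP (w x) (e * eta x)) => _; rewrite ?lerDl ?lerDr powR_ge0.
Qed.

(** The gradient of the filled function is the convex combination of grad w and e grad eta with
    weights 1 - t and t, and s^p is convex. Where eta >= 2 and w < e the argument of [flat 2] lies
    in [1, b], hence t >= exp(-1) / b^2: this is the proportion of |grad w|^p that is saved. *)
Lemma fill_dirichlet p e eta w Q (b : R) : 1 <= p -> 0 < e -> smooth eta -> smooth w ->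
  (forall x, 0 <= w x) -> (forall x, Q x -> 2 <= eta x) -> (forall x, eta x <= b) ->
  measurable Q ->
  (dirichlet p (fill e eta w) + (expR (- 1) / b ^+ 2)%:E *
     \int[mu]_(x in Q `&` [set x | (w x < e)%R]) (enorm (grad w x) `^ p)%:E
   <= dirichlet p w + (e `^ p)%:E * dirichlet p eta)%E.
Proof.
move=> p1 e0 seta sw w0 etaQ etab mQ; have p0 : 0 <= p by lra.
set A := Q `&` _; set c := expR (-1) / b ^+ 2.
have mw := smooth_measurable sw.
have mA : measurable A.
  apply: measurableI => //; have := mw measurableT _ (measurable_itv `]-oo, e[).
  by rewrite setTI set_itvNyo.
have sv := smooth_fill e seta sw.
have c0 : 0 <= c by rewrite divr_ge0 ?expR_ge0 ?sqr_ge0.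
rewrite [X in (_ * X)%E]integral_mkcond.
have hA x : (((fun x => (enorm (grad w x) `^ p)%:E) \_ A) x =
    (enorm (grad w x) `^ p * \1_A x)%:E)%E.
  by rewrite patchE indicE; case: ifP => _; rewrite ?mulr1 ?mulr0.
rewrite (eq_integral _ _ (fun x _ => hA x)).
have mI : measurable_fun setT (fun x => (enorm (grad w x) `^ p * \1_A x)%:E).
  apply/measurable_EFinP; apply: measurable_funM; last exact: measurable_indic.
  by apply/measurable_EFinP; exact: measurable_grad_powR.
have mw' := measurable_grad_powR p sw.
have mv' := measurable_grad_powR p sv.
have me' := measurable_grad_powR p seta.
have ek0 : 0 <= e `^ p by rewrite powR_ge0.
apply: (@ge0_le_integral_combination _ _ _ mu (fun x => enorm (grad (fill e eta w) x) `^ p)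
  (fun x => enorm (grad w x) `^ p * \1_A x) (fun x => enorm (grad w x) `^ p)
  (fun x => enorm (grad eta x) `^ p) _ _ c0 ek0 mv' mI mw' me').
- by move=> x; rewrite powR_ge0.
- by move=> x; rewrite mulr_ge0// powR_ge0.
- by move=> x; rewrite powR_ge0.
- by move=> x; rewrite powR_ge0.
move=> x; rewrite (grad_fill x e0 seta sw).
set t := flat 2 _.
have t0 : 0 <= t by exact: flat_ge0.
have t1 : t <= 1 by exact: flat2_le1.
have tA : c * \1_A x <= t.
  rewrite indicE; have [/set_mem[Qx /= wx]|_] := boolP (x \in A); last by rewrite mulr0.
  rewrite mulr1; apply: flat2_ge.
  have : e^-1 * w x <= 1 by rewrite mulrC ler_pdivrMr// mul1r ltW.
  have : 0 <= e^-1 * w x by rewrite mulr_ge0 ?w0// invr_ge0 ltW.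
  by have := etaQ x Qx; have := etab x; lra.
have h : enorm ((1 - t) *: grad w x + (t * e) *: grad eta x) `^ p <=
    (1 - t) * enorm (grad w x) `^ p + t * (e * enorm (grad eta x)) `^ p.
  apply: le_trans (powR_convex p1 _ (enorm_ge0 _) _); last 2 first.
  - by rewrite t0.
  - by rewrite mulr_ge0 ?enorm_ge0 ?(ltW e0).
  apply: powR_mono => //; first exact: enorm_ge0.
  apply: le_trans (enorm_triangle _ _) _; rewrite !enormZ !ger0_norm ?subr_ge0//.
    by rewrite mulrA.
  by rewrite mulr_ge0// ltW.
rewrite powRM ?enorm_ge0 ?(ltW e0)// in h.
rewrite (mulrC _ (\1_A x)) (mulrA c); apply: convex_gain t1 tA h; first exact: powR_ge0.
by rewrite mulr_ge0// powR_ge0.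
Qed.

End filling.

(** * Consequences of minimality at order eps^p *)

Section minimizer_gain.
Context {R : realType}.

Lemma powR_ge_1B (q l k : R) : 0 <= q -> 0 < l -> 0 <= k -> 1 <= l * (1 + k) ->
  1 - (Num.bound q)%:R * k <= l `^ q.
Proof.
move=> q0 l0 k0 hl; have B0 : 0 <= (Num.bound q)%:R :> R by rewrite ler0n.
case: (leP l 1) => l1.
  have h : 1 - k <= l by nra.
  have l01 : 0 < l <= 1 by rewrite l0.
  apply: le_trans (powR_bernoulli q0 l01).
  have : (Num.bound q)%:R * (1 - l) <= (Num.bound q)%:R * k by rewrite ler_wpM2l//; lra.
  lra.
apply: (@le_trans _ _ 1); first by rewrite gerBl mulr_ge0.
by rewrite -(powRr0 l) ler_powR// ltW.
Qed.

(* [d] is eps^p; [m], [D], [M] are the mass, Dirichlet integral and r-th power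
   integral of the filled function, [H] and [K] the mass and Dirichlet integral of
   the plateau, and [a / m] rescales the filled function to mass [a]. *)
Lemma minimizer_gain (p r a b G e d m D M H K I c : R) : 0 < p -> p <= r -> 0 < a ->
  0 <= b -> 0 <= G -> 0 < d -> d <= 1 -> 0 < e -> e <= d -> e <= a / 2 -> 0 <= H -> 0 <= K ->
  0 <= D -> 0 <= M -> 0 <= I -> 0 < c ->
  a - e <= m -> m <= a + e + d * H -> b - e <= M -> D + c * I <= G + e + d * K ->
  G / p - b / r <= (a / m) * D / p - (a / m) `^ (r / p) * M / r ->
  c * I <= d * (1 + K + 2 / a * (G + 1 + K) +
     (1 + (Num.bound (r / p))%:R * ((1 + H) / a) * b)).
Proof.
move=> p0 pr a0 b0 G0 d0 d1 e0 ed ea H0 K0 D0 M0 I0 c0 m1 m2 M1 D1.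
have r0 : 0 < r by lra.
have m0 : 0 < m by lra.
have l0 : 0 < a / m by rewrite divr_gt0.
set l := a / m; set B : R := (Num.bound (r / p))%:R; rewrite -/l in l0.
have B0 : 0 <= B by rewrite ler0n.
have lm : l * m = a by rewrite divfK// gt_eqF.
(* Chosen so that m <= a + e + d H <= a (1 + k), hence l >= 1 / (1 + k) for the rescaling factor l =
   a / m. *)
pose k := d * ((1 + H) / a).
have k0 : 0 <= k by rewrite mulr_ge0 ?divr_ge0//; lra.
have ka : a * (1 + k) = a + d * (1 + H) by rewrite /k; field; lra.
have rp : 0 <= r / p by rewrite divr_ge0 ?ltW.
have hl : 1 <= l * (1 + k).
  have : a <= l * (a * (1 + k)) by rewrite ka -lm; rewrite ler_pM2l//; lra.
  by rewrite mulrCA -{1}(mulr1 a) ler_pM2l.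
have hq := powR_ge_1B rp l0 k0 hl; rewrite -/B in hq.
have h5 : B * k * b = d * (B * ((1 + H) / a) * b) by rewrite /k; ring.
clearbody k B.
have q0 : 0 <= l `^ (r / p) by rewrite powR_ge0.
move: (l `^ (r / p)) hq q0 => q hq q0 hmin.
have hM : b - e - B * k * b <= q * M.
  case: (leP 0 (b - e)) => be; last first.
    have : 0 <= q * M by rewrite mulr_ge0.
    have : 0 <= B * k * b by rewrite !mulr_ge0.
    lra.
  apply: (@le_trans _ _ (q * (b - e))); last by rewrite ler_wpM2l.
  have : (1 - B * k) * (b - e) <= q * (b - e) by rewrite ler_wpM2r.
  have : 0 <= B * k * e by rewrite !mulr_ge0 ?(ltW e0).
  lra.
(* From m >= a - e and e <= a / 2 one gets l <= 1 / (1 - e/a) <= 1 + 2 e / a. *)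
have lD : l * D <= D + 2 * (e / a) * D.
  rewrite -{2}(mul1r D) -mulrDl ler_wpM2r//.
  have ea0 : 0 <= e / a by rewrite divr_ge0 ?ltW.
  have eaE : e = e / a * a by rewrite divfK// gt_eqF.
  have ea2 : e / a <= 1 / 2 by rewrite ler_pdivrMr//; lra.
  have : l * (a - e) <= a by rewrite -{2}lm ler_pM2l.
  rewrite {1}eaE; move: (e / a) ea0 ea2 => s s0 s2.
  rewrite (_ : l * (a - s * a) = (l * (1 - s)) * a); last by ring.
  rewrite -{2}(mul1r a) ler_pM2r// => h.
  have s1 : 0 < 1 - s by lra.
  rewrite -(ler_pM2r s1); apply: le_trans h _.
  nra.
(* Minimality times p: the loss in the r-th power term carries the factor p / r, which is at most
   1. *)
have G1 : G <= l * D + (e + B * k * b).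
  have h1 : G / p * p <= (l * D / p - q * M / r + b / r) * p by rewrite ler_pM2r//; lra.
  have E1 : G / p * p = G by rewrite divfK// gt_eqF.
  have E2 : (l * D / p - q * M / r + b / r) * p = l * D + (p / r) * (b - q * M).
    by field; lra.
  rewrite E1 E2 in h1.
  have pr0 : 0 <= p / r by rewrite divr_ge0 ?ltW.
  have pr1 : p / r <= 1 by rewrite ler_pdivrMr// mul1r.
  have x0 : 0 <= e + B * k * b by rewrite addr_ge0 ?(ltW e0)// !mulr_ge0.
  have h2 : p / r * (b - q * M) <= p / r * (e + B * k * b) by rewrite ler_wpM2l//; lra.
  have h3 : p / r * (e + B * k * b) <= e + B * k * b by rewrite ler_piMl.
  lra.
have cI : 0 <= c * I by rewrite mulr_ge0 ?(ltW c0).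
have DG : D <= G + 1 + K.
  have : d * K <= K by rewrite ler_piMl.
  lra.
have h4 : 2 * (e / a) * D <= d * (2 / a * (G + 1 + K)).
  rewrite (_ : 2 * (e / a) * D = e * (2 / a * D)); last by field; lra.
  apply: ler_pM => //; first exact: ltW.
    by rewrite mulr_ge0// divr_ge0 ?ltW.
  by rewrite ler_wpM2l// divr_ge0 ?ltW.
rewrite h5 in G1.
lra.
Qed.

End minimizer_gain.

Section comparison.
Context {R : realType} {n : nat}.
Variable Omega : set 'rV[R]_n.
Implicit Types (v w : 'rV[R]_n -> R).
Local Notation mu := (lebesgue_rV R n).
Local Notation enorm := (@euclidean_norm R n).
Hypotheses (oO : open Omega) (bO : bounded_set (~` Omega)) (n0 : (0 < n)%N).

Lemma test_translate v : smooth v -> bsupp v ->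
  exists y, test_function Omega (fun x => v (x + y)).
Proof.
move=> sv [k hk]; have [l _ hl] := bounded_boxP bO.
pose i : 'I_n := Ordinal n0.
(* The translated support lies beyond the cube [l] containing the complement of the domain; the
   extra 1 absorbs the passage from the support to its closure. *)
pose y : 'rV[R]_n := (k%:R + l%:R + 1) *: delta_mx ord0 i.
exists y; apply: testP.
- exact: smooth_shift.
- by apply: bsupp_shift; exists k.
- move=> z hz; apply: contrapT => /hl/(_ i) zl.
  have [|x [/= vx /(ballrVP _ _ ltr01)/(_ i) xz]] := hz (ball z 1).
    by apply: nbhsx_ballx; exact: ltr01.
  have xk : cube k (x + y).
    by apply: contrapT => /hk vxy; rewrite vxy eqxx in vx.
  have /cubeP/(_ i) := xk; rewrite !mxE !eqxx mulr1 => h.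
  move: zl h xz; rewrite !ltr_norml; lra.
Qed.

Lemma min_energy_le (p r a m D M : R) v : 0 < p -> p <= r -> 0 < a -> 0 < m ->
  smooth v -> bsupp v -> mass p v = m%:E -> dirichlet p v = D%:E -> mass r v = M%:E ->
  (min_energy Omega p r a <= ((a / m) * D / p - (a / m) `^ (r / p) * M / r)%:E)%E.
Proof.
move=> p0 pr a0 m0 sv bv vm vD vM; have r0 := lt_le_trans p0 pr.
have [y ty] := test_translate sv bv; have [sy _ hy] := ty.
have l0 : 0 < a / m by rewrite divr_gt0.
(* Normalises the mass to a; p-th powers scale by a / m and r-th powers by its power r / p. *)
pose c := (a / m) `^ p^-1.
have c0 : 0 <= c by rewrite powR_ge0.
have cp : c `^ p = a / m by rewrite /c -powRrM mulVf ?gt_eqF// powRr1// ltW.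
have cr : c `^ r = (a / m) `^ (r / p) by rewrite /c -powRrM (mulrC p^-1).
have mv := smooth_measurable sv; have mvy := smooth_measurable sy.
have tz : test_function Omega (fun x => c * v (x + y)).
  apply: testP.
  - exact: (smoothZ c sy).
  - by apply: bsuppMr; exact: bsupp_shift.
  - apply: subset_trans hy; apply: closureS => x /=.
    by apply: contra_neq => h; rewrite h mulr0.
have Em q : mass q (fun x => c * v (x + y)) = ((c `^ q)%:E * mass q v)%E.
  by rewrite (massZ q c0 mvy) mass_shift.
apply: ereal_inf_lbound; exists (fun x => c * v (x + y)).
  split; first exact: W01p_test.
  rewrite (integral_mass_test p0 tz) Em cp vm -EFinM; congr (_%:E).
  by rewrite divfK// gt_eqF.
rewrite (energy_test oO p0 r0 tz) Em (dirichletZ p c0 sy) (dirichlet_shift p y sv) vD vM.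
by rewrite cp cr -!EFinM -EFinB; congr (_%:E); ring.
Qed.

Lemma exists_plateau (k : nat) : exists (eta : 'rV[R]_n -> R) (b : R),
  [/\ smooth eta, bsupp eta, forall x, 0 <= eta x <= b, forall x, cube k x -> 2 <= eta x
    & 0 < b].
Proof.
(* A lower bound for the bump on the smaller cube: with a margin of 1 on each side, each of its 2n
   factors is at least exp(-1) there. *)
pose q : R := expR (- 2) ^+ n.
have q0 : 0 < q by rewrite exprn_gt0// expR_gt0.
pose K : R := k.+1%:R.
exists (fun x => 2 / q * bump (fun=> - K) (fun=> K) 0 x), (2 / q).
have hq : 0 < 2 / q by rewrite divr_gt0.
split => //.
- by apply: smoothZ; exact: smooth_bump.
- by apply: bsuppMr; exact: bsupp_bump.
- by move=> x; rewrite mulr_ge0 ?bump_ge0 ?(ltW hq)//= ler_piMr ?(ltW hq)// bump_le1.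
- move=> x /cubeP xk.
  have E0 (s : R) : 1 <= s -> expR (- 1) <= flat 0 s.
    move=> s1; have s0 : 0 < s by lra.
    by rewrite /flat s0 expr0 divr1 ler_expR lerN2 invf_le1.
  suff h : q <= bump (fun=> - K) (fun=> K) 0 x.
    rewrite -{1}(mulfVK (lt0r_neq0 q0) 2); apply: ler_wpM2l h; exact: ltW.
  have -> : q = \prod_(i < n) (expR (- 1) * expR (- 1)).
    rewrite prodr_const card_ord -expRD; congr (expR _ ^+ _); ring.
  apply: ler_prod => i _; rewrite mulr_ge0 ?expR_ge0//= mul1r mul1r.
  have := xk i; rewrite ltr_norml => /andP[h1 h2].
  have KE : K = k%:R + 1 by rewrite /K -natr1.
  by apply: ler_pM; rewrite ?expR_ge0// E0//; lra.
Qed.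

(** All losses have order e^p: the Dirichlet integral of the plateau, the mass it adds, and the
    approximation error d <= e^p. The r-th power integral does not decrease, as the filled function
    lies above w >= 0. Hence C can be fixed before e, d and w. *)
Lemma minimizer_small_gradient (p r a b G : R) (k : nat) :
  1 <= p -> p <= r -> 0 < a -> 0 <= b -> 0 <= G ->
  min_energy Omega p r a = (G / p - b / r)%:E ->
  exists2 C : R, 0 <= C & forall (e d : R) w, 0 < e -> e <= 1 ->
    0 < d -> d <= e `^ p -> d <= a / 2 ->
    test_function Omega w -> (forall x, 0 <= w x) ->
    ((a - d)%:E <= mass p w <= (a + d)%:E)%E -> ((b - d)%:E <= mass r w)%E ->
    (dirichlet p w <= (G + d)%:E)%E ->
    (\int[mu]_(x in cube k `&` [set x | (w x < e)%R]) (enorm (grad w x) `^ p)%:E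
      <= (C * e `^ p)%:E)%E.
Proof.
move=> p1 pr a0 b0 G0 hmin; have p0 : 0 < p by lra.
have r0 := lt_le_trans p0 pr.
have [eta [B [seta beta eta0b eta2 B0]]] := exists_plateau k.
have eta0 x : 0 <= eta x by have /andP[] := eta0b x.
have etab x : eta x <= B by have /andP[] := eta0b x.
have [H HE] : exists H, mass p eta = H%:E.
  by exists (fine (mass p eta)); rewrite fineK// mass_fin//; exact: smooth_continuous.
have [K KE] : exists K, dirichlet p eta = K%:E.
  by exists (fine (dirichlet p eta)); rewrite fineK// dirichlet_fin.
have H0 : 0 <= H by rewrite -lee_fin -HE mass_ge0.
have K0 : 0 <= K by rewrite -lee_fin -KE dirichlet_ge0.
pose c := expR (- 1) / B ^+ 2.
have c0 : 0 < c by rewrite divr_gt0 ?expR_gt0// exprn_gt0.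
pose C := 1 + K + 2 / a * (G + 1 + K) + (1 + (Num.bound (r / p))%:R * ((1 + H) / a) * b).
have C0 : 0 <= C.
  by rewrite /C !addr_ge0// ?mulr_ge0 ?invr_ge0 ?addr_ge0 ?(ltW a0).
exists (C / c); first by rewrite divr_ge0 ?(ltW c0).
move=> e d w e0 e1 d0 de da tw w0 /andP[m1 m2] M1 D1.
have [sw _ _] := tw; have bw := test_bsupp tw.
have sv := smooth_fill e seta sw; have bv := bsupp_fill e beta bw.
have h1 := fill_dirichlet p1 e0 seta sw w0 eta2 etab (mcube k).
have h2 := fill_mass_le p0 e0 seta sw eta0 w0.
have mw := smooth_measurable sw; have mv := smooth_measurable sv.
have h3 (q : R) : 0 < q -> (mass q w <= mass q (fill e eta w))%E.
  move=> q0; apply: le_mass => //; first exact: ltW.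
  move=> x; have := fill_ge eta w x e0; have := w0 x => wx vx.
  by rewrite !ger0_norm// (le_trans wx).
have [m mE] : exists m, mass p (fill e eta w) = m%:E.
  by exists (fine (mass p (fill e eta w))); rewrite fineK// mass_fin//; exact: smooth_continuous.
have [M ME] : exists M, mass r (fill e eta w) = M%:E.
  by exists (fine (mass r (fill e eta w))); rewrite fineK// mass_fin//; exact: smooth_continuous.
have [D DE] : exists D, dirichlet p (fill e eta w) = D%:E.
  by exists (fine (dirichlet p (fill e eta w))); rewrite fineK// dirichlet_fin.
have M0 : 0 <= M by rewrite -lee_fin -ME mass_ge0.
have D0 : 0 <= D by rewrite -lee_fin -DE dirichlet_ge0.
have h3p := h3 p p0; have h3r := h3 r r0.
rewrite mE in h2 h3p; rewrite ME in h3r; rewrite DE -/c KE in h1; rewrite HE in h2.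
have am : a - d <= m by rewrite -lee_fin; exact: le_trans h3p.
have m0 : 0 < m by lra.
have := min_energy_le p0 pr a0 m0 sv bv mE DE ME.
rewrite hmin lee_fin => hG.
set I := (\int[mu]_(x in _) _)%E; rewrite -/I in h1.
have I0 : (0 <= I)%E by apply: integral_ge0 => x _; rewrite lee_fin powR_ge0.
clearbody I.
have {}h1 : (D%:E + c%:E * I <= (G + d + e `^ p * K)%:E)%E.
  by apply: le_trans h1 _; rewrite EFinD [in leRHS]EFinM leeD2r.
have {}h2 : m <= a + d + e `^ p * H.
  by rewrite -lee_fin; apply: le_trans h2 _; rewrite EFinD [in leRHS]EFinM leeD2r.
have e1p : e `^ p <= 1 by have := powR_mono (ltW p0) (ltW e0) e1; rewrite powR1.
have bM : b - d <= M by rewrite -lee_fin; exact: le_trans h3r.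
case: I I0 h1 => [I| |] I0 h1; last by [].
- rewrite -EFinM -EFinD lee_fin in h1; rewrite !lee_fin in I0 *.
  have := minimizer_gain p0 pr a0 b0 G0 (powR_gt0 p e0) e1p d0 de da H0 K0 D0 M0 I0 c0 am h2 bM h1 hG.
  rewrite -/C => h; have -> : C / c * e `^ p = e `^ p * C / c by ring.
  by rewrite ler_pdivlMr// mulrC.
- by move: h1; rewrite gt0_muley ?lte_fin// addey.
Qed.

End comparison.

(** * The level set estimate *)

Section smooth_step.
Context {R : realType}.
Implicit Types (s c d : R).

(* [flat 0 (1 / 2) = expR (- 2)], so the step climbs exactly on [1/2, 1]. *)
Definition step s : R := flat 0 (expR (- 2) - flat 0 (1 - s)).
(** The derivative of [step]: both occurrences of [flat 0] differentiate to [flat 2], and the two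
    signs cancel. *)
Definition dstep s : R := flat 2 (expR (- 2) - flat 0 (1 - s)) * flat 2 (1 - s).

Lemma flat0_lt_half s : (flat 0 s < expR (- 2)) = (s < 1 / 2).
Proof.
rewrite /flat; case: (ltP 0 s) => s0; last first.
  by rewrite expR_gt0; symmetry; apply/idP; lra.
rewrite expr0 divr1 ltr_expR ltrN2 (_ : 1 / 2 = (2 : R)^-1); last by rewrite mul1r.
by rewrite -{2}(invrK s) ltf_pV2// posrE// invr_gt0.
Qed.

Lemma step_le0 s : s <= 1 / 2 -> step s = 0.
Proof. by move=> s2; apply: flat_le0; rewrite subr_le0 leNgt flat0_lt_half; lra. Qed.

(** The step is not normalised to height 1; this height is divided out in [level_set_estimate]. *)
Lemma step_ge1 s : 1 <= s -> step s = flat 0 (expR (- 2)).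
Proof. by move=> s1; rewrite /step (@flat_le0 _ _ (1 - s)) ?subr0//; lra. Qed.

Lemma step_ge0 s : 0 <= step s. Proof. exact: flat_ge0. Qed.

Lemma dstep_ge0 s : 0 <= dstep s. Proof. by rewrite mulr_ge0 ?flat_ge0. Qed.

Lemma dstep_le1 s : dstep s <= 1.
Proof. by rewrite mulr_ile1 ?flat_ge0 ?flat2_le1. Qed.

Lemma dstep_gt0 s : 1 / 2 < s -> s < 1 -> 0 < dstep s.
Proof.
move=> s1 s2; apply: mulr_gt0; apply: flat_gt0; last by lra.
by rewrite subr_gt0 flat0_lt_half; lra.
Qed.

Lemma dstep_out s : (s <= 1 / 2) || (1 <= s) -> dstep s = 0.
Proof.
move=> /orP[h|h]; rewrite /dstep; last by rewrite (@flat_le0 _ 2 (1 - s)) ?mulr0//; lra.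
by rewrite flat_le0 ?mul0r// subr_le0 leNgt flat0_lt_half; lra.
Qed.

Context {n : nat}.
Implicit Type f : 'rV[R]_n -> R.

Lemma smooth_step f : smooth f -> smooth (fun x => step (f x)).
Proof.
move=> sf; have s1 := smoothB (smooth_cst (1 : R)) sf.
exact: (smooth_flat 0 (smoothB (smooth_cst (expR (- 2))) (smooth_flat 0 s1))).
Qed.

Lemma smooth_dstep f : smooth f -> smooth (fun x => dstep (f x)).
Proof.
move=> sf; have s1 := smoothB (smooth_cst (1 : R)) sf.
exact: (smoothM (smooth_flat 2 (smoothB (smooth_cst (expR (- 2))) (smooth_flat 0 s1)))
  (smooth_flat 2 s1)).
Qed.

Lemma partial_cst i (c : R) : partial i (fun _ : 'rV[R]_n => c) = fun _ => 0.
Proof. by apply: partial_eq => x; exact: is_derive_cst. Qed.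

Lemma partial_coord i : partial i (fun x : 'rV[R]_n => x ord0 i) = fun _ => 1.
Proof.
apply: partial_eq => x; apply/is_derive_lineP.
rewrite (_ : (fun t : R => _) = (fun t : R => 1 * t + x ord0 i)).
  exact: is_derive_affine.
by apply/funext => t; rewrite !mxE !eqxx/= mulr1 mul1r.
Qed.

Lemma partial_step f i : smooth f ->
  partial i (fun x => step (f x)) = fun x => dstep (f x) * partial i f x.
Proof.
move=> sf; have s1 := smoothB (smooth_cst (1 : R)) sf.
have s2 := smoothB (smooth_cst (expR (- 2))) (smooth_flat 0 s1).
rewrite /step (partial_flat _ _ s2) (partialB _ (smooth_cst _) (smooth_flat 0 s1)).
rewrite (partial_flat _ _ s1) (partialB _ (smooth_cst _) sf) !partial_cst.
by apply/funext => x; rewrite /dstep; ring.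
Qed.

End smooth_step.

(** * Writing a positive function on the cube as one living in a box plus a divergence *)

Section transport.
Context {R : realType} {n : nat}.
Implicit Types (i j : 'I_n) (t : R).

(** The affine map sends [c, d] onto [1/2, 1], where [step] climbs. The total height does not depend
    on c and d, so all the derivatives [dramp] have the same integral and differences of ramps
    vanish at both ends. *)
Definition ramp (c d t : R) := step (1 / 2 + (d - c)^-1 / 2 * (t - c)).
Definition dramp (c d t : R) := dstep (1 / 2 + (d - c)^-1 / 2 * (t - c)) * ((d - c)^-1 / 2).

Lemma ramp_le (c d t : R) : c < d -> t <= c -> ramp c d t = 0.
Proof.
move=> cd tc; apply: step_le0; rewrite gerDl pmulr_rle0 ?subr_le0//.
by rewrite divr_gt0// invr_gt0 subr_gt0.
Qed.

Lemma ramp_lin (c d t : R) : c < d -> (d - c)^-1 / 2 * (t - c) = 1 / 2 + (d - c)^-1 / 2 * (t - d).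
Proof. by move=> cd; field; lra. Qed.

Lemma ramp_ge (c d t : R) : c < d -> d <= t -> ramp c d t = flat 0 (expR (- 2)).
Proof.
move=> cd dt; apply: step_ge1; rewrite ramp_lin//.
have : 0 <= (d - c)^-1 / 2 * (t - d) by rewrite mulr_ge0 ?divr_ge0 ?invr_ge0; lra.
lra.
Qed.

Lemma dramp_ge0 (c d t : R) : c < d -> 0 <= dramp c d t.
Proof. by move=> cd; rewrite mulr_ge0 ?dstep_ge0// divr_ge0// invr_ge0 subr_ge0 ltW. Qed.

Lemma dramp_gt0 (c d t : R) : c < t < d -> 0 < dramp c d t.
Proof.
move=> /andP[ct td]; have cd := lt_trans ct td.
have q0 : 0 < (d - c)^-1 / 2 by rewrite divr_gt0// invr_gt0 subr_gt0.
apply: mulr_gt0 => //; apply: dstep_gt0; first by rewrite ltrDl mulr_gt0 ?subr_gt0.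
rewrite ramp_lin//; have : (d - c)^-1 / 2 * (t - d) < 0 by rewrite pmulr_rlt0 ?subr_lt0.
lra.
Qed.

Lemma dramp_out (c d t : R) : c < d -> ~~ (c < t < d) -> dramp c d t = 0.
Proof.
move=> cd ctd; have q0 : 0 < (d - c)^-1 / 2 by rewrite divr_gt0// invr_gt0 subr_gt0.
rewrite /dramp dstep_out ?mul0r//; case: (lerP t c) => tc.
  by rewrite gerDl pmulr_rle0 ?subr_le0// tc.
rewrite ramp_lin// addrA; move: ctd; rewrite tc/= -leNgt => dt.
apply/orP; right; have : 0 <= (d - c)^-1 / 2 * (t - d) by rewrite mulr_ge0 ?subr_ge0// ltW.
lra.
Qed.

Lemma smooth_affine_coord i (c k : R) : smooth (fun x : 'rV[R]_n => 1 / 2 + k * (x ord0 i - c)).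
Proof.
exact: (smoothD (smooth_cst _) (smoothZ k (smoothB (smooth_coord i) (smooth_cst c)))).
Qed.

Lemma smooth_ramp i (c d : R) : smooth (fun x : 'rV[R]_n => ramp c d (x ord0 i)).
Proof. exact: (smooth_step (smooth_affine_coord i c _)). Qed.

Lemma smooth_dramp i (c d : R) : smooth (fun x : 'rV[R]_n => dramp c d (x ord0 i)).
Proof. exact: (smoothM (smooth_dstep (smooth_affine_coord i c _)) (smooth_cst _)). Qed.

Lemma partial_ramp i (c d : R) :
  partial i (fun x : 'rV[R]_n => ramp c d (x ord0 i)) = fun x => dramp c d (x ord0 i).
Proof.
have s1 := smoothB (smooth_coord i) (smooth_cst c).
rewrite /ramp (partial_step _ (smooth_affine_coord i c _)).
rewrite (partialD _ (smooth_cst _) (smoothZ _ s1)) (partialZ _ _ s1).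
rewrite (partialB _ (smooth_coord i) (smooth_cst c)) !partial_cst partial_coord.
by apply/funext => x; rewrite /dramp; ring.
Qed.

Lemma partial_indep i (f : 'rV[R]_n -> R) :
  (forall x (t : R), f (t *: delta_mx ord0 i + x) = f x) -> partial i f = fun=> 0.
Proof.
move=> h; apply: partial_eq => x; apply/is_derive_lineP.
by rewrite (_ : (fun t : R => _) = cst (f x)); [exact: is_derive_cst|apply/funext => t; exact: h].
Qed.

(* Moving the mass of a bump from the box to the cube, one coordinate at a time. *)
Lemma transport (k : nat) (b c : 'I_n -> R) : (0 < k)%N ->
  (forall i, - k%:R <= b i) -> (forall i, b i < c i) -> (forall i, c i <= k%:R) ->
  exists (f f0 : 'rV[R]_n -> R) (g : 'I_n -> 'rV[R]_n -> R),
  [/\ [/\ smooth f, forall x, 0 <= f x, forall x, cube k x -> 0 < f x &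
          forall x, ~ cube k x -> f x = 0],
      forall x, ~ box b c x -> f0 x = 0,
      forall i, smooth (g i), forall i x, ~ cube k x -> g i x = 0 &
      forall x, f x = f0 x + \sum_i partial i (g i) x].
Proof.
move=> k0 kb bc ck; have K0 : (0 : R) < k%:R by rewrite ltr0n.
have KK : - k%:R < k%:R :> R by lra.
pose A i (x : 'rV[R]_n) := dramp (- k%:R) k%:R (x ord0 i).
pose B i (x : 'rV[R]_n) := dramp (b i) (c i) (x ord0 i).
(* A primitive of [A i - B i] in the coordinate i, zero outside the cube's range because both ramps
   have the same height. *)
pose S i (x : 'rV[R]_n) := ramp (- k%:R) k%:R (x ord0 i) - ramp (b i) (c i) (x ord0 i).
(* Interpolates between the bump of the box at j = 0 and that of the cube at j = n, changing one
   factor at a time; [P j] collects the factors left alone. *)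
pose F (j : nat) x := \prod_(i < n) (if (i < j)%N then A i x else B i x).
pose P (j : 'I_n) x := \prod_(i < n | i != j) (if (i < j)%N then A i x else B i x).
have sA i : smooth (A i) by exact: smooth_dramp.
have sB i : smooth (B i) by exact: smooth_dramp.
have sS i : smooth (S i) by exact: (smoothB (smooth_ramp _ _ _) (smooth_ramp _ _ _)).
have sAB (m : nat) i : smooth (fun x => if (i < m)%N then A i x else B i x).
  by case: (i < m)%N; [exact: sA|exact: sB].
have sF (j : nat) : smooth (F j) by apply: smooth_prod => i; exact: sAB.
have sP j : smooth (P j) by apply: smooth_prod => i; exact: sAB.
have ncube (x : 'rV[R]_n) : ~ cube k x -> exists i, ~~ (- k%:R < x ord0 i < k%:R).
  move=> h; apply: contrapT => /forallNP h'; apply: h => i.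
  by have := h' i; case: (_ < _ < _).
have nbox (x : 'rV[R]_n) : ~ box b c x -> exists i, ~~ (b i < x ord0 i < c i).
  move=> h; apply: contrapT => /forallNP h'; apply: h => i.
  by have := h' i; case: (_ < _ < _).
have Bout i (x : 'rV[R]_n) : ~~ (- k%:R < x ord0 i < k%:R) -> B i x = 0.
  move=> h; apply: dramp_out => //; apply: contra h => /andP[h1 h2].
  by rewrite (le_lt_trans (kb i) h1) (lt_le_trans h2 (ck i)).
have Aout i (x : 'rV[R]_n) : ~~ (- k%:R < x ord0 i < k%:R) -> A i x = 0 by exact: dramp_out.
have Sout i (x : 'rV[R]_n) : ~~ (- k%:R < x ord0 i < k%:R) -> S i x = 0.
  rewrite negb_and -!leNgt /S => /orP[] h.
    by rewrite !ramp_le ?subrr//; exact: le_trans (kb i).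
  by rewrite !ramp_ge ?subrr//; exact: le_trans (ck i) _.
have FE j (x : 'rV[R]_n) : F (val j) x = B j x * P j x.
  rewrite /F (bigD1 j)//= ltnn; congr (_ * _).
have FSE j (x : 'rV[R]_n) : F (val j).+1 x = A j x * P j x.
  rewrite /F (bigD1 j)//= ltnS leqnn; congr (_ * _); apply: eq_bigr => i ij.
  by have /negbTE h : i != j :> nat by []; rewrite ltnS leq_eqVlt h.
(* [P j] does not depend on the coordinate j, so only [S j] is differentiated. *)
have dP j (x : 'rV[R]_n) : partial j (fun x => P j x * S j x) x = F (val j).+1 x - F (val j) x.
  rewrite (partialM _ (sP j) (sS j)) FE FSE (partial_indep (f := P j)).
    rewrite mul0r add0r /S (partialB _ (smooth_ramp _ _ _) (smooth_ramp _ _ _)).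
    by rewrite !partial_ramp /A /B; ring.
  move=> y t; apply: eq_bigr => i ij; rewrite /A /B !mxE (negbTE ij) andbF mulr0 add0r.
  by [].
exists (F n), (F 0%N), (fun j x => P j x * S j x); split.
- split => //.
  + move=> x; apply: prodr_ge0 => i _.
    by case: ifP => _; exact: dramp_ge0.
  + move=> x xk; apply: prodr_gt0 => i _; rewrite ltn_ord.
    by apply: dramp_gt0; exact: xk.
  + move=> x /ncube[i xi]; rewrite /F (bigD1 i)//= ltn_ord Aout// mul0r.
    by [].
- by move=> x /nbox[i xi]; rewrite /F (bigD1 i)//= /B dramp_out// mul0r.
- by move=> j; exact: (smoothM (sP j) (sS j)).
- move=> j x /ncube[i xi]; have [<-|ij] := eqVneq i j; first by rewrite Sout// mulr0.
  rewrite /P (bigD1 i)//= (_ : (if _ then _ else _) = 0) ?mul0r//.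
  by case: ifP => _; [exact: Aout|exact: Bout].
- move=> x; rewrite (eq_bigr _ (fun j _ => dP j x)).
  rewrite -(big_mkord xpredT (fun j : nat => F j.+1 x - F j x)) telescope_sumr//.
  by rewrite addrC subrK.
Qed.

End transport.

Section level_estimate.
Context {R : realType} {n : nat}.
Implicit Types (w : 'rV[R]_n -> R).
Local Notation mu := (lebesgue_rV R n).
Local Notation enorm := (@euclidean_norm R n).

Lemma measurable_band w (e : R) k : smooth w ->
  measurable (cube k `&` [set x | e / 2 < w x < e]).
Proof.
move=> sw; apply: measurableI; first exact: mcube.
have := smooth_measurable sw measurableT (measurable_itv `]e / 2, e[).
by rewrite setTI; congr measurable; apply/seteqP; split => x /=; rewrite in_itv.
Qed.

Lemma measurable_below w (e : R) k : smooth w ->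
  measurable (cube k `&` [set x | w x < e]).
Proof.
move=> sw; apply: measurableI; first exact: mcube.
by have := smooth_measurable sw measurableT (measurable_itv `]-oo, e[); rewrite setTI set_itvNyo.
Qed.

(** After integration by parts the derivative falls on the step, whose gradient is at most |grad w|
    / e and lives on the band e/2 < w < e. Young's inequality with parameter c then trades the
    measure of the band against the p-th power integral. *)
Lemma integral_partial_step (p c e C : R) (k : nat) (j : 'I_n) w (g : 'rV[R]_n -> R) :
  1 <= p -> 0 < c -> 0 < e -> 0 <= C -> smooth w -> bsupp w -> smooth g ->
  (forall x, `|g x| <= C) -> (forall x, ~ cube k x -> g x = 0) ->
  (\int[mu]_x (step (e^-1 * w x) * partial j g x)%:E <=
   C%:E * (c%:E * mu (cube k `&` [set x | (e / 2 < w x < e)%R]) +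
     (c `^ (1 - p) * e^-1 `^ p)%:E *
     \int[mu]_(x in cube k `&` [set x | (w x < e)%R]) (enorm (grad w x) `^ p)%:E))%E.
Proof.
move=> p1 c0 e0 C0 sw bw sg gC gk.
set A := cube k `&` [set x | e / 2 < w x < e].
set A' := cube k `&` [set x | w x < e].
have mA : measurable A := measurable_band e k sw.
have mA' : measurable A' := measurable_below e k sw.
have sew := smoothZ e^-1 sw.
have sT := smooth_step sew.
have bT : bsupp (fun x => step (e^-1 * w x)).
  have [l hl] := bw; exists l => x /hl ->; rewrite mulr0 step_le0//; lra.
have sdT := smooth_partial j sT.
rewrite (integration_by_parts j sT sg bT).
have cA : 0 <= c `^ (1 - p) * e^-1 `^ p by rewrite mulr_ge0// powR_ge0.
set c' := c `^ (1 - p) * e^-1 `^ p in cA *.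
have mw' := measurable_grad_powR p sw.
have mI : measurable_fun setT (fun x => (enorm (grad w x) `^ p * \1_A' x)%:E).
  by apply/measurable_EFinP; apply: measurable_funM; [exact/measurable_EFinP|exact: measurable_indic].
have i0 x : setT x -> (0 <= (enorm (grad w x) `^ p * \1_A' x)%:E)%E.
  by move=> _; rewrite lee_fin mulr_ge0 ?powR_ge0.
have mJ : measurable_fun setT (fun x => (\1_A x : R)%:E).
  by apply/measurable_EFinP; exact: measurable_indic.
have j0 x : setT x -> (0 <= (\1_A x : R)%:E)%E by rewrite lee_fin.
have E1 : (\int[mu]_(x in A') (enorm (grad w x) `^ p)%:E =
    \int[mu]_x (enorm (grad w x) `^ p * \1_A' x)%:E)%E.
  rewrite integral_mkcond; apply: eq_integral => x _.
  by rewrite patchE indicE; case: ifP => _; rewrite ?mulr1 ?mulr0.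
have E2 : (mu A = \int[mu]_x (\1_A x : R)%:E)%E by rewrite integral_indic// setIT.
rewrite E1 E2 -(ge0_integralZl mu measurableT mI i0) ?lee_fin//.
rewrite -(ge0_integralZl mu measurableT mJ j0) ?lee_fin ?(ltW c0)//.
have cj0 x : setT x -> (0 <= c%:E * (\1_A x : R)%:E)%E.
  by move=> Tx; rewrite mule_ge0 ?j0// lee_fin ltW.
have ci0 x : setT x -> (0 <= c'%:E * (enorm (grad w x) `^ p * \1_A' x)%:E)%E.
  by move=> Tx; rewrite mule_ge0 ?i0.
have mcj := measurable_funeM c%:E mJ; have mci := measurable_funeM c'%:E mI.
rewrite -(ge0_integralD mu measurableT cj0 mcj ci0 mci).
have ms := emeasurable_funD mcj mci.
have s0 x : setT x -> (0 <= c%:E * (\1_A x : R)%:E + c'%:E * (enorm (grad w x) `^ p * \1_A' x)%:E)%E.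
  by move=> Tx; apply: adde_ge0; [exact: cj0|exact: ci0].
rewrite -(ge0_integralZl mu measurableT ms s0) ?lee_fin//.
have mdT : measurable_fun setT (EFin \o (fun x => partial j (fun x => step (e^-1 * w x)) x * g x)).
  by apply/measurable_EFinP; apply: measurable_funM; exact: smooth_measurable.
apply: (@le_trans _ _ (\int[mu]_x `|(partial j (fun x => step (e^-1 * w x)) x * g x)%:E|)%E).
  apply: le_trans (le_abse_integral mu measurableT mdT).
  by rewrite -abseN; exact: lee_abs.
apply: (ge0_le_integral mu measurableT) => //.
- exact: (measurableT_comp _ mdT).
- exact: (measurable_funeM _ ms).
move=> x _; rewrite (partial_step _ sew) (partialZ _ _ sw).
rewrite -(EFinM c) -(EFinM c') -EFinD -(EFinM C) abse_EFin lee_fin normrM mulrC.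
have [kx|/gk ->] := pselect (cube k x); last first.
  rewrite normr0 mul0r mulr_ge0// addr_ge0 ?mulr_ge0 ?powR_ge0 ?(ltW c0)//.
have [Ax|nAx] := pselect (A x); last first.
  rewrite dstep_out.
    rewrite mul0r normr0 mulr0 mulr_ge0// addr_ge0 ?mulr_ge0 ?powR_ge0 ?(ltW c0)//.
  apply: contrapT => /negP; rewrite negb_or -!ltNge => /andP[h1 h2]; apply: nAx; split => //=.
  have wE : w x = e * (e^-1 * w x) by rewrite mulrA divff ?mul1r// gt_eqF.
  rewrite wE; move: (e^-1 * w x) h1 h2 => s h1 h2.
  by apply/andP; split; [rewrite ltr_pM2l//; lra|rewrite gtr_pMr].
have A'x : A' x by case: Ax => ? /= /andP[].
rewrite !indicE (mem_set Ax) (mem_set A'x) !mulr1.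
apply: ler_pM => //.
rewrite normrM ger0_norm ?dstep_ge0//.
apply: (@le_trans _ _ (e^-1 * enorm (grad w x))).
  rewrite normrM ger0_norm ?invr_ge0 ?(ltW e0)//.
  apply: le_trans (_ : 1 * (e^-1 * `|partial j w x|) <= _).
    by rewrite ler_wpM2r ?dstep_le1// mulr_ge0// invr_ge0 ltW.
  rewrite mul1r ler_pM2l ?invr_gt0//.
  by have := ler_coord_enorm (grad w x) j; rewrite mxE.
have t0 : 0 <= e^-1 * enorm (grad w x) by rewrite mulr_ge0 ?invr_ge0 ?(ltW e0) ?enorm_ge0.
apply: le_trans (powR_young p1 c0 t0) _.
by rewrite powRM ?invr_ge0 ?(ltW e0) ?enorm_ge0// mulrA.
Qed.

(** In the decomposition of f given by [transport], the part living in the box is multiplied by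
    step(0) = 0, since w vanishes there. Only the divergence is left, and each of its terms falls
    under [integral_partial_step]. *)
Lemma level_estimate (k : nat) (b c : 'I_n -> R) : (0 < k)%N ->
  (forall i, - k%:R <= b i) -> (forall i, b i < c i) -> (forall i, c i <= k%:R) ->
  exists (f : 'rV[R]_n -> R) (B : R), [/\ smooth f, bsupp f, forall x, 0 <= f x <= B,
    forall x, cube k x -> 0 < f x &
    forall (p q e : R) w, 1 <= p -> 0 < q -> 0 < e -> smooth w -> bsupp w ->
      (forall x, box b c x -> w x = 0) ->
      (\int[mu]_x (step (e^-1 * w x) * f x)%:E <=
       B%:E * (q%:E * mu (cube k `&` [set x | (e / 2 < w x < e)%R]) +
         (q `^ (1 - p) * e^-1 `^ p)%:E *
         \int[mu]_(x in cube k `&` [set x | (w x < e)%R]) (enorm (grad w x) `^ p)%:E))%E].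
Proof.
move=> k0 kb bc ck; have [f [f0 [g [[sf fge0 fgt0 fk] f0b sg gk fE]]]] := transport k0 kb bc ck.
have bf : bsupp f by exists k.
have [Bf Bf0 hBf] := bsupp_bounded (smooth_continuous sf) bf.
have bg i : bsupp (g i) by exists k => x; exact: gk.
have /choice[C hC] : forall i, exists C : R, 0 <= C /\ forall x, `|g i x| <= C.
  by move=> i; have [C C0 hC] := bsupp_bounded (smooth_continuous (sg i)) (bg i); exists C.
have C0 i : 0 <= C i by have [] := hC i.
have SC0 : 0 <= \sum_i C i by apply: sumr_ge0.
exists f, (Bf + \sum_i C i); split => //.
  move=> x; rewrite fge0/=; have := hBf x; rewrite ger0_norm//; lra.
move=> p q e w p1 q0 e0 sw bw wb.
have sT := smooth_step (smoothZ e^-1 sw).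
have bT : bsupp (fun x => step (e^-1 * w x)).
  have [l hl] := bw; exists l => x /hl ->; rewrite mulr0 step_le0//; lra.
have TE x : step (e^-1 * w x) * f x = \sum_i step (e^-1 * w x) * partial i (g i) x.
  rewrite fE mulrDr mulr_sumr; have [/wb ->|/f0b ->] := pselect (box b c x).
    by rewrite mulr0 step_le0 ?mul0r ?add0r//; lra.
  by rewrite mulr0 add0r.
have iT i : mu.-integrable setT (EFin \o (fun x => step (e^-1 * w x) * partial i (g i) x)).
  apply: cbsupp_integrable; last exact: bsuppM.
  exact: smooth_continuous (smoothM sT (smooth_partial i (sg i))).
under eq_integral do rewrite TE -sumEFin.
rewrite (integral_sum measurableT iT).
set J := (q%:E * _ + _)%E.
have J0 : (0 <= J)%E.
  apply: adde_ge0; apply: mule_ge0 => //; rewrite ?lee_fin ?(ltW q0)//.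
    by rewrite mulr_ge0// powR_ge0.
  by apply: integral_ge0 => x _; rewrite lee_fin powR_ge0.
apply: (@le_trans _ _ (\sum_i ((C i)%:E * J))%E).
  apply: lee_sum => i _.
  exact: (integral_partial_step i p1 q0 e0 (C0 i) sw bw (sg i) (hC i).2 (gk i)).
rewrite -ge0_sume_distrl; last by move=> i _; rewrite lee_fin.
by rewrite sumEFin lee_wpmul2r// lee_fin lerDr.
Qed.

End level_estimate.

(** The sets 0 < |f| < 2s/(j+1) decrease to the empty set inside a set of finite measure. *)
Lemma small_level d (T : measurableType d) (R : realType) (mu : {measure set T -> \bar R})
    (D : set T) (f : T -> R) (s : R) : measurable D -> (mu D < +oo)%E ->
  measurable_fun D f -> 0 < s ->
  exists2 e : R, 0 < e <= s & (mu (D `&` [set x | (0 < `|f x| < 2 * e)%R]) <= s%:E)%E.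
Proof.
move=> mD Doo mf s0.
pose F (j : nat) := D `&` [set x | 0 < `|f x| < 2 * (s / j.+1%:R)].
have mF j : measurable (F j).
  have mnf : measurable_fun D (fun x => `|f x|) by exact: measurableT_comp.
  have := mnf mD _ (measurable_itv `]0, 2 * (s / j.+1%:R)[).
  by congr measurable; apply/seteqP; split => x [Dx] /=; rewrite in_itv.
have F0 : \bigcap_j F j = set0.
  apply/seteqP; split => // x h; have [_ /= /andP[fx _]] := h 0%N Logic.I.
  pose j := Num.bound (2 * s / `|f x|).
  have [_ /= /andP[_]] := h j Logic.I; apply/negP; rewrite -leNgt mulrA.
  rewrite ler_pdivrMr// (mulrC `|f x|) -ler_pdivrMr//.
  apply: le_trans (ltW (archi_boundP _)) _; last by rewrite ler_nat.
  by rewrite divr_ge0// mulr_ge0// ltW.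
have ni : nonincreasing_seq F.
  apply/nonincreasing_seqP => j; apply/subsetPset => x [Dx /= /andP[fx h]].
  split => //=; rewrite fx/=.
  apply: lt_le_trans h _; rewrite ler_pM2l// ler_pM2l// lef_pV2 ?posrE//.
  by rewrite ler_nat.
have Foo : (mu (F 0%N) < +oo)%E.
  by apply: le_lt_trans Doo; apply: le_measure; rewrite ?inE//; exact: subIsetl.
have := @nonincreasing_cvg_mu _ _ _ mu F Foo mF.
rewrite F0 measure0 => /(_ measurable0 ni) hl.
have [j hj] : exists j, (mu (F j) <= s%:E)%E.
  apply: contrapT => /forallNP h.
  have : (s%:E <= 0)%E.
    rewrite -(cvg_lim _ hl)//; apply: lime_ge; first by apply/cvg_ex; exists 0%E.
    by apply: nearW => j /=; rewrite leNgt; apply/negP => /ltW hj; apply: (h j).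
  by rewrite lee_fin leNgt s0.
exists (s / j.+1%:R) => //; rewrite divr_gt0//= ler_pdivrMr// ler_peMr ?(ltW s0)//.
by rewrite ler1n.
Qed.

(** * An open box outside an exterior domain *)

Section hole.
Context {R : realType} {n : nat}.
Variable Omega : set 'rV[R]_n.

Lemma continuous_col' (i : 'I_n) : continuous (fun y : 'rV[R]_n => col' i y).
Proof.
move=> y A /nbhs_ballP[e /= e0 eA]; apply/nbhs_ballP; exists e => //= z /(ballrVP _ _ e0) h.
by apply: eA; apply/(ballrVP _ _ e0) => j; rewrite !mxE.
Qed.

(** A boundary point x of the open domain is not in it, so x lies on or below the local graph.
    Moving by e/2 away from the epigraph gives a point strictly below the graph, and by continuity a
    whole box around it avoids the domain. *)
Lemma exterior_domain_hole : exterior_domain Omega ->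
  exists b c : 'I_n -> R, (forall i, b i < c i) /\ (forall x, box b c x -> ~ Omega x).
Proof.
move=> [oO _ _ [x bx] sO]; have [i [s [gamma [sg hx]]]] := sO x bx.
have nOx : ~ Omega x by move=> Ox; case: bx => _; apply; exact: oO.
have /nbhs_ballP[e /= e0 he] := hx.
pose z := x - (e / 2 * (-1) ^+ s) *: delta_mx ord0 i.
have zi : z ord0 i = x ord0 i - e / 2 * (-1) ^+ s by rewrite !mxE !eqxx mulr1.
have cz : col' i z = col' i x.
  by apply/rowP => j; rewrite !mxE [_ == i]eq_sym (negbTE (neq_lift i j)) andbF mulr0 subr0.
have s2 : (-1) ^+ s * (-1) ^+ s = 1 :> R by case: (s); rewrite ?expr0 ?expr1 ?mulr1 ?mulrNN ?mulr1.
pose h (y : 'rV[R]_n) := gamma (col' i y) - (-1) ^+ s * y ord0 i.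
have ch : {for z, continuous h}.
  have c1 : {for z, continuous (fun y : 'rV[R]_n => gamma (col' i y))}.
    by apply: continuous_comp; [exact: continuous_col'|exact: smooth_continuous].
  have c2 : {for z, continuous (fun y : 'rV[R]_n => (-1) ^+ s * y ord0 i)}.
    by apply: smooth_continuous; apply: smoothZ; exact: smooth_coord.
  by have := continuousB c1 c2; exact.
have hz : 0 < h z.
  have gx : (-1) ^+ s * x ord0 i <= gamma (col' i x).
    rewrite leNgt; apply/negP => gx; apply: nOx; exact: (nbhs_singleton hx).2.
  rewrite /h cz zi mulrBr (mulrCA _ (e / 2)) s2 mulr1; lra.
have zx : ball x e z.
  apply/(ballrVP _ _ e0) => j; rewrite !mxE opprB addrC subrK.
  rewrite eqxx/=; case: (j == i); last by rewrite mulr0 normr0.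
  rewrite mulr1 normrM normrX normrN1 expr1n mulr1 ger0_norm; lra.
have hn : \forall y \near z, ball x e y /\ 0 < h y.
  apply: filterI; first by apply: open_nbhs_nbhs; split => //; exact: ball_open.
  exact: (cvgr_gt (h z) ch _ hz).
have /nbhs_ballP[d /= d0 hd] := hn.
exists (fun j => z ord0 j - d), (fun j => z ord0 j + d); split; first by move=> j; lra.
move=> y yz Oy; have [|yx] := hd y.
  by apply/(ballrVP _ _ d0) => j; have := yz j; rewrite ltr_norml; lra.
rewrite /h subr_gt0 ltNge => /negP; apply.
by apply: ltW; exact: (he y yx).1.
Qed.

End hole.

Lemma level_arith (R : realType) (T B C q s Q : R) : 0 < T -> 0 <= B -> 0 <= C ->
  0 <= q -> 0 <= s -> 0 <= Q ->
  B * (q * (s + s) + Q * C) + T * B * s <=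
  T * ((T^-1 * (B * (C + 1)) + B) * (s * (2 * q + 1) + Q)).
Proof.
move=> T0 B0 C0 q0 s0 Q0.
have -> : T * ((T^-1 * (B * (C + 1)) + B) * (s * (2 * q + 1) + Q)) =
    (B * (C + 1) + T * B) * (s * (2 * q + 1) + Q) by field; rewrite gt_eqF.
have x1 : 0 <= B * C * (s * (2 * q + 1)) by rewrite !mulr_ge0//; lra.
have x2 : 0 <= T * B * (s * (2 * q) + Q).
  by rewrite !mulr_ge0 ?(ltW T0)// addr_ge0// !mulr_ge0//; lra.
have x3 : 0 <= B * s by rewrite mulr_ge0.
have x4 : 0 <= B * Q by rewrite mulr_ge0.
lra.
Qed.

(** * Vanishing of a minimizer on every cube *)

Section vanishing.
Context {R : realType} {n : nat}.
Variable Omega : set 'rV[R]_n.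
Local Notation mu := (lebesgue_rV R n).
Local Notation enorm := (@euclidean_norm R n).
Hypotheses (oO : open Omega) (bO : bounded_set (~` Omega)) (n0 : (0 < n)%N).
Let mO : measurable Omega := open_measurable_rV oO.
Variables (p r a b G : R) (u : 'rV[R]_n -> R).
Hypotheses (p1 : 1 < p) (pr : p <= r) (a0 : 0 < a) (Wu : W01p Omega p u).
Hypotheses
  (ua : (\int[mu]_(x in Omega) (`|u x| `^ p)%:E = a%:E)%E)
  (ub : (\int[mu]_(x in Omega) (`|u x| `^ r)%:E = b%:E)%E)
  (uG : (\int[mu]_(x in Omega) (enorm (weak_gradient Omega u x) `^ p)%:E = G%:E)%E)
  (hmin : min_energy Omega p r a = (G / p - b / r)%:E).
Variables (k : nat) (l m : 'I_n -> R).
Hypotheses (k0 : (0 < k)%N) (kl : forall i, - k%:R <= l i) (lm : forall i, l i < m i)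
  (mk : forall i, m i <= k%:R) (lmO : forall x, box l m x -> ~ Omega x).

Let mu_ : measurable_fun Omega u. Proof. exact: W01p_measurable Wu. Qed.

Let measurable_level (t : R) : measurable (Omega `&` [set x | 2 * t <= `|u x|]).
Proof.
have mnu : measurable_fun Omega (fun x => `|u x|) by exact: measurableT_comp.
by have := mnu mO _ (measurable_itv `[2 * t, +oo[); rewrite set_itvcy.
Qed.

(** q is the parameter of Young's inequality and s bounds the measure of two bad sets: the part of
    the cube where |u| is small but nonzero, and the set where w is far from |u|. The point is that
    f and B do not depend on t, s and q. *)
Lemma level_set_estimate : exists (f : 'rV[R]_n -> R) (B : R),
  [/\ smooth f, bsupp f, forall x, 0 <= f x <= B, forall x, cube k x -> 0 < f x &
    forall t s q : R, 0 < t -> 0 < s -> 0 < q ->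
      (\int[mu]_x (f x * \1_(Omega `&` [set x | (2 * t <= `|u x|)%R]) x)%:E <=
        (B * (s * (2 * q + 1) + q `^ (1 - p)))%:E)%E].
Proof.
have p0 : 0 < p := lt_trans ltr01 p1.
have b0 : 0 <= b by rewrite -lee_fin -ub; apply: integral_ge0 => x _; rewrite lee_fin powR_ge0.
have G0 : 0 <= G by rewrite -lee_fin -uG; apply: integral_ge0 => x _; rewrite lee_fin powR_ge0.
have [f [B [sf bf fB f0 hf]]] := level_estimate k0 kl lm mk.
have B0 : 0 <= B by have /andP[h1 h2] := fB 0; exact: le_trans h2.
have [C C0 hC] := minimizer_small_gradient oO bO n0 k (ltW p1) pr a0 b0 G0 hmin.
pose T1 : R := flat 0 (expR (- 2)).
have T10 : 0 < T1 by apply: flat_gt0; exact: expR_gt0.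
exists f, (T1^-1 * (B * (C + 1)) + B); split => //.
  move=> x; have /andP[-> h] := fB x; apply: le_trans h _.
  by rewrite /= lerDr mulr_ge0 ?invr_ge0 ?(ltW T10)// mulr_ge0// addr_ge0.
move=> t s q t0 s0 q0.
(* The level e found below satisfies e <= s'. The bound t makes |u| >= 2t imply w >= e wherever w is
   within e/2 of |u|; the bound 1 is required by [minimizer_small_gradient]. *)
pose s' := Num.min s (Num.min t 1).
have s'0 : 0 < s' by rewrite !lt_min s0 t0 ltr01.
have [s's s't s'1] : [/\ s' <= s, s' <= t & s' <= 1].
  by split; rewrite /s' !ge_min lexx ?orbT.
have mOk : measurable (Omega `&` cube k) by apply: measurableI => //; exact: mcube.
have Ok : (mu (Omega `&` cube k) < +oo)%E.
  apply: le_lt_trans (mu_cube k); apply: le_measure; rewrite ?inE//; exact: mcube.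
have muk : measurable_fun (Omega `&` cube k) u.
  by apply: measurable_funS mu_ => //; exact: subIsetl.
have [e /andP[e0 es'] he] := small_level mOk Ok muk s'0.
clearbody s'.
have ep : 0 < e `^ p by rewrite powR_gt0.
have e2p : 0 < (e / 2) `^ p by rewrite powR_gt0//; lra.
(* The first two bounds are those of [minimizer_small_gradient]; the third lets Chebyshev's
   inequality bound by s' the measure of the set where w is farther than e/2 from |u|. *)
pose d := Num.min (e `^ p) (Num.min (a / 2) (s' * (e / 2) `^ p)).
have d0 : 0 < d by rewrite !lt_min ep (mulr_gt0 s'0 e2p) divr_gt0.
have [dep da ds] : [/\ d <= e `^ p, d <= a / 2 & d <= s' * (e / 2) `^ p].
  by split; rewrite /d !ge_min lexx ?orbT.
clearbody d.
have [w [tw w0 [wa wb] wG wu]] := W01p_approx_ge0 oO p0 pr d0 Wu ua ub uG.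
have [sw _ _] := tw; have bw := test_bsupp tw.
have e1 : e <= 1 by exact: le_trans s'1.
have hI := hC e d w e0 e1 d0 dep da tw w0 wa wb wG.
have wlm x : box l m x -> w x = 0 by move=> /lmO; exact: test_out tw.
have {hf} hT := hf p q e w (ltW p1) q0 e0 sw bw wlm.
have mw : measurable_fun Omega w by apply: measurable_funTS; exact: smooth_measurable.
have mnu : measurable_fun Omega (fun x => `|u x|) by exact: measurableT_comp.
have mh : measurable_fun Omega (fun x => `|u x| - w x) by exact: measurable_funB.
pose Z := Omega `&` [set x | e / 2 < `| `|u x| - w x|].
have mZ : measurable Z.
  have mnh : measurable_fun Omega (fun x => `| `|u x| - w x|) by exact: measurableT_comp.
  by have := mnh mO _ (measurable_itv `]e / 2, +oo[); rewrite set_itvoy.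
have e20 : 0 < e / 2 by lra.
have muZ : (mu Z <= s%:E)%E.
  apply: (@le_trans _ _ s'%:E); last by rewrite lee_fin.
  have e2p' : (0 < ((e / 2) `^ p)%:E)%E by rewrite lte_fin.
  rewrite -(@lee_pmul2l _ ((e / 2) `^ p)%:E)//.
  apply: le_trans (chebyshev mu mO mh p0 e20) _.
  by apply: le_trans wu _; rewrite -EFinM lee_fin mulrC.
have muA : (mu (cube k `&` [set x | (e / 2 < w x < e)%R]) <= (s + s)%:E)%E.
  (* Off [Z], e/2 < w < e gives 0 < |u| < 3e/2; and w > 0 puts the point in the domain. *)
  pose L := (Omega `&` cube k) `&` [set x | 0 < `|u x| < 2 * e].
  have mL : measurable L.
    have mnk : measurable_fun (Omega `&` cube k) (fun x => `|u x|) by exact: measurableT_comp.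
    have := mnk mOk _ (measurable_itv `]0, 2 * e[).
    by congr measurable; apply/seteqP; split => x [Dx] /=; rewrite in_itv.
  apply: (@le_trans _ _ (mu (L `|` Z))).
    apply: le_measure; rewrite ?inE; [exact: measurable_band|exact: measurableU|].
    move=> x [kx /= /andP[w1 w2]].
    have Ox : Omega x.
      by apply: contrapT => nOx; move: w1; rewrite (test_out tw nOx); lra.
    case: (ltP (e / 2) `| `|u x| - w x|) => h; [by right|left; split => //=].
    by move: h; rewrite ler_norml; lra.
  apply: le_trans (measureU2 _ mL mZ) _; rewrite EFinD; apply: leeD => //.
  by apply: le_trans he _; rewrite lee_fin.
pose S0 := Omega `&` [set x | 2 * t <= `|u x|].
have mS0 : measurable S0 := measurable_level t.
have sT := smooth_step (smoothZ e^-1 sw).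
(* On the level set the step has reached its height [T1], except on [Z], where the crude bound f <=
   B suffices. *)
have h1 : (\int[mu]_x (T1 * (f x * \1_S0 x))%:E + 0%:E * \int[mu]_x (cst (0 : R) x)%:E <=
   \int[mu]_x (step (e^-1 * w x) * f x)%:E + (T1 * B)%:E * \int[mu]_x (\1_Z x)%:E)%E.
  have mf := smooth_measurable sf.
  apply: ge0_le_integral_combination => //.
  - by rewrite mulr_ge0 ?(ltW T10).
  - apply/measurable_EFinP; apply: measurable_funM; first exact: measurable_cst.
    by apply: measurable_funM => //; exact: measurable_indic.
  - by apply/measurable_EFinP; exact: measurable_cst.
  - by apply/measurable_EFinP; apply: measurable_funM => //; exact: smooth_measurable.
  - by apply/measurable_EFinP; exact: measurable_indic.
  - by move=> x; have /andP[fx _] := fB x; rewrite !mulr_ge0 ?(ltW T10).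
  - by move=> x; have /andP[fx _] := fB x; rewrite mulr_ge0 ?step_ge0.
  - move=> x; have /andP[fx fBx] := fB x; rewrite mulr0 addr0 !indicE.
    have st0 : 0 <= step (e^-1 * w x) * f x by rewrite mulr_ge0 ?step_ge0.
    have TB0 : 0 <= T1 * B by rewrite mulr_ge0 ?(ltW T10).
    have [/set_mem[Ox /= ux]|_] := boolP (x \in S0); last first.
      by rewrite !mulr0 addr_ge0// mulr_ge0.
    rewrite mulr1; have [Zx|Zx] := boolP (x \in Z).
      rewrite mulr1; apply: (@le_trans _ _ (T1 * B)); first by rewrite ler_pM2l.
      by rewrite lerDr.
    rewrite mulr0 addr0 step_ge1//.
    have h : `| `|u x| - w x| <= e / 2.
      by rewrite leNgt; apply: contra Zx => h; rewrite inE.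
    rewrite mulrC ler_pdivlMr// mul1r; move: h; rewrite ler_norml; lra.
rewrite mul0e adde0 in h1.
rewrite (_ : (\int[mu]_x (\1_Z x)%:E)%E = mu Z) in h1; last by rewrite integral_indic// setIT.
have h2 : (\int[mu]_x (T1 * (f x * \1_S0 x))%:E <=
    (B * (q * (s + s) + q `^ (1 - p) * C) + T1 * B * s)%:E)%E.
  apply: le_trans h1 _; rewrite EFinD; apply: leeD; last first.
    by rewrite [in leRHS]EFinM; apply: lee_wpmul2l => //; rewrite lee_fin mulr_ge0 ?(ltW T10).
  apply: le_trans hT _; rewrite [in leRHS]EFinM; apply: lee_wpmul2l; first by rewrite lee_fin.
  rewrite EFinD; apply: leeD.
    by rewrite [in leRHS]EFinM; apply: lee_wpmul2l => //; rewrite lee_fin ltW.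
  have qe : 0 <= q `^ (1 - p) * e^-1 `^ p by rewrite mulr_ge0// powR_ge0.
  apply: (@le_trans _ _ ((q `^ (1 - p) * e^-1 `^ p)%:E * (C * e `^ p)%:E)%E).
    by apply: lee_wpmul2l => //; rewrite lee_fin.
  rewrite -EFinM lee_fin le_eqVlt; apply/orP; left; apply/eqP.
  have ee : e^-1 `^ p * e `^ p = 1.
    by rewrite -powRM ?invr_ge0 ?(ltW e0)// mulVf ?powR1// gt_eqF.
  by rewrite -mulrA (mulrCA _ C) ee mulr1.
have mfS : measurable_fun setT (fun x => (f x * \1_S0 x)%:E).
  apply/measurable_EFinP; apply: measurable_funM; first exact: smooth_measurable.
  exact: measurable_indic.
have fS0 x : setT x -> (0 <= (f x * \1_S0 x)%:E)%E.
  by move=> _; have /andP[fx _] := fB x; rewrite lee_fin mulr_ge0.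
have T10e : (0 < T1%:E)%E by rewrite lte_fin.
rewrite -(@lee_pmul2l _ T1%:E)//.
rewrite -(ge0_integralZl mu measurableT mfS fS0) ?lee_fin ?(ltW T10)//.
apply: le_trans h2 _; rewrite -EFinM lee_fin.
have qp : 0 <= q `^ (1 - p) by rewrite powR_ge0.
by apply: level_arith => //; exact: ltW.
Qed.

Lemma level_set_negligible (t : R) : 0 < t ->
  mu.-negligible (cube k `&` (Omega `&` [set x | 2 * t <= `|u x|])).
Proof.
move=> t0; have [f [B [sf bf fB f0 hf]]] := level_set_estimate.
set S0 := Omega `&` _ in hf *.
have mS0 : measurable S0 := measurable_level t.
have mfS : measurable_fun setT (fun x => (f x * \1_S0 x)%:E).
  apply/measurable_EFinP; apply: measurable_funM; first exact: smooth_measurable.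
  exact: measurable_indic.
have fS0 x : 0 <= f x * \1_S0 x by have /andP[fx _] := fB x; rewrite mulr_ge0.
have B0 : 0 <= B by have /andP[h1 h2] := fB 0; exact: le_trans h2.
have I0 : (\int[mu]_x (f x * \1_S0 x)%:E <= 0)%E.
  apply/lee_addgt0Pr => z z0; rewrite add0e.
  (* Both terms of the estimate are made equal to y: first q by q^(1-p) = y, possible as p differs
     from 1, and then s by s (2q + 1) = y. *)
  pose y := z / (2 * (B + 1)).
  have y0 : 0 < y by rewrite divr_gt0// mulr_gt0//; lra.
  have yB : B * y <= z / 2.
    have : y * (2 * (B + 1)) = z by rewrite divfK//; lra.
    by move=> h; lra.
  pose q := y `^ (1 - p)^-1.
  have q0 : 0 < q by rewrite powR_gt0.
  have qE : q `^ (1 - p) = y.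
    by rewrite /q -powRrM mulVf ?powRr1 ?(ltW y0)// subr_eq0 lt_eqF.
  pose s := y / (2 * q + 1).
  have s0 : 0 < s by rewrite divr_gt0//; lra.
  have sE : s * (2 * q + 1) = y by rewrite divfK//; lra.
  apply: le_trans (hf t s q t0 s0 q0) _.
  by rewrite lee_fin sE qE; lra.
have I0' : (\int[mu]_x `|(f x * \1_S0 x)%:E| = 0)%E.
  apply/eqP; rewrite eq_le integral_ge0// andbT; apply: le_trans I0.
  rewrite le_eqVlt; apply/orP; left; apply/eqP; apply: eq_integral => x _.
  by rewrite abse_EFin ger0_norm.
have /ae_eq_integral_abs := I0'.
move=> /(_ measurableT mfS).
rewrite /ae_eq /almost_everywhere; apply: negligibleS => x [kx Sx] /= /(_ Logic.I) [] /eqP.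
by rewrite indicE mem_set// mulr1 gt_eqF// f0.
Qed.

End vanishing.

Lemma vectors_cube (R : realType) n (v : 'I_n -> R) :
  exists k, forall l, (k <= l)%N -> forall i, `|v i| <= l%:R.
Proof.
have : [set: 'rV[R]_n] (\row_i v i) by [].
rewrite -bigcup_box => -[k _ vk]; exists k => l kl i.
have /cubeP/(_ i) := vk; rewrite mxE => h; apply: le_trans (ltW h) _.
by rewrite ler_nat.
Qed.

Theorem theorem1p1 (R : realType) (N : nat) (p r a : R) (Omega : set 'rV[R]_N) :
  (3 <= N)%N -> 2 <= p -> p < N%:R -> p < r -> r < p + p ^+ 2 / N%:R -> 0 < a ->
  exterior_domain Omega ->
  ~ exists2 u, sphere Omega p a u & energy Omega p r u = min_energy Omega p r a.
Proof.
move=> N3 p2 _ pr rq a0 ext [u [Wu ua] hE].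
have [oO _ bO _ _] := ext.
have n0 : (0 < N)%N by exact: leq_trans N3.
have p1 : 1 < p by lra.
have p1' := ltW p1; have p0 : 0 < p by lra.
have r0 := lt_trans p0 pr.
have Aoo : (\int[lebesgue_rV R N]_(x in Omega) (`|u x| `^ p)%:E < +oo)%E by rewrite ua ltry.
have boo := W01p_embedding oO p1' n0 pr rq Wu Aoo.
have Goo := W01p_dirichlet_lty oO p0 Wu.
have [b _ ub] := fin_integral_powR boo; have [G _ uG] := fin_integral_powR Goo.
(* Finiteness of the L^r norm enters here: the minimal energy becomes a difference of real
   numbers. *)
have hmin : min_energy Omega p r a = (G / p - b / r)%:E.
  by rewrite -hE /energy uG ub -!EFinM -EFinB; congr (_%:E); ring.
have [l [m [lm lmO]]] := exterior_domain_hole ext.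
have [k1 hk1] := vectors_cube l; have [k2 hk2] := vectors_cube m.
pose k := (k1 + k2).+1.
(* k is positive and large enough for every cube [k + j] to contain the box outside the domain,
   while these cubes exhaust the space. *)
have neg (j : nat) (t : R) : 0 < t -> (lebesgue_rV R N).-negligible
    (cube (k + j) `&` (Omega `&` [set x | 2 * t <= `|u x|])).
  move=> t0; have kj : (k1 <= k + j)%N /\ (k2 <= k + j)%N by rewrite /k addSn -addnA; split; apply: leqW;
    [exact: leq_addr|rewrite addnCA; exact: leq_addr].
  apply: (level_set_negligible oO bO n0 p1 (ltW pr) a0 Wu ua ub uG hmin _ _ lm _ lmO t0).
  - by rewrite /k.
  - by move=> i; have := hk1 _ kj.1 i; rewrite ler_norml => /andP[].
  - by move=> i; have := hk2 _ kj.2 i; rewrite ler_norml => /andP[].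
have u0 : {ae lebesgue_rV R N, forall x, Omega x -> (`|u x| `^ p)%:E = cst 0%E x :> \bar R}.
  (* A point with u x nonzero lies in some cube and satisfies |u x| >= 2/(i+1) for some i: countably
     many negligible sets cover the set where u does not vanish. *)
  apply: (negligibleS _ (negligible_bigcup (fun j => negligible_bigcup
    (fun i => neg j (i.+1%:R^-1) _)))); last by move=> j i; rewrite invr_gt0.
  move=> x /= /not_implyP[Ox ux].
  have uxp : 0 < `|u x|.
    by rewrite normr_gt0; apply/eqP => h; apply: ux; rewrite h normr0 powR0// gt_eqF.
  have [j hj] := vectors_cube (fun i => x ord0 i).
  exists j.+1 => //; exists (Num.bound (2 / `|u x|)) => //; split.
    apply/cubeP => i; apply: le_lt_trans (hj j (leqnn j) i) _.
    by rewrite ltr_nat /k addnS ltnS leq_addl.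
  split => //=; rewrite ler_pdivrMr// mulrC -ler_pdivrMr//.
  apply: le_trans (ltW (archi_boundP _)) _; first by rewrite divr_ge0.
  by rewrite ler_nat.
have mO := open_measurable_rV oO.
have I0 : (\int[lebesgue_rV R N]_(x in Omega) (`|u x| `^ p)%:E =
    \int[lebesgue_rV R N]_(x in Omega) cst 0 x)%E.
  apply: ae_eq_integral => //.
  exact: measurable_abs_powR (W01p_measurable Wu).
by move: a0; rewrite -lte_fin -ua I0 integral0 ltxx.
Qed.
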